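(* Let $X$ be an irreducible shift of finite type (SFT) with positive entropy $\mathbf{h}(X)=\log\lambda$. For $n\in\mathbb{N}$ let $W_n\subset\Omega_n$ be the event that the random SFT $X_\omega$ has a unique irreducible component $C$ of positive entropy and $C$ has the same period as $X$. Then there exists $c>0$ such that for every $\alpha$ with $1-c<\alpha\le1$, $$\lim_{n\to\infty}\mathbb{P}_\alpha(W_n)=1;$$ furthermore, the convergence to this limit is exponential in $n$ (i.e. there are $K,\rho>0$ with $1-\mathbb{P}_\alpha(W_n)\le Ke^{-\rho n}$ for all sufficiently large $n$).
   Context: SFTs. Let $\mathcal{A}$ be a finite alphabet and $\sigma$ the left shift on $\mathcal{A}^{\mathbb{Z}}$ (product of discrete topologies). For a finite set $\mathcal{F}$ of finite words over $\mathcal{A}$, $X(\mathcal{F})$ is the set of $x\in\mathcal{A}^{\mathbb{Z}}$ in which no word of $\mathcal{F}$ appears; a shift of finite type (SFT) is a set $X$ of the form $X(\mathcal{F})$ with $\mathcal{F}$ finite. $B_n(X)$ is the set of words of length $n$ appearing in some $x\in X$. The entropy of $X$ is $\mathbf{h}(X)=\lim_n\frac1n\log|B_n(X)|$. An SFT $X$ is irreducible if for all nonempty open $U,V\subset X$ and every $N$ there is $n\ge N$ with $\sigma^n(U)\cap V\ne\varnothing$. An irreducible component of an SFT $X$ is a nonempty, maximal SFT contained in $X$ that is irreducible. The period of an SFT is the greatest common divisor of the sizes of all its periodic orbits. Random SFTs. $\Omega_n$ is the power set of $B_n(X)$. For $\alpha\in[0,1]$, $\mathbb{P}_\alpha$ is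 the probability measure on $\Omega_n$ obtained by including each word of $B_n(X)$ in the random subset $\omega$ independently with probability $\alpha$ (the dependence of $\mathbb{P}_\alpha$ on $n$ is suppressed). To $\omega\in\Omega_n$ one associates the SFT $X_\omega$ of all $x\in X$ such that every word of length $n$ appearing in $x$ belongs to $\omega$. *)

(* Defs.v *)
From HB Require Import structures.
From mathcomp Require Import all_boot all_order all_algebra.
From mathcomp Require Import all_classical all_reals all_analysis.

Set Implicit Arguments.
Unset Strict Implicit.
Unset Printing Implicit Defensive.

Import Order.TTheory GRing.Theory Num.Theory.
Import numFieldNormedType.Exports.

Local Open Scope classical_set_scope.
Local Open Scope ring_scope.

Definition full_shift (A : finType) : Type :=
  prod_topology (fun _ : int => discrete_topology A).

HB.instance Definition _ (A : finType) := Topological.copy (full_shift A)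
  (prod_topology (fun _ : int => discrete_topology A)).

(* The k-th power of the left shift, for every integer k. *)
Definition shift (A : finType) (k : int) (x : full_shift A) : full_shift A :=
  fun i => x (i + k).

Definition subword (A : finType) (x : full_shift A) (i : int) (n : nat) :
    seq A :=
  mkseq (fun k => x (i + k%:Z) : A) n.

Definition appears (A : finType) (w : seq A) (x : full_shift A) : Prop :=
  exists i : int, subword x i (size w) = w.

Definition forbidding (A : finType) (F : seq (seq A)) : set (full_shift A) :=
  [set x | forall w, w \in F -> ~ appears w x].

Definition is_sft (A : finType) (X : set (full_shift A)) : Prop :=
  exists F : seq (seq A), X = forbidding F.

Definition language (A : finType) (n : nat) (X : set (full_shift A)) :
    {set n.-tuple A} :=
  finset (fun w : n.-tuple A => `[< exists2 x, X x & appears w x >]).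

Definition entropy (R : realType) (A : finType) (X : set (full_shift A)) : R :=
  limn (fun n : nat => ln (#|language n X|%:R : R) / n%:R).

Definition open_in (T : topologicalType) (X U : set T) : Prop :=
  exists2 O : set T, open O & U = X `&` O.

Definition irreducible_sft (A : finType) (X : set (full_shift A)) : Prop :=
  is_sft X /\
  forall U V : set (full_shift A),
    open_in X U -> open_in X V -> U !=set0 -> V !=set0 ->
    forall N : nat, exists2 n : nat,
      (N <= n)%N & (shift n%:Z @` U) `&` V !=set0.

Definition irreducible_component (A : finType) (X C : set (full_shift A)) :
    Prop :=
  [/\ C !=set0, C `<=` X, irreducible_sft C &
      forall D : set (full_shift A),
        D !=set0 -> D `<=` X -> irreducible_sft D -> C `<=` D -> D = C].

Definition shift_orbit (A : finType) (x : full_shift A) : set (full_shift A) :=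
  range (fun k : int => shift k x).

Definition periodic_point (A : finType) (x : full_shift A) : Prop :=
  exists2 p : nat, (0 < p)%N & shift p%:Z x = x.

Definition periodic_orbit_sizes (A : finType) (X : set (full_shift A)) :
    set nat :=
  [set p | exists x, [/\ X x, periodic_point x & (shift_orbit x #= `I_p)%card]].

Definition is_gcd (S : set nat) (d : nat) : Prop :=
  (forall s, S s -> (d %| s)%N) /\
  (forall e, (forall s, S s -> (e %| s)%N) -> (e %| d)%N).

(* As for gcdn, the gcd of a set contained in {0} is 0. *)
Definition gcd_set (S : set nat) : nat := xget 0%N (is_gcd S).

Lemma gcd_setP (S : set nat) : is_gcd S (gcd_set S).
Proof.
rewrite /gcd_set; case: xgetP => [d -> //|noG]; exfalso.
have [[s [Ss s0]]|S0] := pselect (exists s, S s /\ (0 < s)%N); last first.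
  apply: (noG 0%N); split=> [s Ss|e _]; last exact: dvdn0.
  by case: s Ss => // s Ss; case: S0; exists s.+1.
(* d is the least positive gcd of a finite list of elements of S. *)
pose P d := `[< (0 < d)%N /\ exists l : seq nat,
  (forall t, t \in l -> S t) /\ d = \big[gcdn/0%N]_(t <- l) t >].
have exP : exists d, P d.
  exists s; apply/asboolP; split=> //; exists [:: s]; split.
    by move=> t; rewrite inE => /eqP->.
  by rewrite big_seq1.
case: (ex_minnP exP) => d /asboolP[d0 [l [lS dE]]] dmin.
apply: (noG d); split=> [t St|e eS].
  have g0 : (0 < gcdn t d)%N by rewrite gcdn_gt0 d0 orbT.
  have : P (gcdn t d).
    apply/asboolP; split=> //; exists (t :: l); split.
      by move=> u; rewrite inE => /predU1P[->//|/lS].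
    by rewrite big_cons dE.
  move=> /dmin le; have := dvdn_gcdl t d.
  by have /eqP-> : gcdn t d == d by rewrite eqn_leq le dvdn_leq ?dvdn_gcdr.
rewrite dE big_seq; elim/big_ind: _ => //[m n em en|t /lS /eS //].
by rewrite dvdn_gcd em en.
Qed.

Definition period (A : finType) (X : set (full_shift A)) : nat :=
  gcd_set (periodic_orbit_sizes X).

Definition Omega (A : finType) (X : set (full_shift A)) (n : nat) :
    {set {set n.-tuple A}} :=
  powerset (language n X).

Definition subset_weight (R : realType) (A : finType) (X : set (full_shift A))
    (n : nat) (alpha : R) (w : {set n.-tuple A}) : R :=
  \prod_(b in language n X) (if b \in w then alpha else 1 - alpha).

Definition prob (R : realType) (A : finType) (X : set (full_shift A))
    (n : nat) (alpha : R) (E : set {set n.-tuple A}) : R :=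
  \sum_(w in Omega X n | `[< E w >]) subset_weight X alpha w.

(* Every finite family of words is included with the product probability; for
   S empty this is the total mass. *)
Lemma prob_include (R : realType) (A : finType) (X : set (full_shift A))
    (n : nat) (alpha : R) (S : {set n.-tuple A}) :
  S \subset language n X ->
  prob X alpha [set w : {set n.-tuple A} | S \subset w] = alpha ^+ #|S|.
Proof.
move=> SL; set L := language n X in SL *.
pose F b : R := if b \in L then alpha else 0.
pose G b : R := if b \in S then 0 else if b \in L then 1 - alpha else 1.
transitivity (\prod_b (F b + G b)).
  rewrite bigA_distr /prob /Omega -/L big_mkcond /=; apply: eq_bigr => w _.
  rewrite powersetE asboolb; have [wL|/subsetPn[b bw bL]] := boolP (w \subset L).
    have [Sw|/subsetPn[b bS bw]] /= := boolP (S \subset w); last first.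
      by rewrite (bigD1 b) //= (negPf bw) /G bS mul0r.
    rewrite /subset_weight -/L big_mkcond /=; apply: eq_bigr => b _.
    rewrite /F /G; have [bw|bw] := ifPn (b \in w).
      by rewrite (fintype.subsetP wL _ bw).
    by rewrite (negPf (contra (fintype.subsetP Sw b) bw)).
  by rewrite (bigD1 b) //= bw /F (negPf bL) mul0r.
rewrite -prodr_const big_mkcond /= [RHS]big_mkcond /=; apply: eq_bigr => b _.
rewrite /F /G; have [bS|bS] := ifPn (b \in S).
  by rewrite (fintype.subsetP SL _ bS) addr0.
by case: ifP => _; rewrite ?add0r // addrC subrK.
Qed.

Definition random_sft (A : finType) (X : set (full_shift A)) (n : nat)
    (w : {set n.-tuple A}) : set (full_shift A) :=
  [set x | X x /\ forall b : n.-tuple A, appears b x -> b \in w].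

Definition unique_component_event (R : realType) (A : finType)
    (X : set (full_shift A)) (n : nat) : set {set n.-tuple A} :=
  [set w | w \in Omega X n /\
    exists C : set (full_shift A),
      [/\ irreducible_component (random_sft X w) C,
          0 < entropy R C,
          forall D, irreducible_component (random_sft X w) D ->
            0 < entropy R D -> D = C &
          period C = period X]].

Arguments unique_component_event R {A} X n.

(* Main.v *)
From HB Require Import structures.
From mathcomp Require Import all_boot all_order all_algebra.
From mathcomp Require Import all_classical all_reals all_analysis.
From mathcomp Require Import zify ring lra.
Require Import Defs.

(** The words of length n of X are the edges of a graph, and the random SFT deletes each edge
    with probability 1 - alpha. An irreducible component of positive entropy contains a word of
    length 4Q, Q proportional to n, that has no period <= Q; otherwise its words of every length
    would be determined by a period and a bounded prefix. Extend such a word in its component to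
    a word Z of length 2n, and such a word of a second component to a word Y. Near the middle, Z
    can be left at order n different places, and from each of them one builds a binary tree of
    words of depth d of order n, glued leaf to leaf, through a fixed marker, to a tree that ends
    by entering Y. Aperiodicity and the marker make the edges used at different nodes of these
    networks distinct, so that they are independent series-parallel networks: each fails to be
    open with a small probability eta when alpha is near 1, and all of them fail with
    probability at most eta^(d-1), which beats the number of pairs (Z, Y). Hence with high
    probability any two components of positive entropy are joined by open paths both ways, and
    coincide.

    Existence: the products of a few loops ("petals") sharing a word x(s) of length of order n
    use only O(n) edges, and there are exponentially many s with disjoint sets of edges, so that
    one of them is open with high probability. Two petals whose lengths differ by a divisor of
    all the lengths of periodic orbits of X force the period, and two petals of equal length the
    entropy. *)

Set Implicit Arguments.
Unset Strict Implicit.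
Unset Printing Implicit Defensive.

Import Order.TTheory GRing.Theory Num.Theory.
Import numFieldNormedType.Exports.

(** * Languages with gluing *)

(** A single word that joins [Z] to [Y] has of order n new windows, so for fixed alpha < 1 it is
    open only with exponentially small probability. In a binary tree an inner node costs boundedly
    many windows, and only the leaves, where the two trees meet, cost of order n; branching over d
    levels absorbs this cost once alpha is close to 1. Still, one network stays closed with a
    probability that does not tend to 0, because a window at its root may be missing; hence the need
    for about d independent networks. [Z] and [Y] run over deterministic words because the
    components are random and the union bound needs a fixed list of events. What makes windows
    recognizable is scale: d is a small fraction of n, so each half of a network is only slightly
    longer than n, and every window that leaves both [Z] and [rev Y] covers the aperiodic stretch of
    one of them. The order of choice is: d = n / B with B depending on X only, then eta below the
    inverse of the growth of the number of pairs per unit of d, then alpha so close to 1 that the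
    trees attain eta. *)

Record language_axioms (A : Type) (h : nat) (L : seq A -> Prop) : Prop := {
  lang_factor : forall u v w, L (u ++ v ++ w) -> L v;
  lang_glue : forall u g v,
    h <= size g -> L (u ++ g) -> L (g ++ v) -> L (u ++ g ++ v);
  lang_irr : forall u v, L u -> L v -> exists c, L (u ++ c ++ v)
}.

(** Positive entropy enters the construction of networks only in this weak form. Together with
    [language_axioms] it is stable under reversal, so the right half of a network is obtained as a
    left half for the reversed language. *)
Definition unbounded_language (A : eqType) (L : seq A -> Prop) : Prop :=
  forall K, exists N, exists2 s : seq (seq A),
    uniq s /\ K < size s & forall w, w \in s -> size w = N /\ L w.

(** A return path to [g]; when [g] is long enough to glue along, loops can be concatenated
    freely. *)
Definition loop (A : Type) (L : seq A -> Prop) (g c : seq A) : Prop :=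
  L (g ++ c) /\ exists c', g ++ c = c' ++ g.

Lemma language_rev (A : Type) (h : nat) (L : seq A -> Prop) :
  language_axioms h L -> language_axioms h (L \o rev).
Proof.
case=> fac glue irr; split=> /=.
- by move=> u v w; rewrite !rev_cat -catA => /fac.
- move=> u g v hg; rewrite !rev_cat -catA => Lu Lv.
  by apply: glue; rewrite ?size_rev.
- move=> u v Lu Lv; have [c] := irr _ _ Lv Lu; rewrite catA => Lc; exists (rev c).
  by rewrite !rev_cat revK.
Qed.

Lemma unbounded_rev (A : eqType) (L : seq A -> Prop) :
  unbounded_language L -> unbounded_language (L \o rev).
Proof.
move=> unb K; have [N [s [us Ks] sL]] := unb K.
exists N, (map rev s); first by rewrite size_map map_inj_uniq //; exact: (can_inj (@revK _)).
by move=> w /mapP[v /sL[Nv Lv] ->] /=; rewrite size_rev revK.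
Qed.

Section Words.
Variables (A : finType) (a0 : A) (h : nat) (L : seq A -> Prop).
Hypothesis hL : language_axioms h L.

Lemma lang_prefix (u v : seq A) : L (u ++ v) -> L u.
Proof. by move=> Luv; apply: (lang_factor hL (u := [::]) (w := v)). Qed.

Lemma lang_suffix (u v : seq A) : L (u ++ v) -> L v.
Proof. by move=> Luv; apply: (lang_factor hL (u := u) (w := [::])); rewrite cats0. Qed.

Lemma lang_extend (u g v w : seq A) : h <= size g ->
  L u -> u = w ++ g -> L (g ++ v) -> L (u ++ v).
Proof. by move=> hg Lu uE Lv; rewrite uE -catA; apply: (lang_glue hL) => //; rewrite -uE. Qed.

Lemma loop_cat (g c d : seq A) : h <= size g ->
  loop L g c -> loop L g d -> loop L g (c ++ d).
Proof.
move=> hg [Lc [c' cE]] [Ld [d' dE]]; split.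
  by rewrite catA; apply: (lang_extend hg Lc cE).
by exists (c' ++ d'); rewrite catA cE -!catA dE.
Qed.

Lemma loop_nil (g : seq A) : L g -> loop L g [::].
Proof. by move=> Lg; split; [rewrite cats0|exists [::]; rewrite cats0]. Qed.

Lemma loop_extend (u w g c : seq A) : h <= size g -> L u -> u = w ++ g ->
  loop L g c -> L (u ++ c) /\ exists w', u ++ c = w' ++ g.
Proof.
move=> hg Lu uE [Lc [c' cE]]; split; first exact: (lang_extend hg Lu uE).
by exists (w ++ c'); rewrite uE -!catA cE.
Qed.

Lemma first_difference (v w : seq A) n m : n <= m ->
  nth a0 v m != nth a0 w m ->
  exists2 e, (n <= e <= m) && (nth a0 v e != nth a0 w e) &
    forall i, n <= i < e -> nth a0 v i = nth a0 w i.
Proof.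
move=> nm vw; have ex : exists i, (n <= i <= m) && (nth a0 v i != nth a0 w i).
  by exists m; rewrite nm leqnn.
exists (ex_minn ex); case: ex_minnP => // e /andP[/andP[ne em] d] emin i /andP[ni ie].
apply/eqP; apply: contraTT (ie) => dd; rewrite -leqNgt; apply: emin.
by rewrite ni dd (leq_trans (ltnW ie) em).
Qed.

Lemma code_exists : unbounded_language L -> exists g (c : bool -> seq A) l,
  [/\ size g = h, 0 < l, forall b, size (c b) = l, forall b, loop L g (c b) &
      nth a0 (c false) 0 != nth a0 (c true) 0].
Proof.
move=> unb.
have [N [s [us Ks] sL]] := unb #|{: h.-bseq A * h.-bseq A}|.
pose f (w : seq A) : h.-bseq A * h.-bseq A :=
  (insub_bseq h (take h w), insub_bseq h (drop (N - h) w)).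
have [w1 [w2 [w1s w2s fw dw]]] : exists w1 w2,
    [/\ w1 \in s, w2 \in s, f w1 = f w2 & w1 != w2].
  apply: contrapT => no; suff : uniq (map f s).
    move=> /card_uniqP; rewrite size_map => E.
    by have := max_card (mem (map f s)); rewrite E leqNgt Ks.
  rewrite map_inj_in_uniq // => x y xs ys fxy; apply/eqP; apply: contrapT => /negP xy.
  by apply: no; exists x, y.
have [Nw1 Lw1] := sL _ w1s; have [Nw2 Lw2] := sL _ w2s.
have ib (u v : seq A) : size u <= h -> size v <= h ->
    insub_bseq h u = insub_bseq h v -> u = v.
  move=> hu hv /(congr1 (@bseqval _ _)).
  by rewrite /insub_bseq !val_insubd hu hv.
case: fw => /ib t12 /ib d12.
have {}t12 : take h w1 = take h w2 by apply: t12; rewrite size_take; case: ltnP.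
have {}d12 : drop (N - h) w1 = drop (N - h) w2.
  by apply: d12; rewrite size_drop ?Nw1 ?Nw2; lia.
have hN : h <= N.
  rewrite leqNgt; apply: contra dw => Nh; apply/eqP.
  by move: t12; rewrite !take_oversize ?Nw1 ?Nw2 // ltnW.
have [m mN dm] : exists2 m, m < N & nth a0 w1 m != nth a0 w2 m.
  apply: contrapT => no; move/eqP: dw; apply; apply: (@eq_from_nth _ a0).
    by rewrite Nw1 Nw2.
  move=> i; rewrite Nw1 => iN; apply/eqP; apply: contrapT => /negP di.
  by apply: no; exists i.
have [u /andP[um du] uu] := first_difference (leq0n m) dm.
have hu : h <= u.
  rewrite leqNgt; apply: contra du => uh.
  by rewrite -(nth_take a0 uh) t12 nth_take.
have uN : u < N - h.
  rewrite ltnNge; apply: contra du => Nu; apply/eqP.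
  have := congr1 (fun x => nth a0 x (u - (N - h))) d12.
  by rewrite !nth_drop subnKC.
have uN' : u < N by lia.
have tE : take u w1 = take u w2.
  apply: (@eq_from_nth _ a0); first by rewrite !size_take Nw1 Nw2.
  move=> i; rewrite size_take Nw1 uN' => iu.
  by rewrite !nth_take // uu.
pose g := drop (u - h) (take u w1).
have gh : size g = h by rewrite size_drop size_take Nw1 uN'; lia.
pose sg := drop (N - h) w1.
have sh : size sg = h by rewrite size_drop Nw1; lia.
have Lg : L g.
  apply: (@lang_suffix (take (u - h) (take u w1))); rewrite cat_take_drop.
  by apply: (@lang_prefix _ (drop u w1)); rewrite cat_take_drop.
have Lsg : L sg by apply: (@lang_suffix (take (N - h) w1)); rewrite cat_take_drop.
have [k Lk] := lang_irr hL Lsg Lg.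
pose W (b : bool) := if b then w2 else w1.
have NW b : size (W b) = N by case: b.
have LW b : L (W b) by case: b.
have tW b : take u (W b) = take u w1 by case: b.
have dW b : drop (N - h) (W b) = sg by case: b.
pose c (b : bool) := drop u (W b) ++ k ++ g.
exists g, c, (N - u + size k + h); split => //; first by lia.
- by move=> b; rewrite /c !size_cat size_drop gh NW; lia.
- move=> b; split; last by exists (g ++ drop u (W b) ++ k); rewrite -!catA.
  have E : g ++ drop u (W b) = drop (u - h) (W b).
    rewrite /g -(tW b) -{3}(cat_take_drop u (W b)) drop_cat size_take NW uN'.
    case: ltnP => // uu'; rewrite drop_oversize ?size_take ?NW ?uN' //.
    have -> : u - h - u = 0 by lia.
    by rewrite drop0.
  rewrite /c catA E.
  apply: (@lang_extend _ sg _ (take (N - u) (drop (u - h) (W b)))); rewrite ?sh //.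
    by apply: (@lang_suffix (take (u - h) (W b))); rewrite cat_take_drop.
  rewrite -[LHS](cat_take_drop (N - u)) drop_drop; congr (_ ++ _).
  have -> : N - u + (u - h) = N - h by lia.
  exact: dW.
- by rewrite /c !nth_cat !size_drop !NW subn_gt0 uN' !nth_drop addn0.
Qed.

(** From the [h] letters of [Z] before [a] a connector leads to [g]; there are finitely many such
    contexts, so its length is bounded. It is followed by whichever codeword disagrees with [Z] at
    its first letter. The new word therefore leaves [Z] at that place at the latest, and [e] is the
    first place where it does. *)
Lemma deviation (g : seq A) (c : bool -> seq A) (l : nat) :
  size g = h -> 0 < l -> (forall b, size (c b) = l) -> (forall b, loop L g (c b)) ->
  nth a0 (c false) 0 != nth a0 (c true) 0 ->
  exists T, forall (Z : seq A) a, L Z -> h <= a -> a + T <= size Z ->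
    exists e rho, [/\ a <= e < a + T, 0 < size rho <= T,
      nth a0 rho 0 != nth a0 Z e, L (take e Z ++ rho) &
      exists w, take e Z ++ rho = w ++ g].
Proof.
move=> gh l0 cl cloop cdiff.
have Lg : L g by have [/lang_prefix] := cloop true.
have /cid2[t tP _] : exists2 t : h.-tuple A -> seq A,
    forall s : h.-tuple A, L s -> L (s ++ t s ++ g) & True.
  have /choice[t tP] : forall s : h.-tuple A, exists t, L s -> L (s ++ t ++ g).
    move=> s; have [Ls|nLs] := pselect (L s); last by exists [::].
    by have [t Lt] := lang_irr hL Ls Lg; exists t.
  by exists t.
have [M tM] : exists M, forall s, size (t s) <= M.
  by exists (\max_(s : h.-tuple A) size (t s)) => s; exact: leq_bigmax.
exists (M + h + l) => Z a LZ ha aT.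
have LsZ : L (take h (drop (a - h) Z)).
  apply: (@lang_prefix _ (drop h (drop (a - h) Z))); rewrite cat_take_drop.
  by apply: (@lang_suffix (take (a - h) Z)); rewrite cat_take_drop.
have ss : size (take h (drop (a - h) Z)) == h.
  by rewrite size_take size_drop; apply/eqP; case: ltnP; lia.
pose s : h.-tuple A := Tuple ss.
have tmax := tM s.
have [p pE] : exists p, p = size (t s) + h by eexists.
have [b bP] : exists b, nth a0 (c b) 0 != nth a0 Z (a + p).
  have [E|] := eqVneq (nth a0 (c false) 0) (nth a0 Z (a + p)); last by exists false.
  by exists true; rewrite -E eq_sym.
pose y := (t s ++ g) ++ c b.
have sy : size y = p + l by rewrite !size_cat cl gh pE.
have yp : nth a0 y p != nth a0 (drop a Z) p.
  by rewrite nth_drop nth_cat size_cat gh -pE ltnn subnn.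
have [u /andP[/= up du] uu] := first_difference (leq0n p) yp.
have TZ : take a Z = take (a - h) Z ++ s.
  by rewrite -{1}(subnK ha) takeD.
have LaZ : L (take a Z) by apply: (@lang_prefix _ (drop a Z)); rewrite cat_take_drop.
have Lts : L (s ++ t s ++ g) by apply: tP.
have L1 : L (take a Z ++ t s ++ g).
  by apply: (lang_extend _ LaZ TZ Lts); rewrite (eqP ss).
have [L2 [w' wE]] : L (take a Z ++ y) /\ exists w', take a Z ++ y = w' ++ g.
  rewrite catA; apply: (@loop_extend _ (take a Z ++ t s)) => //; rewrite ?gh //.
  by rewrite catA.
exists (a + u), (drop u y).
have E : take (a + u) Z ++ drop u y = take a Z ++ y.
  have s1 : size (take u (drop a Z)) = u by rewrite size_takel ?size_drop //; lia.
  have s2 : size (take u y) = u by rewrite size_takel // sy; lia.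
  rewrite takeD -catA -[in RHS](cat_take_drop u y).
  suff -> : take u (drop a Z) = take u y by [].
  apply: (@eq_from_nth _ a0); rewrite s1 ?s2 // => i iu.
  by rewrite !nth_take // uu.
split.
- by lia.
- by rewrite size_drop sy; lia.
- by rewrite nth_drop addn0 -nth_drop.
- by rewrite E.
- by rewrite E; exists w'.
Qed.

End Words.

(** * Words branching off a given word *)

Section Halves.
Variables (A : Type) (a0 : A).

Definition encode (c : bool -> seq A) (s : seq bool) : seq A := flatten (map c s).

Definition half (Z : seq A) (e : nat) (rho : seq A) (c : bool -> seq A)
    (s : seq bool) : seq A :=
  take e Z ++ rho ++ encode c s.

Definition aperiodic (Z : seq A) (lo hi Q : nat) : Prop :=
  forall q, 0 < q <= Q -> exists2 y, lo + q <= y < hi & nth a0 Z y <> nth a0 Z (y - q).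

Variables (c : bool -> seq A) (l : nat).
Hypotheses (l_gt0 : 0 < l) (size_c : forall b, size (c b) = l).

Lemma size_encode s : size (encode c s) = size s * l.
Proof. by elim: s => //= b s IH; rewrite /encode /= size_cat size_c -/(encode c s) IH mulSn. Qed.

Lemma encode_take j s : encode c (take j s) = take (j * l) (encode c s).
Proof.
elim: s j => [|b s IH] [|j]; rewrite ?take0 ?mul0n ?take0 //.
by rewrite /= /encode /= -!/(encode c _) IH mulSn takeD take_size_cat ?drop_size_cat.
Qed.

Lemma nth_encode s j : j < size s ->
  nth a0 (encode c s) (j * l) = nth a0 (c (nth false s j)) 0.
Proof.
elim: s j => // b s IH [|j] /= js; rewrite /encode /= -/(encode c s) nth_cat size_c.
  by rewrite mul0n l_gt0.
by rewrite mulSn ltnNge leq_addr addKn IH.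
Qed.

Lemma encode_inj s t : nth a0 (c false) 0 <> nth a0 (c true) 0 ->
  size s = size t -> encode c s = encode c t -> s = t.
Proof.
move=> cd st E; apply: (@eq_from_nth _ false) => // j js.
have := nth_encode js; rewrite E nth_encode -?st //.
by case: (nth false s j); case: (nth false t j) => // /esym.
Qed.

Lemma size_half Z e rho s : e <= size Z ->
  size (half Z e rho c s) = e + size rho + size s * l.
Proof. by move=> eZ; rewrite /half !size_cat size_encode size_takel // addnA. Qed.

Lemma half_prefix Z e rho s y r : y < e <= size Z ->
  nth a0 (half Z e rho c s ++ r) y = nth a0 Z y.
Proof.
move=> /andP[ye eZ]; rewrite /half -!catA nth_cat size_takel // ye nth_take //.
Qed.

Lemma half_deviation Z e rho s r : e <= size Z -> 0 < size rho ->
  nth a0 (half Z e rho c s ++ r) e = nth a0 rho 0.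
Proof.
by move=> eZ r0; rewrite /half -!catA nth_cat size_takel // ltnn subnn nth_cat r0.
Qed.

Lemma half_bit Z e rho s r j : e <= size Z -> j < size s ->
  nth a0 (half Z e rho c s ++ r) (e + size rho + j * l) = nth a0 (c (nth false s j)) 0.
Proof.
move=> eZ js; rewrite /half -!catA nth_cat size_takel // ltnNge -addnA leq_addr /=.
rewrite addKn nth_cat ltnNge leq_addr /= addKn nth_cat size_encode ltn_mul2r l_gt0 js.
exact: nth_encode.
Qed.

Lemma half_take Z e rho s t j : e <= size Z -> take j s = take j t ->
  take (e + size rho + j * l) (half Z e rho c s) =
  take (e + size rho + j * l) (half Z e rho c t).
Proof.
move=> eZ st; have E : size (take e Z ++ rho) = e + size rho.
  by rewrite size_cat size_takel.
by rewrite /half !catA -E !takeD !take_size_cat // !drop_size_cat // -!encode_take st.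
Qed.

(* Two windows at different places of words continuing the same [Z] would make [q = p' - p] a period
   of [Z]; at the same place, the letter at the first deviation tells [e]. *)
Lemma half_align Z lo hi Q e rho s r e' rho' s' r' p p' N :
  aperiodic Z lo hi Q -> hi <= e <= size Z -> hi <= e' <= size Z ->
  0 < size rho -> nth a0 rho 0 <> nth a0 Z e ->
  0 < size rho' -> nth a0 rho' 0 <> nth a0 Z e' ->
  p <= lo -> p' <= lo -> lo <= hi -> p <= p' + Q -> p' <= p + Q -> e < p + N -> e' < p' + N ->
  (forall u, u < N -> nth a0 (half Z e rho c s ++ r) (p + u) =
                      nth a0 (half Z e' rho' c s' ++ r') (p' + u)) ->
  p = p' /\ e = e'.
Proof.
move=> ap; wlog pp' : e rho s r e' rho' s' r' p p' / p <= p'.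
  move=> W eb eb' r0 rd r0' rd' pl pl' lh pQ pQ' pe pe' E; have [le|/ltnW le] := leqP p p'.
    exact: (W e rho s r e' rho' s' r').
  by case: (W e' rho' s' r' e rho s r p' p) => // u uN; rewrite E.
move=> /andP[he eZ] /andP[he' eZ'] r0 rd r0' rd' pl pl' lh _ pQ pe pe' E.
have pE : p = p'.
  apply/eqP; apply: contraT => pn; have [|y yb] := ap (p' - p); first by lia.
  case; have := E (y - p'); rewrite (_ : p' + (y - p') = y); last by lia.
  rewrite (_ : p + (y - p') = y - (p' - p)); last by lia.
  by rewrite !half_prefix; first (by move=> H; rewrite H //; lia); lia.
split=> //; move: E pe pe' pl; rewrite -pE => {pE pp' pQ pl'} E pe pe' pl.
have [ee|ee|//] := ltngtP e e'.
- case: rd; have := E (e - p); rewrite subnKC; last by lia.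
  by rewrite half_deviation // half_prefix; [move=> -> //; lia|lia].
- case: rd'; have := E (e' - p); rewrite subnKC; last by lia.
  by rewrite half_deviation // half_prefix; [move=> <- //; lia|lia].
Qed.

End Halves.

(** * Networks of words *)

(* [side] describes one half of the words of a network: the words [half Z (e i) (rho i) c s] with
   [i : 'I_m] and [s] of size [d]; [cmu] is the size of the marker that separates the two halves. *)
Record side (A : Type) (a0 : A) (m d n lo Q K cmu : nat) (Z : seq A) (c : bool -> seq A)
    (l : nat) (e : 'I_m -> nat) (rho : 'I_m -> seq A) : Prop := {
  side_l : 0 < l;
  side_c : forall b, size (c b) = l;
  side_heads : nth a0 (c false) 0 <> nth a0 (c true) 0;
  side_aperiodic : aperiodic a0 Z lo n Q;
  side_e : forall i, n <= e i <= size Z;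
  side_inj : injective e;
  side_rho : forall i, 0 < size (rho i);
  side_dev : forall i, nth a0 (rho i) 0 <> nth a0 Z (e i);
  side_size : forall i, e i + size (rho i) + d * l + cmu <= n + K
}.

Definition ceil_div (x l : nat) := (x + l.-1) %/ l.

Lemma ltn_ceil_div j x l : 0 < l -> (j < ceil_div x l) = (j * l < x).
Proof. by move=> l0; rewrite /ceil_div leq_divRL // mulSn; lia. Qed.

Section SideLemmas.
Variables (A : Type) (a0 : A) (m d n lo Q K cmu : nat) (Z : seq A) (c : bool -> seq A).
Variables (l : nat) (e : 'I_m -> nat) (rho : 'I_m -> seq A).
Hypothesis S : side a0 d n lo Q K cmu Z c l e rho.

Definition root_size i := e i + size (rho i).
Definition side_len i := root_size i + d * l.
(** The number of bits whose codewords have begun before position [t]. Since the first letter of a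
    codeword identifies it, these are the bits that the first [t] letters reveal; they also
    determine these letters. *)
Definition level i t := minn d (ceil_div (t - root_size i) l).

Lemma size_side i s : size s = d -> size (half Z (e i) (rho i) c s) = side_len i.
Proof.
move=> sd; have /andP[_ eZ] := side_e S i.
by rewrite (size_half (side_c S)) // sd.
Qed.

Lemma ltn_level i t j : j < d -> (j < level i t) = (root_size i + j * l < t).
Proof. by move=> jd; rewrite /level leq_min jd ltn_ceil_div ?(side_l S) //; lia. Qed.

Lemma level_cover i t : level i t < d -> t <= root_size i + level i t * l.
Proof. by move=> jd; have := ltn_level i t jd; rewrite ltnn; lia. Qed.

(** Alignment yields the place and the index; bit [j] is then read off the first letter of its
    codeword, at [root_size i + j * l]. *)
Lemma side_match i i' s s' r r' p p' N :
  lo <= n -> p <= lo -> p' <= lo -> p <= p' + Q -> p' <= p + Q ->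
  e i < p + N -> e i' < p' + N -> size s = d -> size s' = d ->
  (forall u, u < N -> nth a0 (half Z (e i) (rho i) c s ++ r) (p + u) =
                      nth a0 (half Z (e i') (rho i') c s' ++ r') (p' + u)) ->
  [/\ p = p', i = i' & take (level i (p + N)) s = take (level i (p + N)) s'].
Proof.
move=> ln pl pl' pQ pQ' pe pe' sd sd' E.
have [pp ee] := half_align (side_l S) (side_aperiodic S) (side_e S i) (side_e S i') (side_rho S i)
  (side_dev S (i := i)) (side_rho S i') (side_dev S (i := i')) pl pl' ln pQ pQ' pe pe' E.
have ii := side_inj S ee; split=> //; move: E; rewrite -ii -pp => E.
have /andP[ne eZ] := side_e S i.
have ld : level i (p + N) <= d by rewrite geq_minl.
apply: (@eq_from_nth _ false); first by rewrite !size_take sd sd'.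
move=> j; rewrite size_takel ?sd // => jl; rewrite !nth_take //.
have jd : j < d by apply: leq_trans ld.
have := jl; rewrite ltn_level // => jt.
have := E (root_size i + j * l - p).
rewrite subnKC; last by rewrite /root_size; lia.
rewrite !(half_bit a0 (side_l S) (side_c S)) ?sd ?sd' // => H.
have {}H := H ltac:(lia).
have := side_heads S.
by case: (nth false s j) H; case: (nth false s' j) => // H; rewrite H.
Qed.

(** The condition [level i t < d] keeps [t] within the half, so the continuations [r] and [r'] may
    be arbitrary. *)
Lemma side_depends i s s' t : size s = d -> size s' = d ->
  take (level i t) s = take (level i t) s' -> level i t < d ->
  forall r r' u, u < t -> nth a0 (half Z (e i) (rho i) c s ++ r) u =
                nth a0 (half Z (e i) (rho i) c s' ++ r') u.
Proof.
move=> sd sd' E ld r r' u ut; have /andP[_ eZ] := side_e S i.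
have tl := level_cover ld.
have le : root_size i + level i t * l <= side_len i.
  by rewrite /side_len leq_add2l leq_mul2r ltnW ?orbT.
have ul := leq_trans ut tl; have us := leq_trans ul le.
have := half_take (side_c S) (rho i) eZ E.
rewrite -/(root_size i) => /(congr1 (fun x => nth a0 x u)); rewrite !nth_take //.
move=> H; rewrite nth_cat size_side // us H.
by rewrite nth_cat size_side // us.
Qed.

End SideLemmas.

Section Net.
Variables (A : Type) (a0 : A) (m d n lo Q K : nat) (Z Y : seq A) (c c' : bool -> seq A).
Variables (l l' : nat) (e e' : 'I_m -> nat) (rho rho' : 'I_m -> seq A) (mu : seq A).
Hypothesis SL : side a0 d n lo Q K (size mu) Z c l e rho.
Hypothesis SR : side a0 d n lo Q K (size mu) Y c' l' e' rho'.

Let lenL := side_len d l e rho.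
Let lenR := side_len d l' e' rho'.

(** The same bits [s] drive both halves: the tree that branches off [Z] and the tree that merges
    into [rev Y] are glued leaf to leaf, and a prefix of [s] names a node in both. *)
Definition net_word i s : seq A :=
  half Z (e i) (rho i) c s ++ mu ++ rev (half Y (e' i) (rho' i) c' s).

Definition net_size i := lenL i + size mu + lenR i.

Lemma size_net_word i s : size s = d -> size (net_word i s) = net_size i.
Proof.
move=> sd; rewrite /net_word (size_cat (half _ _ _ _ _)) (size_cat mu) size_rev.
rewrite (size_side SL) // (size_side SR) //.
by rewrite addnA.
Qed.

Lemma rev_net_word i s :
  rev (net_word i s) = half Y (e' i) (rho' i) c' s ++ rev mu ++ rev (half Z (e i) (rho i) c s).
Proof. by rewrite /net_word (rev_cat (half _ _ _ _ _)) (rev_cat mu) revK catA. Qed.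

Lemma nth_rev_net_word i s q : size s = d -> q < net_size i ->
  nth a0 (net_word i s) q = nth a0 (rev (net_word i s)) (net_size i - q.+1).
Proof.
move=> sd q_lt; rewrite nth_rev size_net_word //; last by lia.
by congr nth; lia.
Qed.

Lemma nth_net_mu i s j : size s = d -> j < size mu ->
  nth a0 (net_word i s) (lenL i + j) = nth a0 mu j.
Proof.
move=> sd jm; rewrite /net_word nth_cat (size_side SL) // ltnNge leq_addr /= addKn.
by rewrite nth_cat jm.
Qed.

(* The windows that are not contained in [Z] or in [rev Y]. *)
Definition net_window i p := (e i < p + n) && (p + e' i < net_size i).

(* The number of bits of [s] on which the window of [net_word i s] at [p] depends. *)
Definition net_level i p :=
  minn (level d l e rho i (p + n)) (level d l' e' rho' i (net_size i - p)).

Lemma net_level_le i p : net_level i p <= d.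
Proof. by rewrite /net_level /level; lia. Qed.

Definition same_window i s p i' s' p' :=
  forall u, u < n -> nth a0 (net_word i s) (p + u) = nth a0 (net_word i' s') (p' + u).

Lemma same_window_rev i s p i' s' p' : size s = d -> size s' = d ->
  net_window i p -> net_window i' p' -> same_window i s p i' s' p' ->
  forall u, u < n -> nth a0 (rev (net_word i s)) (net_size i - n - p + u) =
                     nth a0 (rev (net_word i' s')) (net_size i' - n - p' + u).
Proof.
move=> sd sd' /andP[w1 w2] /andP[w1' w2'] E u un.
have /andP[ne' _] := side_e SR i; have /andP[ne'' _] := side_e SR i'.
have := E (n - u.+1); rewrite nth_rev_net_word // ?[RHS]nth_rev_net_word //; try lia.
have -> : net_size i - (p + (n - u.+1)).+1 = net_size i - n - p + u by lia.
have -> : net_size i' - (p' + (n - u.+1)).+1 = net_size i' - n - p' + u by lia.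
by move=> ->//; lia.
Qed.

(** The window lies in the prefix of length [p + n] and in the suffix that starts at [p]. Either one
    determines it, so the smaller number of bits suffices. *)
Lemma net_depends i s s' p : size s = d -> size s' = d -> net_window i p ->
  take (net_level i p) s = take (net_level i p) s' -> same_window i s p i s' p.
Proof.
move=> sd sd' /andP[w1 w2] E u un.
have /andP[ne' _] := side_e SR i.
have [|le] := leqP (level d l e rho i (p + n)) (level d l' e' rho' i (net_size i - p)).
  move=> le; move: E; rewrite /net_level (minn_idPl le) => E.
  have [ld|ld] := ltnP (level d l e rho i (p + n)) d.
    by apply: (side_depends SL sd sd' E ld); lia.
  by move: E; rewrite !take_oversize ?sd ?sd' // => ->.
move: E; rewrite /net_level (minn_idPr (ltnW le)) => E.
have ld : level d l' e' rho' i (net_size i - p) < d.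
  by apply: leq_trans le _; rewrite /level geq_minl.
rewrite !nth_rev_net_word // ?rev_net_word; try lia.
by apply: (side_depends SR sd sd' E ld); lia.
Qed.

Hypotheses (lo_n : lo <= n) (K_lo : K <= lo) (K_Q : 2 * K <= Q) (nK : n + 3 * K <= 2 * lo).

(** Front windows end no later than the marker, back windows start no earlier than the marker. A
    window of neither kind contains the whole marker. *)
Let isF i p := p + n <= lenL i + size mu.
Let isB i p := lenL i <= p.

Lemma isF_bound i p : net_window i p -> isF i p -> 0 < p <= K.
Proof.
rewrite /isF => /andP[w _] F; have /andP[ne _] := side_e SL i; have := side_size SL i.
by rewrite /lenL /side_len /root_size in F *; lia.
Qed.

Lemma isB_bound i p : net_window i p -> isB i p -> 0 < net_size i - n - p <= K.
Proof.
rewrite /isB => /andP[_ w] F; have /andP[ne _] := side_e SR i; have := side_size SR i.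
by rewrite /net_size /lenR /lenL /side_len /root_size in F w *; lia.
Qed.

Lemma lenL_bound i : n <= lenL i <= n + K.
Proof.
have /andP[ne _] := side_e SL i; have := side_size SL i.
by rewrite /lenL /side_len /root_size; lia.
Qed.

Lemma lenR_bound i : (n <= lenR i) && (lenR i + size mu <= n + K).
Proof.
have /andP[ne _] := side_e SR i; have := side_size SR i.
by rewrite /lenR /side_len /root_size; lia.
Qed.

Lemma match_left i s p i' s' p' : size s = d -> size s' = d ->
  net_window i p -> net_window i' p' -> same_window i s p i' s' p' ->
  p <= lo -> p' <= lo -> p <= p' + Q -> p' <= p + Q ->
  [/\ i = i', p = p' & take (net_level i p) s = take (net_level i p) s'].
Proof.
move=> sd sd' /andP[w1 w2] /andP[w1' w2'] E pl pl' pQ pQ'.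
have [pp ii T] := side_match SL lo_n pl pl' pQ pQ' w1 w1' sd sd' E.
by split=> //; rewrite /net_level minnC take_min [RHS]take_min T.
Qed.

Lemma match_right i s p i' s' p' : size s = d -> size s' = d ->
  net_window i p -> net_window i' p' -> same_window i s p i' s' p' ->
  net_size i - n - p <= lo -> net_size i' - n - p' <= lo ->
  net_size i - n - p <= net_size i' - n - p' + Q -> 
  net_size i' - n - p' <= net_size i - n - p + Q ->
  [/\ i = i', p = p' & take (net_level i p) s = take (net_level i p) s'].
Proof.
move=> sd sd' w w' E pl pl' pQ pQ'; have := same_window_rev sd sd' w w' E.
rewrite !rev_net_word => {}E; case/andP: w => w1 w2; case/andP: w' => w1' w2'.
have /andP[ne _] := side_e SR i; have /andP[ne' _] := side_e SR i'.
have b1 : e' i < net_size i - n - p + n by lia.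
have b2 : e' i' < net_size i' - n - p' + n by lia.
have [pp ii T] := side_match SR lo_n pl pl' pQ pQ' b1 b2 sd sd' E.
move: pp w2'; rewrite -ii => pp w2'; split=> //; first by lia.
rewrite /net_level take_min [RHS]take_min.
by have <- : net_size i - n - p + n = net_size i - p by [lia]; rewrite T.
Qed.

(* A window near the left end of [net_word i s] that reappears near the right end of another word:
   then [rev Y] and [Z] overlap, at a unique place by aperiodicity, and that place tells [i]. *)
Definition crossing i := exists s p i' s' p',
  [/\ size s = d, size s' = d, net_window i p /\ isF i p, net_window i' p' /\ isB i' p' &
      same_window i s p i' s' p'].

Lemma crossing_overlap i : crossing i -> exists2 k, n < k <= n - 1 + 2 * K &
  (forall y, 2 * K <= y < e i -> nth a0 Z y = nth a0 Y (k - y)) /\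
  nth a0 Z (e i) <> nth a0 Y (k - e i).
Proof.
case=> s [p [i' [s' [p' [sd sd' [w F] [w' B] E]]]]].
have pF := isF_bound w F; have pB := isB_bound w' B.
exists (n - 1 + p + (net_size i' - n - p')); first by lia.
case/andP: w => w1 w2; case/andP: w' => w1' w2'.
have /andP[ne eZ] := side_e SL i; have /andP[ne' eY] := side_e SR i'.
have key y : 2 * K <= y <= e i ->
    nth a0 (net_word i s) y = nth a0 Y (n - 1 + p + (net_size i' - n - p') - y).
  move=> yb; have := E (y - p); rewrite subnKC; last by lia.
  move=> ->; last by lia.
  rewrite nth_rev_net_word ?rev_net_word //; last by lia.
  have -> : net_size i' - (p' + (y - p)).+1 = n - 1 + p + (net_size i' - n - p') - y by lia.
  by rewrite half_prefix //; lia.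
split=> [y yb|].
  rewrite -key; last by lia.
  by rewrite half_prefix //; lia.
rewrite -key; last by lia.
rewrite half_deviation ?(side_rho SL) // => H.
exact: (side_dev SL (i := i)).
Qed.

(** Different values of [k] would give [Z] the period [|k - k'| <= Q]; for equal [k] the first
    disagreement determines [e i]. So at most one network has to be discarded, whence the exponent
    [d.-1] in [net_pr]. *)
Lemma crossing_unique i j : crossing i -> crossing j -> i = j.
Proof.
move=> /crossing_overlap[k kb [Zk dk]] /crossing_overlap[k' kb' [Zk' dk']].
have /andP[ne eZ] := side_e SL i; have /andP[ne' eZ'] := side_e SL j.
have per q : 0 < q <= Q ->
    (forall y, lo + q <= y < n -> nth a0 Z y = nth a0 Z (y - q)) -> False.
  by move=> qQ H; have [y /H ->] := side_aperiodic SL qQ.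
have [kk|kk|kk] := ltngtP k k'.
- case: (per (k' - k)) => [|y yb]; first by lia.
  rewrite Zk'; last by lia.
  rewrite Zk; last by lia.
  by congr nth; lia.
- case: (per (k - k')) => [|y yb]; first by lia.
  rewrite Zk; last by lia.
  rewrite Zk'; last by lia.
  by congr nth; lia.
- apply: (side_inj SL); have [ee|ee|//] := ltngtP (e i) (e j).
    by case: dk; rewrite kk Zk' //; lia.
  by case: dk'; rewrite -kk Zk //; lia.
Qed.

Hypothesis marker : forall i s q, size s = d -> q + size mu <= net_size i ->
  (forall j, j < size mu -> nth a0 (net_word i s) (q + j) = nth a0 mu j) -> q = lenL i.

(** The second window contains the marker, so the first one contains a copy of it at the same
    offset, and [marker] says where that copy sits. *)
Lemma marker_in_window i s p i' s' p' : size s = d -> size s' = d ->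
  net_window i p -> net_window i' p' -> same_window i s p i' s' p' ->
  ~~ isF i' p' -> ~~ isB i' p' -> lenL i + p' = p + lenL i'.
Proof.
rewrite /isF /isB => sd sd' /andP[w1 w2] /andP[w1' w2'] E nF nB.
have /andP[ne' _] := side_e SR i.
have <- : p + (lenL i' - p') = lenL i; last by lia.
apply: (marker sd) => [|j jm]; first by lia.
rewrite -addnA E; last by lia.
by rewrite addnA subnKC ?nth_net_mu //; lia.
Qed.

(** Two front windows, or two back windows, start within [K] of the same end and are compared from
    that end. A front window equal to a back window is a crossing. If one window contains the
    marker, so does the other at the same offset, which makes [p] and [p'] differ by at most [K]. *)
Lemma net_collision i s p i' s' p' : ~ crossing i -> ~ crossing i' ->
  size s = d -> size s' = d ->
  net_window i p -> net_window i' p' -> same_window i s p i' s' p' ->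
  [/\ i = i', p = p' & take (net_level i p) s = take (net_level i p) s'].
Proof.
move=> nc nc' sd sd' w w' E; have E' : same_window i' s' p' i s p.
  by move=> u un; rewrite E.
have lb := lenL_bound i; have lb' := lenL_bound i'.
have rb := lenR_bound i; have rb' := lenR_bound i'.
have [F|nF] := boolP (isF i p); have [F'|nF'] := boolP (isF i' p').
- have := isF_bound w F; have := isF_bound w' F' => b b'.
  by apply: match_left => //; lia.
- have [B'|nB'] := boolP (isB i' p').
    by case: nc; exists s, p, i', s', p'.
  have := marker_in_window sd sd' w w' E nF' nB'.
  by move: F nF' nB'; rewrite /isF /isB; lia.
- have [B|nB] := boolP (isB i p).
    by case: nc'; exists s', p', i, s, p.
  have := marker_in_window sd' sd w' w E' nF nB.
  by move: F' nF nB; rewrite /isF /isB; lia.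
have [B|nB] := boolP (isB i p); have [B'|nB'] := boolP (isB i' p').
- have := isB_bound w B; have := isB_bound w' B' => b b'.
  by apply: match_right => //; lia.
- have := marker_in_window sd sd' w w' E nF' nB'.
  by move: B nF' nB'; rewrite /isF /isB; lia.
- have := marker_in_window sd' sd w' w E' nF nB.
  by move: B' nF nB; rewrite /isF /isB; lia.
have M := marker_in_window sd sd' w w' E nF' nB'.
(* A window with start at most [lo] covers the aperiodic stretch of [Z]. Otherwise, by [nK], both
   windows are within [lo] of the right end and cover the stretch of [Y]. *)
have [pl|pl] := leqP (maxn p p') lo.
  by apply: match_left => //; lia.
by apply: match_right => //; rewrite /net_size; lia.
Qed.

End Net.

(** * Choice of the marker and existence of networks *)

Section Marker.
Variables (A : Type) (a0 : A).

(** An occurrence of the marker at a wrong place [q] equates each of its letters with a letter of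
    [u] or [v], or with another of its own letters, always on the same side. So [u], [v] and [q]
    determine it, by induction from the left if [q < size u] and from the right otherwise. This
    bounds the number of bad markers. *)
Lemma marker_determined (u v mu nu : seq A) q : size mu = size nu -> q <> size u ->
  q + size mu <= size u + size mu + size v ->
  (forall j, j < size mu -> nth a0 (u ++ mu ++ v) (q + j) = nth a0 mu j) ->
  (forall j, j < size mu -> nth a0 (u ++ nu ++ v) (q + j) = nth a0 nu j) ->
  mu = nu.
Proof.
move=> mn qu qb Em En.
have [lt|ge] := ltnP q (size u).
  apply: (@eq_from_nth _ a0) => //; elim/ltn_ind => j IH jm.
  rewrite -Em // -En // !nth_cat -mn; case: ltnP => // uj.
  case: ltnP => // jj; apply: IH; lia.
apply: (@eq_from_nth _ a0) => // j jm.
have [k] := ubnP (size mu - j); elim: k => // k IH in j jm *; move=> jk.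
rewrite -Em // -En // !nth_cat -mn; case: ltnP => // uj.
case: ltnP => // jj; apply: IH; lia.
Qed.

End Marker.

Lemma injection_card (T U : finType) (f : T -> U) : injective f -> #|T| <= #|U|.
Proof. by move=> fi; rewrite -(card_codom fi) max_card. Qed.

Section Construction.
Variables (A : finType) (a0 : A) (h : nat) (L : seq A -> Prop).
Hypotheses (hL : language_axioms h L).

Lemma loop_encode g c s : h <= size g -> L g -> (forall b, loop L g (c b)) ->
  loop L g (encode c s).
Proof.
move=> hg Lg cl; elim: s => [|b s IH]; first exact: loop_nil.
by apply: (loop_cat hL hg).
Qed.

Lemma half_lang Z e rho g c s : h <= size g -> L g -> (forall b, loop L g (c b)) ->
  L (take e Z ++ rho) -> (exists w, take e Z ++ rho = w ++ g) ->
  L (half Z e rho c s) /\ exists w, half Z e rho c s = w ++ g.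
Proof.
move=> hg Lg cl Lr [w wE]; rewrite /half catA.
by apply: (loop_extend hL hg Lr wE); apply: loop_encode.
Qed.

Lemma deviations T g : (forall (Z : seq A) a, L Z -> h <= a -> a + T <= size Z ->
    exists e rho, [/\ a <= e < a + T, 0 < size rho <= T,
      nth a0 rho 0 != nth a0 Z e, L (take e Z ++ rho) &
      exists w, take e Z ++ rho = w ++ g]) ->
  forall Z n d, L Z -> h <= n -> n + d * T <= size Z ->
  exists (e : 'I_d -> nat) (rho : 'I_d -> seq A), forall i : 'I_d,
    [/\ n + i * T <= e i < n + i * T + T, 0 < size (rho i) <= T,
      nth a0 (rho i) 0 != nth a0 Z (e i), L (take (e i) Z ++ rho i) &
      exists w, take (e i) Z ++ rho i = w ++ g].
Proof.
move=> dev Z n d LZ hn nd.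
have /choice[f fP] : forall i : 'I_d, exists x : nat * seq A,
    [/\ n + i * T <= x.1 < n + i * T + T, 0 < size x.2 <= T,
      nth a0 x.2 0 != nth a0 Z x.1, L (take x.1 Z ++ x.2) &
      exists w, take x.1 Z ++ x.2 = w ++ g].
  move=> i; have [] := dev Z (n + i * T) LZ; first by lia.
    have := ltn_ord i; have : i.+1 * T <= d * T by rewrite leq_mul2r ltn_ord orbT.
    by rewrite mulSn; lia.
  by move=> e [rho H]; exists (e, rho).
by exists (fun i => (f i).1), (fun i => (f i).2).
Qed.

Lemma mkside T g l (c : bool -> seq A) Z n lo Q K d cmu
    (e : 'I_d -> nat) (rho : 'I_d -> seq A) :
  0 < l -> (forall b, size (c b) = l) -> nth a0 (c false) 0 != nth a0 (c true) 0 ->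
  aperiodic a0 Z lo n Q -> n + d * T <= size Z ->
  (forall i : 'I_d,
    [/\ n + i * T <= e i < n + i * T + T, 0 < size (rho i) <= T,
      nth a0 (rho i) 0 != nth a0 Z (e i), L (take (e i) Z ++ rho i) &
      exists w, take (e i) Z ++ rho i = w ++ g]) ->
  d * T + T + d * l + cmu <= K ->
  side a0 d n lo Q K cmu Z c l e rho.
Proof.
move=> l0 cl cd ap nd H bound.
have iT (i : 'I_d) : i * T + T <= d * T.
  by have := ltn_ord i; rewrite addnC -mulSn leq_mul2r => ->; rewrite orbT.
split=> //.
- exact/eqP.
- by move=> i; have [? _ _ _ _] := H i; have := iT i; lia.
- move=> i j ij; apply: val_inj; have [ei _ _ _ _] := H i; have [ej _ _ _ _] := H j.
  have [lt|lt|//] /= := ltngtP i j.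
    have : i.+1 * T <= j * T by rewrite leq_mul2r lt orbT.
    by rewrite mulSn; lia.
  have : j.+1 * T <= i * T by rewrite leq_mul2r lt orbT.
  by rewrite mulSn; lia.
- by move=> i; have [_ /andP[]] := H i.
- by move=> i; have [_ _ /eqP] := H i.
- by move=> i; have [? /andP[_ ?] _ _ _] := H i; have := iT i; lia.
Qed.

End Construction.

Section NetExistence.
Variables (A : finType) (a0 : A) (h : nat) (L : seq A -> Prop).
Hypotheses (hL : language_axioms h L).

(** [C] bounds all lengths per unit of depth, which gives the scale [K = 4 * C * d] for what a half
    has beyond [n]. The marker [encode c tau ++ k] leads from the end [g] of the left half to
    [rev g'], the beginning of the right half. *)
Theorem net_exists : unbounded_language L -> exists C l c l' c', 
  [/\ 0 < l <= C & 0 < l' <= C] /\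
  forall d n Z Y, 0 < d -> h <= n -> 80 * C * d <= n -> 4 * n * d < 2 ^ d ->
  size Z = 2 * n -> size Y = 2 * n -> L Z -> L (rev Y) ->
  aperiodic a0 Z (n - 32 * C * d) n (8 * C * d) ->
  aperiodic a0 Y (n - 32 * C * d) n (8 * C * d) ->
  exists mu (e e' : 'I_d -> nat) rho rho', let K := 4 * C * d in
  [/\ side a0 d n (n - 32 * C * d) (8 * C * d) K (size mu) Z c l e rho,
      side a0 d n (n - 32 * C * d) (8 * C * d) K (size mu) Y c' l' e' rho',
      (forall i, size (rho i) <= C /\ size (rho' i) <= C),
      (forall i s q, size s = d -> q + size mu <= net_size d l l' e e' rho rho' mu i ->
       (forall j, j < size mu ->
          nth a0 (net_word Z Y c c' e e' rho rho' mu i s) (q + j) = nth a0 mu j) ->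
       q = side_len d l e rho i) &
      forall i s, size s = d -> L (net_word Z Y c c' e e' rho rho' mu i s)].
Proof.
move=> unb.
have hR := language_rev hL; have unbR := unbounded_rev unb.
have [g [c [l [gh l0 cl cloop cd]]]] := code_exists a0 hL unb.
have [g' [c' [l' [gh' l0' cl' cloop' cd']]]] := code_exists a0 hR unbR.
have [T dev] := deviation hL gh l0 cl cloop cd.
have [T' dev'] := deviation hR gh' l0' cl' cloop' cd'.
have Lg : L g by have [/(lang_prefix hL)] := cloop true.
have Lg' : (L \o rev) g' by have [/(lang_prefix hR)] := cloop' true.
have [k Lk] := lang_irr hL Lg Lg'.
pose C := T + T' + l + l' + size k.
have [C' CE] : exists C', C' = C by exists C.
exists C', l, c, l', c'; split; first by split; rewrite CE /C; lia.
move=> d n Z Y d0 hn Cn n2 sZ sY LZ LY apZ apY.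
have dC x : x <= C -> d * x <= C' * d by move=> xC; rewrite mulnC leq_mul2r CE xC orbT.
have dT := dC T ltac:(rewrite /C; lia); have dT' := dC T' ltac:(rewrite /C; lia).
have tot : d * T + d * T' + d * l + d * l' + d * size k = C' * d.
  by rewrite CE /C; lia.
have Td : T <= d * T by rewrite leq_pmull.
have Td' : T' <= d * T' by rewrite leq_pmull.
have kd : size k <= d * size k by rewrite leq_pmull.
have LY' : (L \o rev) Y by [].
have [e [rho H]] := deviations dev (n := n) (d := d) LZ hn ltac:(lia).
have [e' [rho' H']] := deviations dev' (n := n) (d := d) LY' hn ltac:(lia).
pose mk (t : seq bool) := encode c t ++ k.
have smk t : size t = 2 * d -> size (mk t) = 2 * d * l + size k.
  by move=> st; rewrite size_cat (size_encode cl) st.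
pose cm := 2 * d * l + size k.
have S1 : side a0 d n (n - 32 * C' * d) (8 * C' * d) (4 * C' * d) cm Z c l e rho.
  by apply: (mkside (T := T) (g := g) l0 cl cd apZ _ H); rewrite ?sZ /cm; lia.
have S2 : side a0 d n (n - 32 * C' * d) (8 * C' * d) (4 * C' * d) cm Y c' l' e' rho'.
  by apply: (mkside (T := T') (g := g') l0' cl' cd' apY _ H'); rewrite ?sY /cm; lia.
have hg : h <= size g by rewrite gh.
have hg' : h <= size g' by rewrite gh'.
have [tau [st tauP]] : exists tau, size tau = 2 * d /\
    forall i s q, size s = d -> q + cm <= side_len d l e rho i + cm + side_len d l' e' rho' i ->
    (forall j, j < cm -> nth a0 (net_word Z Y c c' e e' rho rho' (mk tau) i s) (q + j) =
                         nth a0 (mk tau) j) -> q = side_len d l e rho i.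
  (* If all candidates fail, choose for each [t] a triple [(i, s, q)] at which [mk t] occurs out of
     place. By [marker_determined] this choice is injective, but there are [2 ^ (2 * d)] candidates
     and only [d * 2 ^ d * (4 * n)] triples; hence the hypothesis [4 * n * d < 2 ^ d]. *)
  apply: contrapT => no.
  have bad (t : (2 * d).-tuple bool) : exists x : 'I_d * d.-tuple bool * 'I_(4 * n),
      [/\ x.2 + cm <= side_len d l e rho x.1.1 + cm + side_len d l' e' rho' x.1.1,
      forall j, j < cm -> nth a0 (net_word Z Y c c' e e' rho rho' (mk t) x.1.1 x.1.2) (x.2 + j) =
                         nth a0 (mk t) j & x.2 <> side_len d l e rho x.1.1 :> nat].
    apply: contrapT => nx; apply: no; exists t; split; first by rewrite size_tuple.
    move=> i s q sd qb Hq; apply: contrapT => qn; apply: nx.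
    have q4 : q < 4 * n.
      have := side_size S1 i; have := side_size S2 i.
      by move: qb; rewrite /side_len /root_size; lia.
    have sd' : size s == d by apply/eqP.
    by exists (i, Tuple sd', Ordinal q4).
  have /choice[f fP] := bad.
  suff /injection_card : injective f.
    rewrite !card_prod !card_tuple card_bool !card_ord (_ : 2 * d = d + d) ?expnD; last by lia.
    have : 2 ^ d * (4 * n * d) < 2 ^ d * 2 ^ d by rewrite ltn_mul2l expn_gt0 n2.
    by lia.
  move=> t t' E; apply: val_inj; have [b1 o1 n1] := fP t; have [b2 o2 n2'] := fP t'.
  have et : mk t = mk t'.
    move: b1 o1 n1 b2 o2 n2'; rewrite E; set x := f t' => b1 o1 n1 b2 o2 n2'.
    have sx : size (half Z (e x.1.1) (rho x.1.1) c x.1.2) = side_len d l e rho x.1.1.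
      by apply: (size_side S1); rewrite size_tuple.
    have sx' : size (rev (half Y (e' x.1.1) (rho' x.1.1) c' x.1.2)) = side_len d l' e' rho' x.1.1.
      by rewrite size_rev; apply: (size_side S2); rewrite size_tuple.
    have szt (r : (2 * d).-tuple bool) : size (mk r) = cm by rewrite smk ?size_tuple.
    apply: (@marker_determined _ a0 (half Z (e x.1.1) (rho x.1.1) c x.1.2)
      (rev (half Y (e' x.1.1) (rho' x.1.1) c' x.1.2)) _ _ x.2); rewrite ?szt ?sx ?sx' //.
  move: et => /eqP; rewrite eqseq_cat ?(size_encode cl) ?size_tuple // => /andP[/eqP et _].
  by apply: (encode_inj (a0 := a0) l0 cl) et; [exact/eqP|rewrite !size_tuple].
exists (mk tau), e, e', rho, rho'; rewrite /= smk //; split=> //.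
- move=> i; have [_ /andP[_ r1] _ _ _] := H i; have [_ /andP[_ r2] _ _ _] := H' i.
  by split; [apply: leq_trans r1 _|apply: leq_trans r2 _]; rewrite CE /C; lia.
- by move=> i s q sd; rewrite /net_size smk //; exact: tauP.
move=> i s sd; rewrite /net_word.
have [_ _ _ L1 g1] := H i; have [_ _ _ L2 g2] := H' i.
have [L3 [w3 g3]] := half_lang hL s hg Lg cloop L1 g1.
have [L4 [w4 g4]] := half_lang hR s hg' Lg' cloop' L2 g2.
have [L5 [w5 g5]] := loop_extend hL hg L3 g3 (loop_encode hL tau hg Lg cloop).
have L6 := lang_extend hL hg L5 g5 Lk.
rewrite g4 rev_cat /mk catA [X in X ++ _]catA catA -catA.
apply: (lang_glue hL); first by rewrite size_rev.
  by rewrite -!catA; rewrite -!catA in L6.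
by rewrite -rev_cat -g4.
Qed.

End NetExistence.

(** * Random subsets of a finite set *)

Section RandomSubset.
Local Open Scope ring_scope.
Variables (R : realType) (T : finType) (alpha : R).
Hypotheses (alpha_ge0 : 0 <= alpha) (alpha_le1 : alpha <= 1).

Definition weight (L w : {set T}) : R :=
  \prod_(b in L) (if b \in w then alpha else 1 - alpha).

Definition expect (L : {set T}) (f : {set T} -> R) : R :=
  \sum_(w in powerset L) weight L w * f w.

Definition pr (L : {set T}) (E : pred {set T}) : R :=
  \sum_(w in powerset L | E w) weight L w.

Definition depends_on (S : {set T}) (E : pred {set T}) := forall w, E (w :&: S) = E w.

Lemma weight_ge0 L w : 0 <= weight L w.
Proof. by apply: prodr_ge0 => b _; case: ifP; rewrite ?subr_ge0. Qed.

Lemma prE L E : pr L E = expect L (fun w => (E w)%:R).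
Proof.
rewrite /pr /expect big_mkcondr; apply: eq_bigr => w _.
by case: (E w); rewrite ?mulr1 ?mulr0.
Qed.

(** Fubini: the random subset of [L] is the union of independent random subsets of [S] and of
    [L :\: S]. *)
Lemma expect_split (S L : {set T}) f : S \subset L ->
  expect L f = expect S (fun u => expect (L :\: S) (fun v => f (u :|: v))).
Proof.
move=> SL; rewrite /expect.
under [RHS]eq_bigr => u _ do rewrite mulr_sumr.
rewrite pair_big /= (reindex_onto (fun p : {set T} * {set T} => p.1 :|: p.2)
  (fun w => (w :&: S, w :\: S))) /=; last by move=> w _; rewrite finset.setID.
apply: eq_big => [[u v]|[u v]] /=.
  rewrite !powersetE; apply/andP/andP => [[uvL /eqP[uE vE]]|[uS vL]].
    by split; [rewrite -uE finset.subsetIr|rewrite -vE finset.setSD].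
  split; first by rewrite finset.subUset (fintype.subset_trans uS SL)
    (fintype.subset_trans vL) ?finset.subsetDl.
  have vS : v :&: S = finset.set0.
    by apply/finset.setP => b; rewrite !inE; apply/negbTE/negP => /andP[/(fintype.subsetP vL)];
       rewrite !inE => /andP[/negP].
  rewrite finset.setIUl vS finset.setU0 (finset.setIidPl uS) finset.setDUl.
  have /eqP -> : u :\: S == finset.set0 by rewrite finset.setD_eq0.
  rewrite finset.set0U; apply/eqP; congr pair; apply/finset.setDidPl.
  by rewrite -finset.setI_eq0 vS.
move=> /andP[uvL /eqP[uE vE]]; rewrite mulrA; congr (_ * _).
rewrite /weight (finset.big_setID S) /=; congr (_ * _).
  rewrite (finset.setIidPr SL); apply: eq_bigr => b bS; congr (if _ then _ else _).
  by have := congr1 (fun X : {set T} => b \in X) uE; rewrite /= finset.in_setI bS andbT.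
apply: eq_bigr => b; rewrite inE => /andP[bS _]; congr (if _ then _ else _).
by have := congr1 (fun X : {set T} => b \in X) vE; rewrite /= finset.in_setD bS.
Qed.

Lemma expect1 L : expect L (fun=> 1) = 1.
Proof.
rewrite /expect; transitivity (\prod_(b : T) ((if b \in L then alpha else 0) +
    (if b \in L then 1 - alpha else 1))); last first.
  by apply: big1 => b _; case: ifP => _; rewrite ?add0r // addrC subrK.
rewrite bigA_distr big_mkcond /=; apply: eq_bigr => w _; rewrite powersetE mulr1.
case: ifPn => [wL|/subsetPn[b bw bL]].
  rewrite /weight big_mkcond /=; apply: eq_bigr => b _.
  by case: (boolP (b \in w)) => [/(fintype.subsetP wL) ->|_].
by rewrite (bigD1 b) //= bw (negPf bL) mul0r.
Qed.

Lemma expectZ L k f : expect L (fun w => k * f w) = k * expect L f.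
Proof. by rewrite /expect mulr_sumr; apply: eq_bigr => w _; rewrite mulrCA. Qed.

Lemma pr_ge0 L E : 0 <= pr L E.
Proof. by apply: sumr_ge0 => w _; exact: weight_ge0. Qed.

Lemma prT L : pr L predT = 1.
Proof. by rewrite prE -[RHS](expect1 L). Qed.

Lemma pr_sub (L : {set T}) (E F : pred {set T}) :
  (forall w : {set T}, w \subset L -> E w -> F w) -> pr L E <= pr L F.
Proof.
move=> EF; rewrite /pr [leLHS]big_mkcondr [leRHS]big_mkcondr; apply: ler_sum => w.
rewrite powersetE => wL; case: ifP => [/(EF w wL) -> //|_].
by case: ifP => // _; exact: weight_ge0.
Qed.

Lemma pr_le1 L E : pr L E <= 1.
Proof. by rewrite -(prT L); apply: pr_sub. Qed.

Lemma prC L E : pr L (fun w => ~~ E w) = 1 - pr L E.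
Proof.
apply/eqP; rewrite eq_sym subr_eq -(prT L) /pr (bigID E) /= addrC; apply/eqP.
by congr (_ + _); apply: eq_bigl => w; rewrite ?andbT.
Qed.

Lemma pr_union L (I : finType) (D : pred I) (E : I -> pred {set T}) :
  pr L (fun w => [exists i, D i && E i w]) <= \sum_(i | D i) pr L (E i).
Proof.
under [leRHS]eq_bigr => i _ do rewrite /pr big_mkcondr.
rewrite exchange_big /= /pr [leLHS]big_mkcondr; apply: ler_sum => w wL.
have nn (P : pred I) : 0 <= \sum_(i | P i) (if E i w then weight L w else 0).
  by apply: sumr_ge0 => i _; case: ifP => // _; exact: weight_ge0.
case: ifP => [/existsP[i /andP[Di Ei]]|_]; last exact: nn.
by rewrite (bigD1 i) //= Ei lerDl nn.
Qed.

Lemma pr_unionU L (E F : pred {set T}) :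
  pr L (fun w => E w || F w) <= pr L E + pr L F.
Proof.
rewrite /pr !big_mkcondr -big_split /=.
apply: ler_sum => w _; have := weight_ge0 L w.
by case: (E w); case: (F w) => //=; rewrite ?addr0 ?add0r // => w0; rewrite lerDl.
Qed.

Lemma pr_independent (L S S' : {set T}) E F : S \subset L -> [disjoint S & S'] ->
  depends_on S E -> depends_on S' F ->
  pr L (fun w => E w && F w) = pr L E * pr L F.
Proof.
move=> SL dis ES FS'.
have Eu (u v : {set T}) : u \subset S -> v \subset L :\: S -> E (u :|: v) = E u.
  move=> uS vL; rewrite -ES -[in RHS]ES; congr (E _); apply/finset.setP => b; rewrite !inE.
  case: (boolP (b \in S)) => bS; rewrite ?andbF // !andbT.
  case: (boolP (b \in v)) => bv; rewrite ?orbF ?orbT //.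
  by have := fintype.subsetP vL _ bv; rewrite inE bS.
have Fv (u v : {set T}) : u \subset S -> F (u :|: v) = F v.
  move=> uS; rewrite -FS' -[in RHS]FS'; congr (F _); apply/finset.setP => b; rewrite !inE.
  case: (boolP (b \in S')) => bS; rewrite ?andbF // !andbT.
  case: (boolP (b \in u)) => bu //=.
  by have := disjointFr dis (fintype.subsetP uS _ bu); rewrite bS.
have split2 (G : pred {set T}) (f g : {set T} -> R) :
    (forall u v : {set T}, u \subset S -> v \subset L :\: S -> (G (u :|: v))%:R = f u * g v) ->
    pr L G = expect S f * expect (L :\: S) g.
  move=> GE; rewrite prE (expect_split _ SL) mulrC -expectZ /expect.
  apply: eq_bigr => u; rewrite powersetE => uS; congr (_ * _).
  rewrite mulrC -expectZ; apply: eq_bigr => v; rewrite powersetE => vS.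
  by rewrite GE.
rewrite (split2 _ (fun u => (E u)%:R) (fun v => (F v)%:R)); last first.
  by move=> u v uS vS; rewrite Eu // Fv // -natrM mulnb.
rewrite (split2 E (fun u => (E u)%:R) (fun=> 1)); last first.
  by move=> u v uS vS; rewrite Eu // mulr1.
rewrite (split2 F (fun=> 1) (fun v => (F v)%:R)); last first.
  by move=> u v uS vS; rewrite Fv // mul1r.
by rewrite !expect1 mulr1 mul1r.
Qed.

Lemma depends_subset (S : {set T}) : depends_on S (fun w => S \subset w).
Proof. by move=> w; rewrite finset.subsetI subxx andbT. Qed.

Lemma depends_widen (S S' : {set T}) E : S \subset S' -> depends_on S E -> depends_on S' E.
Proof.
move=> SS ES w; rewrite -ES -[RHS]ES -finset.setIA; congr (E (_ :&: _)).
exact/finset.setIidPr.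
Qed.

Lemma pr_subset (L S : {set T}) : S \subset L ->
  pr L (fun w => S \subset w) = alpha ^+ #|S|.
Proof.
move=> SL; rewrite prE (expect_split _ SL) /expect (bigD1 S) ?powersetE //=.
rewrite [X in _ + X]big1 ?addr0; last first.
  move=> u /andP[]; rewrite powersetE => uS un; rewrite big1 ?mulr0 // => v.
  rewrite powersetE => vL; suff /negPf -> : ~~ (S \subset u :|: v) by rewrite mulr0.
  apply: contra un => SU; rewrite finset.eqEsubset uS /=; apply/fintype.subsetP => b bS.
  have := fintype.subsetP SU _ bS; rewrite inE => /orP[//|bv].
  by have := fintype.subsetP vL _ bv; rewrite inE bS.
under eq_bigr => v _ do rewrite finset.subsetUl.
rewrite -/(expect (L :\: S) (fun=> 1)) expect1 mulr1 /weight -prodr_const.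
by apply: eq_bigr => b ->.
Qed.

Lemma pr_all_independent (I : eqType) (s : seq I) (L : {set T}) (S : I -> {set T})
    (E : I -> pred {set T}) : uniq s ->
  (forall i, i \in s -> S i \subset L /\ depends_on (S i) (E i)) ->
  (forall i j, i \in s -> j \in s -> i != j -> [disjoint S i & S j]) ->
  pr L (fun w => all (fun i => E i w) s) = \prod_(i <- s) pr L (E i).
Proof.
elim: s => [|i s IH] /=; first by rewrite big_nil prT.
move=> /andP[is_ us] H dis; rewrite big_cons -IH //; last 2 first.
- by move=> j js; apply: H; rewrite inE js orbT.
- by move=> j k js ks; apply: dis; rewrite inE ?js ?ks orbT.
have [SL Ei] := H i (mem_head _ _).
apply: (@pr_independent _ (S i) [set b | has (fun j => b \in S j) s]) => //.
  rewrite finset.disjoints_subset; apply/fintype.subsetP => b bS; rewrite !inE.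
  apply/negP => /hasP[j js bj].
  have := dis i j (mem_head _ _); rewrite inE js orbT => /(_ isT).
  have ij : i != j by apply: contra is_ => /eqP ->.
  by move=> /(_ ij) /disjointFr /(_ bS); rewrite bj.
move=> w; apply: eq_in_all => j js; have [|_ Ej] := H j; first by rewrite inE js orbT.
apply: (depends_widen _ Ej); apply/fintype.subsetP => b bj; rewrite inE.
by apply/hasP; exists j.
Qed.

End RandomSubset.

Lemma rcons_cat_neq (T : Type) (s t : seq T) x : s <> rcons s x ++ t.
Proof. by move=> /(congr1 size); rewrite size_cat size_rcons; lia. Qed.

(** * Open branches in a binary tree of disjoint random sets *)

Section Tree.
Local Open Scope ring_scope.
Variables (R : realType) (T : finType) (alpha : R).
Hypotheses (alpha_ge0 : 0 <= alpha) (alpha_le1 : alpha <= 1).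
Variables (L : {set T}) (Win : seq bool -> {set T}) (d w0 N : nat).

Fixpoint tree_open (r : nat) (s : seq bool) (w : {set T}) : bool :=
  (Win s \subset w) && (if r is r'.+1 then
    tree_open r' (rcons s false) w || tree_open r' (rcons s true) w else true).

Fixpoint tree_support (r : nat) (s : seq bool) : {set T} :=
  Win s :|: (if r is r'.+1 then
    tree_support r' (rcons s false) :|: tree_support r' (rcons s true) else finset.set0).

Hypothesis Win_sub : forall s, Win s \subset L.

Lemma tree_supportP r s b : b \in tree_support r s ->
  exists2 t, (size t <= r)%N & b \in Win (s ++ t).
Proof.
elim: r s => [|r IH] s /=; first by rewrite finset.setU0 => bs; exists [::]; rewrite ?cats0.
rewrite !inE => /or3P[bs|/IH[t tr bt]|/IH[t tr bt]].
- by exists [::]; rewrite ?cats0.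
- by exists (false :: t) => //; rewrite -cat_rcons.
- by exists (true :: t) => //; rewrite -cat_rcons.
Qed.

Lemma tree_support_sub r s : tree_support r s \subset L.
Proof.
by apply/fintype.subsetP => b /tree_supportP[t _]; apply/fintype.subsetP.
Qed.

Lemma tree_open_depends r s : depends_on (tree_support r s) (tree_open r s).
Proof.
elim: r s => [|r IH] s /= w.
  by rewrite finset.setU0 (depends_subset (Win s)).
congr (_ && _).
  by apply: (depends_widen _ (@depends_subset _ (Win s))); exact: finset.subsetUl.
congr (_ || _); apply: (depends_widen _ (IH _)); apply: fintype.subset_trans (finset.subsetUr _ _).
  exact: finset.subsetUl.
exact: finset.subsetUr.
Qed.

Lemma tree_openP r s w : tree_open r s w ->
  exists2 t, size t = r & forall j, (j <= r)%N -> Win (s ++ take j t) \subset w.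
Proof.
elim: r s => [|r IH] s /=.
  by rewrite andbT => sw; exists [::] => // j _; rewrite cats0.
move=> /andP[sw /orP[] /IH[t tr H]].
  exists (false :: t); first by rewrite /= tr.
  by case=> [|j] jr; rewrite ?take0 ?cats0 //= -cat_rcons H.
exists (true :: t); first by rewrite /= tr.
by case=> [|j] jr; rewrite ?take0 ?cats0 //= -cat_rcons H.
Qed.

Hypothesis Win_inj : forall s t b, (size s <= d)%N -> (size t <= d)%N ->
  b \in Win s -> b \in Win t -> s = t.
Hypothesis Win_inner : forall s, (size s < d)%N -> (#|Win s| <= w0)%N.
Hypothesis Win_leaf : forall s, size s = d -> (#|Win s| <= N)%N.

Variables (beta Y0 : R).
Hypotheses (beta0 : 0 <= beta) (beta3 : beta <= 1 / 3) (alphaw : 1 <= alpha ^+ w0 * (1 + beta)).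
Hypotheses (alphaN : 1 <= alpha ^+ N * Y0).

(** A bound for the inverse of the probability that a tree with [r] further levels is open. For
    inverses the recursion is almost affine: two children with bound [z] give [(1 + z) / 2], times
    [1 + beta] for the node itself. So the large cost [Y0] of a leaf shrinks geometrically. *)
Let u r : R := 1 + 3 * beta + (2 / 3) ^+ r * Y0.

Lemma Y0_ge0 : 0 <= Y0.
Proof.
rewrite leNgt; apply: contraL alphaN => Yn; rewrite -ltNge.
apply: le_lt_trans ltr01; rewrite mulr_ge0_le0 ?exprn_ge0 //; exact: ltW.
Qed.

Lemma tree_open_pr r s : (size s + r)%N = d -> 1 <= pr alpha L (tree_open r s) * u r.
Proof.
have Y0_0 := Y0_ge0.
have up k : 1 <= u k.
  rewrite /u -addrA lerDl addr_ge0 ?mulr_ge0 ?exprn_ge0 //; lra.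
elim: r s => [|r IH] s sr.
  rewrite /u expr0 mul1r.
  have -> : pr alpha L (tree_open 0 s) = alpha ^+ #|Win s|.
    rewrite -(pr_subset alpha (Win_sub s)).
    by rewrite /pr; apply: eq_bigl => w /=; rewrite andbT.
  apply: le_trans alphaN _; apply: ler_pM; rewrite ?exprn_ge0 //; last first.
    by have := beta0; lra.
  by apply: ler_wiXn2l => //; apply: Win_leaf; rewrite -sr addn0.
have sub b : (size (rcons s b) + r)%N = d by rewrite size_rcons addSnnS.
have sd : (size s < d)%N by rewrite -sr -addSnnS leq_addr.
have cd b t : (size t <= r)%N -> (size (rcons s b ++ t) <= d)%N.
  by move=> tr; rewrite size_cat -(sub b) leq_add2l.
set E0 := tree_open r (rcons s false); set E1 := tree_open r (rcons s true).
set S0 := tree_support r (rcons s false); set S1 := tree_support r (rcons s true).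
have dis01 : [disjoint S0 & S1].
  rewrite finset.disjoints_subset; apply/fintype.subsetP => b b0; rewrite inE; apply/negP => b1.
  have [t tr bt] := tree_supportP b0; have [t' tr' bt'] := tree_supportP b1.
  have : rcons s false ++ t = rcons s true ++ t'.
    by apply: (Win_inj _ _ bt bt'); exact: cd.
  by move=> /eqP; rewrite eqseq_cat ?size_rcons // eqseq_rcons andbF.
have disS : [disjoint Win s & S0 :|: S1].
  rewrite finset.disjoints_subset; apply/fintype.subsetP => b b0; rewrite !inE; apply/negP.
  move=> /orP[] /tree_supportP[t tr bt];
    exact: (rcons_cat_neq (Win_inj (ltnW sd) (cd _ _ tr) b0 bt)).
have D0 : depends_on S0 E0 by apply: tree_open_depends.
have D1 : depends_on S1 E1 by apply: tree_open_depends.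
have -> : pr alpha L (tree_open r.+1 s) =
    alpha ^+ #|Win s| * (1 - (1 - pr alpha L E0) * (1 - pr alpha L E1)).
  rewrite -(pr_subset alpha (Win_sub s)) -!prC.
  rewrite -(@pr_independent _ _ _ L S0 S1 (fun w => ~~ E0 w) (fun w => ~~ E1 w)) //; last 3 first.
  - exact: tree_support_sub.
  - by move=> w; rewrite D0.
  - by move=> w; rewrite D1.
  rewrite -prC -(@pr_independent _ _ _ L (Win s) (S0 :|: S1)) //.
  - by rewrite /pr; apply: eq_bigl => w /=; rewrite negb_and !negbK.
  - exact: depends_subset.
  - move=> w; congr (~~ (~~ _ && ~~ _)).
      by apply: (depends_widen _ D0); exact: finset.subsetUl.
    by apply: (depends_widen _ D1); exact: finset.subsetUr.
have p0 := IH _ (sub false); have p1 := IH _ (sub true); rewrite -/E0 -/E1 in p0 p1.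
have p00 := pr_ge0 alpha_ge0 alpha_le1 L E0; have p10 := pr_ge0 alpha_ge0 alpha_le1 L E1.
have p01 := pr_le1 alpha_ge0 alpha_le1 L E0; have p11 := pr_le1 alpha_ge0 alpha_le1 L E1.
move: p0 p1 p00 p10 p01 p11; move: (pr alpha L E0) (pr alpha L E1) => x y.
move=> xu yu x0 y0 x1 y1.
have aw : alpha ^+ w0 <= alpha ^+ #|Win s|.
  by apply: ler_wiXn2l => //; exact: Win_inner.
(* With [beta <= 1 / 3], the factor [(1 + beta) / 2] is at most [2 / 3], which is the rate in [u],
   and [3 * beta ^+ 2 <= beta] makes [1 + 3 * beta] reproduce itself. *)
have uS : (1 + beta) * (1 + u r) <= 2 * u r.+1.
  rewrite /u exprS; have : 0 <= (2 / 3) ^+ r * Y0 by rewrite mulr_ge0 ?exprn_ge0 //; lra.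
  rewrite -mulrA; move: ((2 / 3) ^+ r * Y0) => v v0.
  have b3 : 0 <= 1 / 3 - beta by rewrite subr_ge0.
  have := mulr_ge0 beta0 b3; have := mulr_ge0 v0 b3; have := beta0; lra.
(* with [z = 1 / x >= 1]: [1 / (x (2 - x)) <= (1 + z) / 2] *)
have key : 2 <= (1 - (1 - x) * (1 - y)) * (1 + u r).
  have u1 := up r; move: (u r) u1 xu yu => z z1 xz yz.
  have z0 : 0 < z by lra.
  pose t := z^-1.
  have t1 : t * z = 1 by rewrite mulVf // gt_eqF.
  have t0 : 0 < t by rewrite invr_gt0.
  have tx : t <= x by rewrite -(ler_pM2r z0) t1.
  have ty : t <= y by rewrite -(ler_pM2r z0) t1.
  have tt : t <= 1 by lra.
  have : (1 - x) * (1 - y) <= (1 - t) * (1 - t) by apply: ler_pM; lra.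
  move=> h; apply: (@le_trans _ _ ((1 - (1 - t) * (1 - t)) * (1 + z))); last first.
    by apply: ler_wpM2r; lra.
  have -> : (1 - (1 - t) * (1 - t)) * (1 + z) = 2 * t - t * t + 2 * (t * z) - t * (t * z) by ring.
  rewrite t1; have t2 : 0 <= 1 - t by rewrite subr_ge0.
  by have := mulr_ge0 (ltW t0) t2; lra.
set q := 1 - _ in key *.
have q0 : 0 <= q by rewrite /q subr_ge0 mulr_ile1 ?subr_ge0 //; lra.
have a0 : 0 <= alpha ^+ w0 by rewrite exprn_ge0.
have step : 1 <= alpha ^+ w0 * q * u r.+1.
  have : 2 <= (alpha ^+ w0 * (1 + beta)) * (q * (1 + u r)).
    by rewrite -[leLHS]mul1r; apply: ler_pM.
  have : alpha ^+ w0 * q * ((1 + beta) * (1 + u r)) <= alpha ^+ w0 * q * (2 * u r.+1).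
    by apply: ler_wpM2l => //; rewrite mulr_ge0.
  have -> : alpha ^+ w0 * q * ((1 + beta) * (1 + u r)) =
            alpha ^+ w0 * (1 + beta) * (q * (1 + u r)) by ring.
  have -> : alpha ^+ w0 * q * (2 * u r.+1) = 2 * (alpha ^+ w0 * q * u r.+1) by ring.
  by lra.
apply: le_trans step _; apply: ler_wpM2r; first by have := up r.+1; lra.
by apply: ler_wpM2r.
Qed.

Lemma tree_closed_pr :
  pr alpha L (fun w => ~~ tree_open d [::] w) <= 3 * beta + (2 / 3) ^+ d * Y0.
Proof.
have := @tree_open_pr d [::] erefl; rewrite prC /u.
have := pr_ge0 alpha_ge0 alpha_le1 L (tree_open d [::]).
have := pr_le1 alpha_ge0 alpha_le1 L (tree_open d [::]).
have : 0 <= (2 / 3) ^+ d * Y0 by rewrite mulr_ge0 ?exprn_ge0 ?Y0_ge0 //; lra.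
move: ((2 / 3) ^+ d * Y0) (pr _ _ _) => v p v0 p1 p0 H.
have b0 := beta0; have q0 : 0 <= 1 - p by rewrite subr_ge0.
have s0 : 0 <= 3 * beta + v by lra.
by have := mulr_ge0 q0 s0; lra.
Qed.

End Tree.

(** * Independent families of events and disjoint subfamilies *)

Section Family.
Local Open Scope ring_scope.
Variables (R : realType) (T : finType) (alpha : R).
Hypotheses (alpha_ge0 : 0 <= alpha) (alpha_le1 : alpha <= 1).

Lemma all_closed_pr (I : finType) (D : pred I) (L : {set T}) (S : I -> {set T})
    (E : I -> pred {set T}) (eta : R) k : 0 <= eta <= 1 ->
  (forall i, D i -> S i \subset L /\ depends_on (S i) (E i)) ->
  (forall i j, D i -> D j -> i != j -> [disjoint S i & S j]) ->
  (forall i, D i -> pr alpha L (E i) <= eta) -> (k <= #|D|)%N ->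
  pr alpha L (fun w => [forall i, D i ==> E i w]) <= eta ^+ k.
Proof.
move=> /andP[e0 e1] H dis Ee kD.
have -> : pr alpha L (fun w => [forall i, D i ==> E i w]) =
          pr alpha L (fun w => all (fun i => E i w) (enum D)).
  rewrite /pr; apply: eq_bigl => w; congr (_ && _).
  apply/forallP/allP => [a i|a i]; first by rewrite mem_enum => Di; have := a i; rewrite [D i]Di.
  by apply/implyP => Di; apply: a; rewrite mem_enum.
rewrite (@pr_all_independent _ _ _ _ _ _ S); last 3 first.
- exact: enum_uniq.
- by move=> i; rewrite mem_enum; exact: H.
- by move=> i j; rewrite !mem_enum; exact: dis.
rewrite big_enum /=; apply: (@le_trans _ _ (\prod_(i in D) eta)).
  by apply: ler_prod => i Di; rewrite pr_ge0 // Ee.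
by rewrite prodr_const; apply: ler_wiXn2l.
Qed.

Lemma card_bigcup_le (I U : finType) (F : {set I}) (S : I -> {set U}) N :
  (forall i, (#|S i| <= N)%N) -> (#|\bigcup_(i in F) S i| <= #|F| * N)%N.
Proof.
move=> SN; apply: (@leq_trans (\sum_(i in F) N)); last by rewrite sum_nat_const.
elim/big_rec2: _ => [|i k B _ IH]; first by rewrite cards0.
by apply: leq_trans (leq_card_setU _ _) _; apply: leq_add.
Qed.

(** For a maximal disjoint subfamily [F], every [S i] meets the union over [F]. That union has at
    most [#|F| * N] elements, each in at most [m] sets. Nonemptiness makes the members of [F]
    themselves meet the union. *)
Lemma disjoint_subfamily (I : finType) (S : I -> {set T}) (N m : nat) :
  (forall i, (#|S i| <= N)%N) -> (forall b, (#|[set i | b \in S i]| <= m)%N) ->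
  (forall i, S i != finset.set0) ->
  exists2 F : {set I}, (#|I| <= #|F| * N * m)%N &
    forall i j, i \in F -> j \in F -> i != j -> [disjoint S i & S j].
Proof.
move=> SN Sm Sn0.
pose P (F : {set I}) := [forall i in F, forall j in F, (i != j) ==> [disjoint S i & S j]].
have P0 : P finset.set0 by apply/forallP => i; rewrite inE.
have [F /maxsetP[FP Fmax] _] := maxset_exists P0.
exists F; last first.
  move=> i j iF jF ij; move/forallP: FP => /(_ i); rewrite iF => /forallP/(_ j).
  by rewrite jF ij.
pose U := \bigcup_(i in F) S i.
have cov : [set: I] \subset \bigcup_(b in U) [set i | b \in S i].
  apply/fintype.subsetP => i _; apply/bigcupP.
  suff /existsP[b /andP[bU bi]] : [exists b, (b \in U) && (b \in S i)].
    by exists b; rewrite ?inE.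
  have [iF|iF] := boolP (i \in F).
    have /finset.set0Pn[b bi] := Sn0 i; apply/existsP; exists b.
    by rewrite bi andbT; apply/finset.bigcupP; exists i.
  apply: contraT; rewrite negb_exists => /forallP H.
  have disU j : j \in F -> [disjoint S i & S j].
    move=> jF; rewrite finset.disjoints_subset; apply/fintype.subsetP => b bi; rewrite inE.
    have := H b; rewrite bi andbT; apply: contra => bj.
    by apply/finset.bigcupP; exists j.
  have : i |: F = F.
    apply: Fmax; last exact: finset.subsetUr.
    apply/forallP => j; apply/implyP; rewrite !inE => jF.
    apply/forallP => k; apply/implyP; rewrite !inE => kF; apply/implyP => jk.
    have [ji|ji] := eqVneq j i; have [ki|ki] := eqVneq k i.
    - by move: jk; rewrite ji ki eqxx.
    - by rewrite ji disU //; move: kF; rewrite (negPf ki).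
    - by rewrite ki disjoint_sym disU //; move: jF; rewrite (negPf ji).
    - move: jF kF; rewrite (negPf ji) (negPf ki) /= => jF kF.
      by move/forallP: FP => /(_ j); rewrite jF => /forallP/(_ k); rewrite kF jk.
  by move=> FE; move: iF; rewrite -FE !inE eqxx.
rewrite -cardsT; apply: leq_trans (subset_leq_card cov) _.
apply: leq_trans (@card_bigcup_le _ _ U _ m Sm) _; rewrite leq_mul2r; apply/orP; right.
exact: card_bigcup_le.
Qed.
End Family.

(** * Probability that a network is open *)

Section Windows.
Variables (A : finType) (a0 : A) (n : nat).

Definition window (p : nat) (W : seq A) : n.-tuple A := [tuple nth a0 W (p + i) | i < n].

Definition open_word (w : {set n.-tuple A}) (W : seq A) : Prop :=
  forall p, p + n <= size W -> window p W \in w.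

Definition linked (w : {set n.-tuple A}) (b b' : n.-tuple A) : Prop :=
  exists W, [/\ open_word w W, n <= size W, window 0 W = b & window (size W - n) W = b'].

Lemma windowP p W p' W' :
  (forall u, u < n -> nth a0 W (p + u) = nth a0 W' (p' + u)) <-> window p W = window p' W'.
Proof.
split=> [H|H u un]; first by apply: eq_from_tnth => i; rewrite !tnth_mktuple H.
by have := congr1 (fun t => tnth t (Ordinal un)) H; rewrite !tnth_mktuple.
Qed.

Lemma tval_window p W : p + n <= size W -> tval (window p W) = take n (drop p W).
Proof.
move=> pn; have sz : size (take n (drop p W)) = n by rewrite size_takel // size_drop; lia.
apply: (@eq_from_nth _ a0); rewrite size_tuple ?sz // => i iN.
by rewrite nth_take // nth_drop -(tnth_nth a0 _ (Ordinal iN)) tnth_mktuple.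
Qed.

Lemma window_lang h (L : seq A -> Prop) p W : language_axioms h L -> L W ->
  p + n <= size W -> L (window p W).
Proof.
move=> hL LW pn; rewrite tval_window //.
apply: (lang_factor hL (u := take p W) (w := drop n (drop p W))).
by rewrite !cat_take_drop.
Qed.

End Windows.

Lemma card_set_seq (T : finType) (s : seq T) (S : {set T}) m :
  {subset S <= s} -> size s <= m -> #|S| <= m.
Proof.
move=> Ss sm; apply: leq_trans sm; apply: leq_trans (card_size s).
by apply: subset_leq_card; apply/fintype.subsetP.
Qed.

Section NetProbability.
Variables (A : finType) (a0 : A) (h : nat) (L : seq A -> Prop).
Hypothesis hL : language_axioms h L.
Variables (C d n lo Q K : nat) (Z Y : seq A) (c c' : bool -> seq A).
Variables (l l' : nat) (e e' : 'I_d -> nat) (rho rho' : 'I_d -> seq A) (mu : seq A).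
Hypotheses (lo_n : lo <= n) (K_lo : K <= lo) (K_Q : 2 * K <= Q) (nK : n + 3 * K <= 2 * lo).
Hypotheses (sZ : size Z = 2 * n) (sY : size Y = 2 * n) (lC : l <= C) (lC' : l' <= C).
Hypothesis SL : side a0 d n lo Q K (size mu) Z c l e rho.
Hypothesis SR : side a0 d n lo Q K (size mu) Y c' l' e' rho'.
Hypothesis rhoC : forall i, size (rho i) <= C /\ size (rho' i) <= C.
Let NW := net_word Z Y c c' e e' rho rho' mu.
Let NS := net_size d l l' e e' rho rho' mu.
Hypothesis marker : forall i s q, size s = d -> q + size mu <= NS i ->
  (forall j, j < size mu -> nth a0 (NW i s) (q + j) = nth a0 mu j) -> q = side_len d l e rho i.
Hypothesis NWL : forall i s, size s = d -> L (NW i s).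
Let NWin := net_window d n l l' e e' rho rho' mu.
Let NL := net_level d n l l' e e' rho rho' mu.
Let cross i := crossing a0 d n Z Y c c' l l' e e' rho rho' mu i.
Let wd := window a0 n.

(** A node of the tree is a prefix of the bits. Any completion to depth [d] gives the same windows
    at the node, by [net_depends]; this one adds zeros. *)
Definition pad (s : seq bool) := take d (s ++ nseq d false).

Lemma size_pad s : size (pad s) = d.
Proof. by rewrite size_takel // size_cat size_nseq leq_addl. Qed.

Lemma take_pad s : size s <= d -> take (size s) (pad s) = s.
Proof. by move=> sd; rewrite /pad take_takel // take_size_cat. Qed.

(** Each window is charged to the node formed by exactly the bits on which it depends, so a node
    collects windows of both halves, and windows of different nodes are distinct by
    [net_collision]. *)
Definition node_windows (i : 'I_d) (s : seq bool) : {set n.-tuple A} :=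
  [set b in [seq wd p (NW i (pad s)) | p <- iota 0 (NS i) & NWin i p && (NL i p == size s)]].

Lemma node_windowsP i s b : reflect
  (exists p, [/\ NWin i p, NL i p = size s & b = wd p (NW i (pad s))]) (b \in node_windows i s).
Proof.
rewrite inE; apply: (iffP mapP) => [[p]|[p [w lv ->]]].
  by rewrite mem_filter => /andP[/andP[w /eqP lv] _] ->; exists p.
exists p => //; rewrite mem_filter w lv eqxx mem_iota /= add0n.
by move: w; rewrite /NWin /net_window -/(NS i); lia.
Qed.

Lemma node_windows_lang i s b : b \in node_windows i s -> L b.
Proof.
move=> /node_windowsP[p [w _ ->]]; apply: (window_lang a0 hL (NWL _ (size_pad _))).
rewrite (size_net_word SL SR) ?size_pad //; move: w; rewrite /NWin /net_window.
by have /andP[] := side_e SR i; lia.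
Qed.

(** The level stays equal to [size s] only while the right end of the window crosses one codeword
    (or [rho i] at the root), or while its left end does so in the right half: at most [C] places
    each. At a leaf this fails, because the window may move across the whole middle. *)
Lemma card_node_inner i s : size s < d -> #|node_windows i s| <= 2 * C.
Proof.
move=> sd; pose t := root_size e rho i + size s * l; pose t' := root_size e' rho' i + size s * l'.
apply: (@card_set_seq _ [seq wd p (NW i (pad s)) | p <-
  iota (t.+1 - n - C) C ++ iota (NS i - t') C]); last first.
  by rewrite size_map size_cat !size_iota; lia.
move=> b /node_windowsP[p [w lv ->]]; apply: map_f; rewrite mem_cat !mem_iota.
have /andP[ne _] := side_e SL i; have /andP[ne' _] := side_e SR i.
have [rC rC'] := rhoC i.
case/andP: w => w1; rewrite -/(NS i) => w2; move: lv; rewrite /NL /net_level -/(NS i).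
have gen (e0 : 'I_d -> nat) (rho0 : 'I_d -> seq A) l0 x : 0 < l0 -> l0 <= C ->
    size (rho0 i) <= C -> e0 i < x -> level d l0 e0 rho0 i x = size s ->
    root_size e0 rho0 i + size s * l0 < x + C /\ x <= root_size e0 rho0 i + size s * l0.
  move=> l00 lc rc ex lv; have ld : level d l0 e0 rho0 i x < d by rewrite lv.
  have lt j : j < d -> (j < level d l0 e0 rho0 i x) = (root_size e0 rho0 i + j * l0 < x).
    by move=> jd; rewrite /level leq_min jd ltn_ceil_div //; lia.
  have := lt _ sd; rewrite lv ltnn => /esym/negbT; rewrite -leqNgt => le; split=> //.
  case: (size s) sd lv {ld le} => [|j] jd lv; first by rewrite /root_size; lia.
  by have := lt j (ltnW jd); rewrite lv ltnSn => /esym; rewrite mulSn; lia.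
case: (leqP (level d l e rho i (p + n)) (level d l' e' rho' i (NS i - p))) => [le|/ltnW le].
  move=> lv; have [] := gen _ _ _ _ (side_l SL) lC rC w1 lv.
  rewrite -/t; lia.
move=> lv.
have w2' : e' i < NS i - p by lia.
have [] := gen _ _ _ _ (side_l SR) lC' rC' w2' lv.
rewrite -/t'; lia.
Qed.

Lemma card_node_leaf i s : #|node_windows i s| <= 2 * n.
Proof.
apply: (@card_set_seq _ [seq wd p (NW i (pad s)) | p <- iota 0 (2 * n)]); last first.
  by rewrite size_map size_iota.
move=> b /node_windowsP[p [/andP[w1 w2] lv ->]]; apply: map_f; rewrite mem_iota /= add0n.
have := side_size SL i; have := side_size SR i; have /andP[ne' _] := side_e SR i.
by move: w2; rewrite /net_size /side_len /root_size; lia.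
Qed.

Lemma node_windows_inj i s j t b : ~ cross i -> ~ cross j -> size s <= d -> size t <= d ->
  b \in node_windows i s -> b \in node_windows j t -> i = j /\ s = t.
Proof.
move=> ci cj sd td /node_windowsP[p [w lv ->]] /node_windowsP[p' [w' lv' /windowP E]].
have [ij pp T] := net_collision SL SR lo_n K_lo K_Q nK marker ci cj
  (size_pad s) (size_pad t) w w' E.
split=> //; move: T; rewrite -/(NL i p) lv take_pad // => ->.
have -> : size s = size t by rewrite -lv -lv' -ij -pp.
by rewrite take_pad.
Qed.

(** Along an open branch [s] the word [net_word i s] is open: a window before the first deviation is
    a window of [Z], one after the last is a window of [rev Y], and any other belongs to a node on
    the branch. *)
Lemma net_linked i w : open_word a0 w Z -> open_word a0 w (rev Y) ->
  tree_open (node_windows i) d [::] w -> linked a0 w (wd 0 Z) (wd n (rev Y)).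
Proof.
move=> oZ oY /tree_openP[s sd sw].
have sN : size (NW i s) = NS i by apply: (size_net_word SL SR).
have /andP[ne eZ] := side_e SL i; have /andP[ne' eY] := side_e SR i.
have left p : p + n <= e i -> wd p (NW i s) = wd p Z.
  move=> pe; apply/windowP => u un; rewrite /NW /net_word half_prefix //.
  by rewrite eZ; lia.
have NS2 : e i + e' i <= NS i by rewrite /NS /net_size /side_len /root_size; lia.
have right p : NS i <= p + e' i -> p + n <= NS i -> wd p (NW i s) = wd (p + 2 * n - NS i) (rev Y).
  move=> pe pn; apply/windowP => u un.
  rewrite (nth_rev_net_word SL SR sd); last by rewrite -/(NS i); lia.
  rewrite -/(NS i) rev_net_word half_prefix; last by rewrite eY andbT; lia.
  by rewrite nth_rev ?sY; [congr nth; lia|lia].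
exists (NW i s); rewrite sN; split.
- move=> p; rewrite sN -/(wd p (NW i s)) => pn.
  have [pe|pe] := leqP (p + n) (e i); first by rewrite left //; apply: oZ; lia.
  have [pe'|pe'] := leqP (NS i) (p + e' i).
    by rewrite right //; apply: oY; rewrite size_rev sY; lia.
  have w_ : NWin i p by rewrite /NWin /net_window pe.
  have lv : NL i p <= d by apply: net_level_le.
  have : wd p (NW i (pad (take (NL i p) s))) \in w.
    apply: (fintype.subsetP (sw _ lv)); apply/node_windowsP; exists p; split=> //.
    by rewrite size_takel // sd.
  suff -> : wd p (NW i (pad (take (NL i p) s))) = wd p (NW i s) by [].
  apply/windowP; apply: (net_depends SL SR (size_pad _) sd w_).
  have st : size (take (NL i p) s) = NL i p by rewrite size_takel ?sd.
  by have := @take_pad (take (NL i p) s); rewrite st => ->.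
- by lia.
- by apply: left; lia.
- by rewrite -/(wd _ _) right; [congr window; lia|lia|lia].
Qed.

Local Open Scope ring_scope.

Lemma net_pr (R : realType) (alpha beta Y0 eta : R) (Ln : {set n.-tuple A}) :
  0 <= alpha -> alpha <= 1 -> 0 <= beta -> beta <= 1 / 3 ->
  1 <= alpha ^+ (2 * C) * (1 + beta) -> 1 <= alpha ^+ (2 * n) * Y0 ->
  3 * beta + (2 / 3) ^+ d * Y0 <= eta -> 0 <= eta -> eta <= 1 ->
  (forall b : n.-tuple A, L b -> b \in Ln) ->
  pr alpha Ln (fun w => `[< [/\ open_word a0 w Z, open_word a0 w (rev Y) &
      ~ linked a0 w (wd 0 Z) (wd n (rev Y))] >]) <= eta ^+ d.-1.
Proof.
move=> a0' a1 b0 b3 aw aN et e0 e1 LLn.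
pose D : pred 'I_d := fun i => `[< ~ cross i >].
have sub i s : node_windows i s \subset Ln.
  by apply/fintype.subsetP => b /node_windows_lang /LLn.
apply: (@le_trans _ _ (pr alpha Ln
    (fun w => [forall i, D i ==> ~~ tree_open (node_windows i) d [::] w]))).
  apply: pr_sub => // w _ /asboolP[oZ oY nl]; apply/forallP => i; apply/implyP => _.
  by apply/negP => /(net_linked oZ oY).
apply: (@all_closed_pr _ _ _ a0' a1 _ _ _ (fun i => tree_support (node_windows i) d [::])).
- by rewrite e0.
- move=> i _; split; first exact: tree_support_sub.
  by move=> w; rewrite (tree_open_depends (node_windows i) d [::]).
- move=> i j /asboolP ci /asboolP cj ij; rewrite finset.disjoints_subset.
  apply/fintype.subsetP => b bi; rewrite inE; apply/negP => bj.
  have [s sd bs] := tree_supportP bi; have [t td bt] := tree_supportP bj.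
  by have [ij' _] := node_windows_inj ci cj sd td bs bt; rewrite ij' eqxx in ij.
- move=> i /asboolP ci; apply: le_trans et.
  apply: (tree_closed_pr a0' a1 (sub i) (w0 := (2 * C)%N) (N := (2 * n)%N)) => //.
  + by move=> s t b sd td bs bt; have [] := node_windows_inj ci ci sd td bs bt.
  + by move=> s; exact: card_node_inner.
  + by move=> s _; exact: card_node_leaf.
have [[i ci]|nc] := pselect (exists i, cross i).
  apply: (@leq_trans #|predC1 i|); first by rewrite cardC1 card_ord.
  apply: subset_leq_card; apply/fintype.subsetP => j; rewrite inE => ji.
  apply/asboolP => cj; move/eqP: ji; apply.
  exact: (crossing_unique SL SR lo_n K_lo K_Q nK cj ci).
apply: (@leq_trans #|'I_d|); first by rewrite card_ord leq_pred.
by apply: subset_leq_card; apply/fintype.subsetP => j _; apply/asboolP => cj; apply: nc; exists j.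
Qed.

End NetProbability.

(** * Shifts of finite type *)

Section Points.
Variables (A : finType) (a0 : A).
Implicit Types (x y z : full_shift A) (X D : set (full_shift A)).

Definition lang X (w : seq A) : Prop := exists2 x, X x & appears w x.

Lemma nth_subword x i n k : k < n -> nth a0 (subword x i n) k = x (i + k%:Z)%R.
Proof. by move=> kn; rewrite nth_mkseq. Qed.

Lemma size_subword x i n : size (subword x i n) = n.
Proof. by rewrite size_mkseq. Qed.

Lemma subwordP x i (w : seq A) :
  subword x i (size w) = w <-> forall k, k < size w -> x (i + k%:Z)%R = nth a0 w k.
Proof.
split=> [<- k|H]; first by rewrite size_subword => kn; rewrite nth_subword.
by apply: (@eq_from_nth _ a0); rewrite size_subword // => k kw; rewrite nth_subword // H.
Qed.

Lemma lang_subword X x i n : X x -> lang X (subword x i n).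
Proof. by move=> Xx; exists x => //; exists i; rewrite size_subword. Qed.

Lemma lang_sub X u v w : lang X (u ++ v ++ w) -> lang X v.
Proof.
move=> [x Xx [i /subwordP H]]; exists x => //; exists (i + (size u)%:Z)%R.
apply/subwordP => k kv; have := H (size u + k); rewrite !size_cat => /(_ ltac:(lia)).
rewrite !nth_cat ltnNge leq_addr /= addKn kv => <-.
by congr x; lia.
Qed.

Definition order_bound (F : seq (seq A)) := \max_(w <- F) size w.

Lemma forbidding_shift F k x : forbidding F x -> forbidding F (shift k x).
Proof.
move=> Fx w /Fx nx [i wE]; apply: nx; exists (i + k)%R; rewrite -[RHS]wE.
by apply: eq_mkseq => j; rewrite /shift; congr x; lia.
Qed.

(** A forbidden word has length at most [n], so if it ends after the common block it starts inside
    it or later, where the spliced point agrees with [y]. *)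
Lemma forbidding_splice F x y (i j : int) n : order_bound F <= n ->
  forbidding F x -> forbidding F y ->
  (forall k, k < n -> x (i + k%:Z)%R = y (j + k%:Z)%R) ->
  forbidding F (fun t : int => if (t < i + n%:Z)%R then x t else y (t - i + j)%R).
Proof.
move=> Fn Fx Fy xy w wF [a wE].
have wn : size w <= n by apply: leq_trans Fn; rewrite /order_bound (leq_bigmax_seq (F := size)).
move/subwordP: wE => wE; have [m mw] : exists m, size w = m by eexists.
rewrite mw in wE wn; have [le|lt] := lerP (a + m%:Z)%R (i + n%:Z)%R.
  apply: (Fx w wF); exists a; apply/subwordP => k; rewrite mw => kw; rewrite -wE //.
  by have -> : (a + k%:Z < i + n%:Z)%R by lia.
apply: (Fy w wF); exists (a - i + j)%R; apply/subwordP => k; rewrite mw => kw; rewrite -wE //.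
case: ltrP => h; last by congr y; lia.
have [r rE] : exists r : nat, (a + k%:Z = i + r%:Z)%R by exists (absz (a + k%:Z - i)%R); lia.
by rewrite rE xy; [congr y; lia|lia].
Qed.

Lemma forbidding_windows F x n : order_bound F <= n ->
  (forall i, lang (forbidding F) (subword x i n)) -> forbidding F x.
Proof.
move=> Fn H w wF [a /subwordP wE].
have wn : size w <= n by apply: leq_trans Fn; rewrite /order_bound (leq_bigmax_seq (F := size)).
have [y Fy [i]] := H a; rewrite size_subword => yE.
apply: (Fy w wF); exists i; apply/subwordP => k kw.
have kn : k < n by apply: leq_trans kw wn.
by rewrite -wE // -(nth_subword x a kn) -yE nth_subword.
Qed.

Lemma lang_glue_sft F u g v : order_bound F <= size g ->
  lang (forbidding F) (u ++ g) -> lang (forbidding F) (g ++ v) ->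
  lang (forbidding F) (u ++ g ++ v).
Proof.
move=> Fg [x Fx [i /subwordP xE]] [y Fy [j /subwordP yE]].
have sub : forall k, k < size g -> x (i + (size u)%:Z + k%:Z)%R = y (j + k%:Z)%R.
  move=> k kg; have /xE : size u + k < size (u ++ g) by rewrite size_cat ltn_add2l.
  rewrite nth_cat ltnNge leq_addr /= addKn => xk.
  have /yE : k < size (g ++ v) by rewrite size_cat ltn_addr.
  by rewrite nth_cat kg => ->; rewrite -xk; congr x; lia.
have Fz := forbidding_splice Fg Fx Fy sub; eexists; first exact: Fz.
exists i; apply/subwordP => k; move: xE yE; rewrite !size_cat.
have [su suE] : exists m, size u = m by eexists.
have [sg sgE] : exists m, size g = m by eexists.
have [sv svE] : exists m, size v = m by eexists.
rewrite suE sgE svE => xE yE kw; case: ltrP => h.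
  by rewrite xE; [rewrite catA [RHS]nth_cat size_cat suE sgE ifT //; lia|lia].
rewrite nth_cat suE ltnNge (_ : su <= k) /=; last by lia.
by rewrite -yE; [congr y; lia|lia].
Qed.

Lemma open_coordinate (i : int) (a : A) : open [set y : full_shift A | y i = a]%classic.
Proof.
rewrite openE => x xa; rewrite /interior /=.
have := iffLR (@cvg_sup _ _ _ (nbhs x) x _) (@cvg_id _ _) => /(_ (nbhs_filter x) i).
apply; rewrite nbhsE; exists [set y : full_shift A | y i = a]%classic => //; split=> //.
exists [set a]%classic; last by [].
exact: (@discrete_open (discrete_topology A)).
Qed.

Lemma open_cylinder x n :
  open [set y : full_shift A | forall k, k < n -> y (Posz k) = x (Posz k)]%classic.
Proof.
elim: n => [|n IH].
  have -> : [set y : full_shift A | forall k, k < 0 -> y (Posz k) = x (Posz k)]%classic = setT.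
    by apply/seteqP; split.
  exact: openT.
have -> : [set y : full_shift A | forall k, k < n.+1 -> y (Posz k) = x (Posz k)]%classic =
  ([set y : full_shift A | forall k, k < n -> y (Posz k) = x (Posz k)] `&`
   [set y : full_shift A | y (Posz n) = x (Posz n)])%classic.
  apply/seteqP; split=> [y H|y [H Hn] k] /=.
    by split=> [k kn|]; apply: H => //; apply: ltnW.
  by rewrite ltnS leq_eqVlt => /orP[/eqP ->|/H].
by apply: openI => //; exact: open_coordinate.
Qed.

(** The sets that contain a cylinder around [x] form a filter, which converges to [x] in every
    coordinate, hence in the product topology. *)
Lemma nbhs_cylinder x (O : set (full_shift A)) : nbhs x O ->
  exists r, forall y, (forall j : int, absz j <= r -> y j = x j) -> O y.
Proof.
pose cyl r := [set y : full_shift A | forall j : int, absz j <= r -> y j = x j]%classic.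
pose F : set_system (full_shift A) := [set U | exists r, (cyl r `<=` U)%classic]%classic.
have FF : Filter F.
  split.
  - by exists 0.
  - move=> P Q [r rP] [s sQ]; exists (maxn r s) => y yc; split.
      by apply: rP => j jr; apply: yc; rewrite leq_max jr.
    by apply: sQ => j js; apply: yc; rewrite leq_max js orbT.
  - by move=> P Q PQ [r rP]; exists r => y /rP /PQ.
suff FX : (F --> x)%classic by move=> /FX[r rO]; exists r.
apply/(@cvg_sup _ _ _ F x FF) => i U; rewrite nbhs_simpl nbhsE => -[B [[C oC BC] Bx] BU].
exists (absz i) => y yc; apply: BU; rewrite -BC /=; rewrite -BC /= in Bx.
by rewrite yc.
Qed.

Lemma lang_shift_at D (w : seq A) : (forall k y, D y -> D (shift k y)) -> lang D w ->
  exists2 x, D x & forall k, k < size w -> x (Posz k) = nth a0 w k.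
Proof.
move=> Ds [x Dx [i /subwordP wE]]; exists (shift i x); first exact: Ds.
by move=> k kw; rewrite /shift -wE //; congr x; lia.
Qed.

Lemma irreducible_shift D : irreducible_sft D -> forall k y, D y -> D (shift k y).
Proof. by move=> [[F ->] _] k y; exact: forbidding_shift. Qed.

Lemma irreducible_meet D (u v : seq A) N : irreducible_sft D -> lang D u -> lang D v ->
  exists x m, [/\ D x, N <= m, forall k, k < size u -> x (Posz k) = nth a0 u k &
    forall k, k < size v -> x (Posz (m + k)) = nth a0 v k].
Proof.
move=> iD Lu Lv; have Ds := irreducible_shift iD.
have [x Dx xu] := lang_shift_at Ds Lu; have [y Dy yv] := lang_shift_at Ds Lv.
have [_ H] := iD.
pose U n (z : full_shift A) := (D `&` [set y | forall k, k < n -> y (Posz k) = z (Posz k)])%classic.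
have oU n z : open_in D (U n z) by eexists; first exact: open_cylinder.
have Uz n z : D z -> (U n z !=set0)%classic by move=> Dz; exists z.
have [m Nm [_ [[z [Dz zx] <-] [_ zy]]]] :=
  H _ _ (oU (size u) x) (oU (size v) y) (Uz _ _ Dx) (Uz _ _ Dy) N.
exists z, m; split=> // k kn; first by rewrite zx // xu.
by rewrite -yv // -zy // /shift; congr z; lia.
Qed.

Lemma irreducible_language D : irreducible_sft D ->
  exists h, (exists2 F, D = forbidding F & h = order_bound F) /\ language_axioms h (lang D).
Proof.
move=> iD; have [[F DE] _] := iD; exists (order_bound F); split; first by exists F.
split.
- exact: lang_sub.
- by move=> u g v gh; rewrite DE; apply: lang_glue_sft.
- move=> u v Lu Lv; have [x [m [Dx um xu xv]]] := irreducible_meet (size u) iD Lu Lv.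
  exists (subword x (Posz (size u)) (m - size u)).
  have [su suE] : exists n, size u = n by eexists.
  exists x => //; exists 0%R; apply/subwordP => k; rewrite !size_cat size_subword suE => kb.
  rewrite suE in um xu; rewrite add0r nth_cat suE; case: ltnP => [/xu //|uk].
  rewrite nth_cat size_subword; case: ltnP => km.
    by rewrite nth_subword //; congr x; lia.
  by rewrite -xv; [congr x; lia|lia].
Qed.

Lemma language_card D N : exists2 s : seq (seq A), uniq s /\ size s = #|language N D| &
  forall w, w \in s -> size w = N /\ lang D w.
Proof.
exists [seq tval w | w <- enum (language N D)]; rewrite ?size_map -?cardE.
  by split=> //; rewrite map_inj_uniq ?enum_uniq //; exact: val_inj.
move=> w /mapP[t]; rewrite mem_enum inE => /asboolP Lt ->.
by rewrite size_tuple.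
Qed.

Lemma mem_language D N (w : N.-tuple A) : (w \in language N D) <-> lang D w.
Proof. by rewrite inE; split=> [/asboolP|H]; [|apply/asboolP]. Qed.

(* Words with a short period are determined by the period and a bounded prefix. *)
Lemma aperiodic_word D Q : 0 < Q -> (forall k y, D y -> D (shift k y)) ->
  unbounded_language (lang D) ->
  exists2 x, D x & forall q, 0 < q <= Q -> exists2 k, q <= k < 4 * Q &
    x (Posz k) <> x (Posz (k - q)).
Proof.
move=> Q0 Ds unb; apply: contrapT => no.
have per x i : D x -> exists2 q, 0 < q <= Q &
    forall k, q <= k < 4 * Q -> x (i + Posz k)%R = x (i + Posz (k - q))%R.
  move=> Dx; apply: contrapT => nq; apply: no; exists (shift i x); first exact: Ds.
  move=> q qQ; apply: contrapT => nk; apply: nq; exists q => // k kb; apply: contrapT => ne.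
  apply: nk; exists k => //; rewrite /shift addrC [X in _ <> x X]addrC; exact: ne.
have perw (w : seq A) : lang D w -> exists2 q, 0 < q <= Q &
    forall k, q <= k < size w -> nth a0 w k = nth a0 w (k - q).
  move=> [x Dx [i /subwordP wE]]; have [q qQ H] := per x i Dx; exists q => //.
  suff H' : forall k, q <= k -> x (i + Posz k)%R = x (i + Posz (k - q))%R.
    move=> k /andP[qk kw]; have kq := leq_ltn_trans (leq_subr q k) kw.
    by rewrite -!wE // H'.
  elim/ltn_ind => k IH qk; have [k4|k4] := ltnP k (4 * Q); first by apply: H; lia.
  (* The stretch of length [4 * Q] that ends at [k] has some period [q']. Moving [k] and [k - q]
     back by [q'] reduces the claim to a smaller index, so the period [q] of the first stretch
     persists. *)
  have [q' qQ' H2] := per x (i + Posz (k.+1 - 4 * Q))%R Dx.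
  have e1 : x (i + Posz k)%R = x (i + Posz (k - q'))%R.
    have -> : (i + Posz k)%R = (i + Posz (k.+1 - 4 * Q) + Posz (4 * Q - 1))%R by lia.
    by rewrite H2; [congr x; lia|lia].
  have e2 : x (i + Posz (k - q))%R = x (i + Posz (k - q - q'))%R.
    have -> : (i + Posz (k - q))%R = (i + Posz (k.+1 - 4 * Q) + Posz (4 * Q - 1 - q))%R by lia.
    by rewrite H2; [congr x; lia|lia].
  by rewrite e1 e2 IH; [congr x; lia|lia|lia].
have [N [s [us Ks] sL]] := unb #|{: 'I_Q.+1 * Q.-bseq A}|.
have /choice[f fP] : forall w : seq A, exists q : nat, lang D w -> 0 < q <= Q /\
    forall k, q <= k < size w -> nth a0 w k = nth a0 w (k - q).
  move=> w; have [/perw[q qQ H]|nw] := pselect (lang D w); first by exists q.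
  by exists 0.
pose g (w : seq A) : 'I_Q.+1 * Q.-bseq A := (inord (f w), insub_bseq Q (take Q w)).
have : uniq (map g s).
  rewrite map_inj_in_uniq // => u v us' vs [].
  have [Nu Lu] := sL _ us'; have [Nv Lv] := sL _ vs.
  have [qu Hu] := fP _ Lu; have [qv Hv] := fP _ Lv.
  move=> /(congr1 (@nat_of_ord _)); rewrite !inordK; try lia.
  move=> fuv /(congr1 (@bseqval _ _)); rewrite /insub_bseq !val_insubd.
  have tQ (w : seq A) : size (take Q w) <= Q by rewrite size_take; case: ltnP.
  rewrite !tQ => tuv; apply: (@eq_from_nth _ a0); first by rewrite Nu Nv.
  rewrite Nu => k; elim/ltn_ind: k => k IH kN.
  have [kQ|Qk] := ltnP k Q.
    by rewrite -(nth_take a0 kQ) tuv nth_take.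
  rewrite Hu ?Nu; last by lia.
  by rewrite Hv ?Nv -?fuv; [apply: IH; lia|lia].
move=> /card_uniqP; rewrite size_map => E.
by have := max_card (mem (map g s)); rewrite E leqNgt Ks.
Qed.

End Points.

(** * Strongly connected classes of blocks *)

Section Classes.
Variables (A : finType) (a0 : A) (n : nat) (w : {set n.-tuple A}).
Hypothesis n_gt0 : 0 < n.
Implicit Types (x y z : full_shift A) (D : set (full_shift A)) (b e : n.-tuple A).

Definition block x (i : int) : n.-tuple A := [tuple x (i + Posz k)%R | k < n].

Lemma tnth_block x i (k : 'I_n) : tnth (block x i) k = x (i + Posz k)%R.
Proof. exact: tnth_mktuple. Qed.

Lemma eq_block x y i j : (forall k, k < n -> x (i + Posz k)%R = y (j + Posz k)%R) ->
  block x i = block y j.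
Proof. by move=> H; apply: eq_from_tnth => k; rewrite !tnth_block H. Qed.

Lemma tval_block x i : tval (block x i) = subword x i n.
Proof.
apply: (@eq_from_nth _ a0); rewrite size_tuple ?size_subword // => k kn.
by rewrite nth_subword // -(tnth_nth a0 _ (Ordinal kn)) tnth_block.
Qed.

Lemma block_window x i (W : seq A) p :
  (forall k, k < n -> x (i + Posz k)%R = nth a0 W (p + k)) -> block x i = window a0 n p W.
Proof. by move=> H; apply: eq_from_tnth => k; rewrite tnth_block tnth_mktuple H. Qed.

Lemma window_subword x i N p : p + n <= N ->
  window a0 n p (subword x i N) = block x (i + Posz p)%R.
Proof.
move=> pN; symmetry; apply: block_window => k kn.
by rewrite nth_subword; [congr x; lia|lia].
Qed.

Lemma appears_block x b : appears b x <-> exists i, b = block x i.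
Proof.
split=> [[i]|[i ->]]; last by exists i; rewrite size_tuple; exact/esym/tval_block.
by rewrite size_tuple => bE; exists i; apply: val_inj; rewrite /= -bE; exact/esym/tval_block.
Qed.

Lemma open_take W m : open_word a0 w W -> open_word a0 w (take m W).
Proof.
move=> oW p; rewrite size_take_min leq_min => /andP[pm pW].
have -> : window a0 n p (take m W) = window a0 n p W; last exact: oW.
by apply/windowP => u un; rewrite nth_take //; lia.
Qed.

Lemma open_drop W m : open_word a0 w W -> open_word a0 w (drop m W).
Proof.
move=> oW p; rewrite size_drop => pW.
have -> : window a0 n p (drop m W) = window a0 n (m + p) W; last by apply: oW; lia.
by apply/windowP => u un; rewrite nth_drop addnA.
Qed.

Lemma linked_prefix W p : open_word a0 w W -> p + n <= size W ->
  linked a0 w (window a0 n 0 W) (window a0 n p W).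
Proof.
move=> oW pW; exists (take (p + n) W); rewrite size_takel // addnK leq_addl.
split=> //; first exact: open_take.
  by apply/windowP => u un; rewrite nth_take //; lia.
by apply/windowP => u un; rewrite nth_take //; lia.
Qed.

Lemma linked_suffix W p : open_word a0 w W -> p + n <= size W ->
  linked a0 w (window a0 n p W) (window a0 n (size W - n) W).
Proof.
move=> oW pW; exists (drop p W); rewrite size_drop; split; first exact: open_drop.
- by lia.
- by apply/windowP => u un; rewrite nth_drop add0n.
- by apply/windowP => u un; rewrite nth_drop; congr nth; lia.
Qed.

Lemma linked_trans b1 b2 b3 : linked a0 w b1 b2 -> linked a0 w b2 b3 -> linked a0 w b1 b3.
Proof.
move=> [U [oU nU U0 U1]] [V [oV nV V0 V1]].
have UV k : k < n -> nth a0 U (size U - n + k) = nth a0 V k.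
  by apply: (iffRL (windowP a0 n (size U - n) U 0 V)); rewrite U1 V0.
have nU' k : k < size U -> nth a0 (U ++ drop n V) k = nth a0 U k.
  by move=> kU; rewrite nth_cat kU.
have nV' k : size U - n <= k -> nth a0 (U ++ drop n V) k = nth a0 V (k - (size U - n)).
  move=> Uk; rewrite nth_cat; case: ltnP => kU; last by rewrite nth_drop; congr nth; lia.
  by rewrite -UV; [congr nth; lia|lia].
exists (U ++ drop n V); rewrite size_cat size_drop; split.
- move=> p; rewrite size_cat size_drop => pb.
  have [pU|pU] := leqP (p + n) (size U).
    have -> : window a0 n p (U ++ drop n V) = window a0 n p U; last exact: oU.
    by apply/windowP => u un; rewrite nU' //; lia.
  have -> : window a0 n p (U ++ drop n V) = window a0 n (p - (size U - n)) V.
    by apply/windowP => u un; rewrite nV'; [congr nth; lia|lia].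
  by apply: oV; lia.
- by lia.
- by rewrite -U0; apply/windowP => u un; rewrite nU' //; lia.
- by rewrite -V1; apply/windowP => u un; rewrite nV'; [congr nth; lia|lia].
Qed.

Lemma linked_between W p q : open_word a0 w W -> p <= q -> q + n <= size W ->
  linked a0 w (window a0 n p W) (window a0 n q W).
Proof.
move=> oW pq qW; have := linked_prefix (p := q - p) (open_drop (m := p) oW).
rewrite size_drop => /(_ ltac:(lia)).
have wd i : window a0 n i (drop p W) = window a0 n (p + i) W.
  by apply/windowP => u un; rewrite nth_drop addnA.
by rewrite !wd addn0 subnKC.
Qed.

Variable F : seq (seq A).
Hypothesis Fn : order_bound F <= n.
Let X : set (full_shift A) := forbidding F.
Hypothesis wX : forall b, b \in w -> lang X (tval b).

Lemma random_sftP x : random_sft X w x <-> forall i, block x i \in w.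
Proof.
split=> [[_ H] i|H]; first by apply: H; apply/appears_block; exists i.
split; last by move=> b /appears_block[i ->].
by apply: (forbidding_windows a0 Fn) => i; rewrite -tval_block; apply: wX.
Qed.

Lemma open_subword x i N : random_sft X w x -> open_word a0 w (subword x i N).
Proof.
by move=> /random_sftP H p; rewrite size_subword => pN; rewrite window_subword.
Qed.

Lemma irreducible_linked D x y i j : irreducible_sft D -> (D `<=` random_sft X w)%classic ->
  D x -> D y -> linked a0 w (block x i) (block y j).
Proof.
move=> iD DX Dx Dy.
have [z [m [Dz _ zx zy]]] := irreducible_meet a0 0 iD (lang_subword i n Dx) (lang_subword j n Dy).
rewrite size_subword in zx.
have oW : open_word a0 w (subword z 0%R (m + n)) by apply: open_subword; exact: DX.
rewrite size_subword in zy.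
have -> : block x i = window a0 n 0 (subword z 0%R (m + n)).
  apply: block_window => k kn; rewrite nth_subword; last by lia.
  by rewrite -(nth_subword a0 x i kn) -zx // add0r.
have -> : block y j = window a0 n m (subword z 0%R (m + n)).
  apply: block_window => k kn; rewrite nth_subword; last by lia.
  by rewrite -(nth_subword a0 y j kn) -zy // add0r.
by apply: linked_prefix => //; rewrite size_subword.
Qed.

(** A block of [w] is linked to itself by the word of length [n], without any cycle. So a class may
    carry no point at all, and nonemptiness of [scc_sft e] is a separate matter. *)
Definition scc e : {set n.-tuple A} := finset (fun b => `[< linked a0 w e b /\ linked a0 w b e >]).

Definition scc_sft e : set (full_shift A) := [set x | forall i, block x i \in scc e]%classic.

Lemma sccP e b : reflect (linked a0 w e b /\ linked a0 w b e) (b \in scc e).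
Proof. by rewrite inE; apply: asboolP. Qed.

Lemma scc_sub e b : b \in scc e -> b \in w.
Proof.
move/sccP => [[W [oW nW _ <-]] _]; apply: oW; rewrite subnK //.
Qed.

Lemma scc_sft_sub e : (scc_sft e `<=` random_sft X w)%classic.
Proof. by move=> x H; apply/random_sftP => i; apply: (@scc_sub e). Qed.

Lemma scc_sft_shift e k x : scc_sft e x -> scc_sft e (shift k x).
Proof.
move=> H i; have -> : block (shift k x) i = block x (i + k)%R; last exact: H.
by apply: eq_block => j _; rewrite /shift; congr x; lia.
Qed.

Lemma scc_linked e b b' : b \in scc e -> b' \in scc e -> linked a0 w b b'.
Proof. by move=> /sccP[_ be] /sccP[eb _]; apply: linked_trans be eb. Qed.

Lemma open_scc e W p : open_word a0 w W -> linked a0 w e (window a0 n 0 W) ->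
  linked a0 w (window a0 n (size W - n) W) e -> p + n <= size W -> window a0 n p W \in scc e.
Proof.
move=> oW eW We pW; apply/sccP; split.
  exact: linked_trans eW (linked_prefix oW pW).
exact: linked_trans (linked_suffix oW pW) We.
Qed.

Lemma is_sft_scc e : is_sft (scc_sft e).
Proof.
exists (F ++ [seq tval b | b <- enum (~: scc e)]); apply/seteqP; split=> x.
  move=> H u; rewrite mem_cat => /orP[uF|/mapP[b]].
    by have [Xx _] := scc_sft_sub H; exact: Xx.
  by rewrite mem_enum inE => bn -> /appears_block[i bE]; rewrite bE H in bn.
move=> H i; apply: contraT => bn.
suff : ~ appears (block x i) x by case; apply/appears_block; exists i.
by apply: H; rewrite mem_cat map_f ?orbT // mem_enum inE.
Qed.

Lemma irreducible_scc e : irreducible_sft (scc_sft e).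
Proof.
split; first exact: is_sft_scc.
move=> U V [G oG UE] [H oH VE] [x Ux] [y Vy] N.
have [Ex Gx] : (scc_sft e `&` G)%classic x by rewrite -UE.
have [Ey Hy] : (scc_sft e `&` H)%classic y by rewrite -VE.
have [r rG] : exists r, forall z, (forall j : int, absz j <= r -> z j = x j) -> G z.
  by apply: nbhs_cylinder; exact: open_nbhs_nbhs.
have [s sH] : exists r, forall z, (forall j : int, absz j <= r -> z j = y j) -> H z.
  by apply: nbhs_cylinder; exact: open_nbhs_nbhs.
(* Beyond [r], so that [z] keeps the coordinates of [x] on which [G] depends, and beyond [N], so
   that the return time is large enough. The word [W] ends in the block of [y] at [- s], which keeps
   all coordinates of [y] on which [H] depends. *)
pose i1 := (r + N).+1.
have lk := scc_linked (Ex (Posz i1)) (Ey (- Posz s)%R).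
have [W [oW nW W0 W1]] := lk.
have Wx k : k < n -> nth a0 W k = x (Posz i1 + Posz k)%R.
  move=> kn; have := congr1 (fun t => tnth t (Ordinal kn)) W0.
  by rewrite tnth_mktuple tnth_block.
have Wy k : k < n -> nth a0 W (size W - n + k) = y (- Posz s + Posz k)%R.
  move=> kn; have := congr1 (fun t => tnth t (Ordinal kn)) W1.
  by rewrite tnth_mktuple tnth_block.
have [sW sWE] : exists m, size W = m by eexists.
rewrite sWE in nW W1 Wy.
pose m := i1 + (sW - n).
pose z : full_shift A := fun j : int => if (j < Posz i1)%R then x j else
  if (j < Posz m)%R then nth a0 W (absz (j - Posz i1)%R) else y (j - Posz m - Posz s)%R.
have zy (j : int) : (Posz m <= j)%R -> z j = y (j - Posz m - Posz s)%R.
  by move=> mj; rewrite /z ifN ?ifN //; lia.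
have zW k : k < sW -> z (Posz (i1 + k)) = nth a0 W k.
  move=> kW; have [km|km] := ltnP k (sW - n).
    by rewrite /z ifN ?ifT; [congr nth; lia|lia|lia].
  rewrite zy; last by lia.
  have -> : k = sW - n + (k - (sW - n)) by lia.
  by rewrite Wy; [congr y; lia|lia].
have zx (j : int) : (j < Posz (i1 + n))%R -> z j = x j.
  move=> jn; have [ji|ji] := ltrP j (Posz i1); first by rewrite /z ji.
  have -> : j = Posz (i1 + absz (j - Posz i1)%R) by lia.
  by rewrite zW ?Wx; [congr x; lia|lia|lia].
have Ez : scc_sft e z.
  move=> j; have [ji|ji] := lerP j (Posz i1).
    by rewrite (_ : block z j = block x j) //; apply: eq_block => k kn; rewrite zx //; lia.
  have [jm|jm] := lerP (Posz m) j.
    rewrite (_ : block z j = block y (j - Posz m - Posz s)%R) //; apply: eq_block => k kn.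
    by rewrite zy; [congr y; lia|lia].
  rewrite (_ : block z j = window a0 n (absz (j - Posz i1)%R) W); last first.
    apply: block_window => k kn; rewrite -zW; last by lia.
    by congr z; lia.
  apply: open_scc => //.
  - by rewrite W0; have /sccP[] := Ex (Posz i1).
  - by rewrite sWE W1; have /sccP[] := Ey (- Posz s)%R.
  - by lia.
exists (m + s); first by lia.
exists (shift (Posz (m + s)) z); split.
  exists z => //; rewrite UE; split=> //; apply: rG => j jr; rewrite zx //; lia.
rewrite VE; split; first exact: scc_sft_shift.
by apply: sH => j js; rewrite /shift zy; [congr y; lia|lia].
Qed.

Lemma scc_maximal e D x i : irreducible_sft D -> (D `<=` random_sft X w)%classic ->
  D x -> block x i \in scc e -> (D `<=` scc_sft e)%classic.
Proof.
move=> iD DX Dx /sccP[ex xe] y Dy j; apply/sccP; split.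
  exact: linked_trans ex (irreducible_linked _ _ iD DX Dx Dy).
exact: linked_trans (irreducible_linked _ _ iD DX Dy Dx) xe.
Qed.

Lemma scc_component e : (scc_sft e !=set0)%classic ->
  irreducible_component (random_sft X w) (scc_sft e).
Proof.
move=> [x Ex]; split; [by exists x|exact: scc_sft_sub|exact: irreducible_scc|].
move=> D _ DX iD ED; apply/seteqP; split=> //.
exact: (scc_maximal iD DX (ED _ Ex) (Ex 0%R)).
Qed.

Lemma component_scc e D x i : irreducible_component (random_sft X w) D ->
  D x -> block x i \in scc e -> D = scc_sft e.
Proof.
move=> [_ DX iD Dmax] Dx xe; have DE := scc_maximal iD DX Dx xe.
symmetry; apply: Dmax => //; [by exists x; apply: DE|exact: scc_sft_sub|exact: irreducible_scc].
Qed.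

End Classes.

(** * Entropy *)

Section Fekete.
Local Open Scope ring_scope.
Local Open Scope classical_set_scope.
Variables (R : realType) (u : nat -> R).
Hypotheses (u_ge0 : forall n, 0 <= u n) (u_add : forall m n, u (m + n)%N <= u m + u n).

(** The factor is [k.+1] because [u 0] may be positive. *)
Lemma subadditive_mul k n : u (k.+1 * n)%N <= k.+1%:R * u n.
Proof.
elim: k => [|k IH]; first by rewrite mul1n mul1r.
rewrite mulSn (le_trans (u_add _ _)) // -[in leRHS]natr1 mulrDl mul1r addrC lerD2r.
exact: IH.
Qed.

(** Fekete's lemma. As [entropy] is defined by [limn], convergence must be known before a lower
    bound passes to the limit. *)
Lemma subadditive_cvg : cvgn (fun n => u n / n%:R).
Proof.
pose S := [set u n.+1 / n.+1%:R | n in setT].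
have S0 : S !=set0 by exists (u 1 / 1%:R), 0%N.
have lb : lbound S 0 by move=> _ [n _ <-]; rewrite divr_ge0 ?ler0n.
have hS : has_inf S by split=> //; exists 0.
apply/cvg_ex; exists (inf S); apply/cvgrPdist_le => eps eps0.
have e2 : 0 < eps / 2 by rewrite divr_gt0.
have [_ [m _ <-] hm] := inf_adherent e2 hS.
have [M Mr] : exists M, forall r, (r < m.+1)%N -> u r <= M.
  exists (\sum_(r < m.+1) u r) => r rm; rewrite (bigD1 (Ordinal rm)) //= lerDl.
  by apply: sumr_ge0.
near=> n.
have n0 : (0 < n)%N by near: n; exact: nbhs_infty_gt.
have nR : 0 < n%:R :> R by rewrite ltr0n.
have low : inf S <= u n / n%:R.
  apply: ge_inf; first by exists 0.
  by exists n.-1 => //; rewrite prednK.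
rewrite distrC ger0_norm ?subr_ge0 // lerBlDl.
have Mn : M <= eps / 2 * n%:R.
  rewrite mulrC -ler_pdivrMr //; near: n; exact: nbhs_infty_ger.
have upper : u n <= (n %/ m.+1)%N%:R * u m.+1 + M.
  rewrite {1}(divn_eq n m.+1); case: (n %/ m.+1)%N => [|k].
    by rewrite mul0n add0n mul0r add0r Mr // ltn_pmod.
  by rewrite (le_trans (u_add _ _)) // lerD ?Mr ?ltn_pmod // subadditive_mul.
have inf0 : 0 <= inf S by apply: lb_le_inf.
have um : u m.+1 <= (inf S + eps / 2) * m.+1%:R by rewrite -ler_pdivrMr ?ltr0n // ltW.
have qm : (n %/ m.+1)%N%:R * m.+1%:R <= n%:R :> R by rewrite -natrM ler_nat leq_divM.
have h1 : (n %/ m.+1)%N%:R * u m.+1 <= (inf S + eps / 2) * n%:R.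
  apply: (@le_trans _ _ ((n %/ m.+1)%N%:R * ((inf S + eps / 2) * m.+1%:R))).
    by apply: ler_wpM2l.
  by rewrite mulrCA; apply: ler_wpM2l => //; rewrite addr_ge0 // ltW.
rewrite ler_pdivrMr // (le_trans upper) //.
apply: (le_trans (lerD h1 Mn)); rewrite -mulrDl; apply: ler_wpM2r; first exact: ltW.
by rewrite -addrA -splitr addrC.
Unshelve. all: by end_near.
Qed.

End Fekete.

Section Entropy.
Local Open Scope ring_scope.
Local Open Scope classical_set_scope.
Variables (R : realType) (A : finType).
Implicit Types (D : set (full_shift A)).

Lemma language_gt0 D n : D !=set0 -> (0 < #|language n D|)%N.
Proof.
move=> [x Dx]; apply/card_gt0P; have sz : size (subword x 0 n) == n by rewrite size_mkseq.
exists (Tuple sz); apply/mem_language; exact: lang_subword.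
Qed.

Lemma language_submul D m n :
  (#|language (m + n) D| <= #|language m D| * #|language n D|)%N.
Proof.
have szt (t : (m + n).-tuple A) : size (take m t) == m.
  by rewrite size_takel // size_tuple leq_addr.
have szd (t : (m + n).-tuple A) : size (drop m t) == n.
  by rewrite size_drop size_tuple addKn.
pose f t : m.-tuple A * n.-tuple A := (Tuple (szt t), Tuple (szd t)).
have finj : injective f.
  move=> s t [E1 E2]; apply: val_inj.
  by rewrite /= -(cat_take_drop m s) -(cat_take_drop m t) E1 E2.
rewrite -cardsX -(card_imset _ finj); apply: subset_leq_card.
apply/fintype.subsetP => _ /imsetP[t /mem_language Lt ->]; rewrite inE /=.
have [x _ _] := Lt; pose a0 : A := x 0.
apply/andP; split; apply/mem_language => /=.
  by apply: (lang_sub a0 (u := [::]) (w := drop m t)); rewrite /= cat_take_drop.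
by apply: (lang_sub a0 (u := take m t) (w := [::])); rewrite cats0 cat_take_drop.
Qed.

Lemma entropy_gt0_lower D (k : nat) : D !=set0 -> (0 < k)%N ->
  (forall N, (2 ^ N <= #|language (N * k) D|)%N) -> 0 < entropy R D.
Proof.
move=> D0 k0 lower.
pose u n : R := ln (#|language n D|%:R).
have u0 n : 0 <= u n by rewrite ln_ge0 // ler1n language_gt0.
have uD m n : u (m + n)%N <= u m + u n.
  rewrite -lnM ?posrE ?ltr0n ?language_gt0 //.
  rewrite ler_ln ?posrE -?natrM ?ltr0n ?muln_gt0 ?language_gt0 //.
  by rewrite ler_nat language_submul.
have ln2 : 0 < ln 2 :> R by rewrite ln_gt0 // ltr1n.
apply: (@lt_le_trans _ _ (ln 2 / k%:R)); first by rewrite divr_gt0 // ltr0n.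
apply: limr_ge; first exact: subadditive_cvg.
near=> n; have n0 : (0 < n)%N by near: n; exact: nbhs_infty_gt.
rewrite ler_pdivlMr ?ltr0n // mulrAC ler_pdivrMr ?ltr0n //.
apply: (@le_trans _ _ (u (n * k)%N)).
  rewrite mulrC mulr_natl -lnXn ?ltr0n // -natrX ler_ln ?posrE ?ltr0n ?expn_gt0 ?language_gt0 //.
  by rewrite ler_nat.
rewrite mulnC mulrC; case: k k0 {lower} => // k _; exact: subadditive_mul.
Unshelve. all: by end_near.
Qed.

Lemma entropy_unbounded D : 0 < entropy R D -> unbounded_language (lang D).
Proof.
move=> ent K; apply: contrapT => no.
have bound n : (#|language n D| <= K)%N.
  rewrite leqNgt; apply/negP => Kn; apply: no; exists n.
  have [s [us ss] sL] := language_card D n.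
  by exists s => //; rewrite ss.
suff E : entropy R D = 0 by rewrite E ltxx in ent.
apply/cvg_lim => //.
have u0 n : 0 <= ln (#|language n D|%:R : R).
  have [->|c0] := posnP #|language n D|; first by rewrite ln0.
  by rewrite ln_ge0 // ler1n.
have uK n : ln (#|language n D|%:R : R) <= K%:R.
  have [->|c0] := posnP #|language n D|; first by rewrite ln0 ?ler0n.
  apply: (@le_trans _ _ (#|language n D|%:R)); last by rewrite ler_nat.
  by rewrite ltW // ln_sublinear // ltr0n.
apply/cvgrPdist_le => eps eps0; near=> n.
have n0 : (0 < n)%N by near: n; exact: nbhs_infty_gt.
rewrite sub0r normrN ger0_norm ?divr_ge0 ?ler0n // ler_pdivrMr ?ltr0n //.
apply: (le_trans (uK n)); rewrite mulrC -ler_pdivrMr //; near: n; exact: nbhs_infty_ger.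
Unshelve. all: by end_near.
Qed.

End Entropy.

(** * Periods *)

Section Orbits.
Variable A : finType.
Implicit Types (x : full_shift A) (X C : set (full_shift A)).

Lemma shift_shift j k x : shift j (shift k x) = shift (j + k)%R x.
Proof. by apply/funext => i; rewrite /shift; congr x; lia. Qed.

Lemma shift0 x : shift 0%R x = x.
Proof. by apply/funext => i; rewrite /shift; congr x; lia. Qed.

Lemma shift_mul p m x : shift (Posz p) x = x -> shift (Posz (m * p)) x = x.
Proof.
move=> px; elim: m => [|m IH]; first by rewrite mul0n shift0.
rewrite mulSn (_ : Posz (p + m * p) = (Posz p + Posz (m * p))%R); last by lia.
by rewrite -shift_shift IH.
Qed.

Lemma shift_modz p (k : int) x : 0 < p -> shift (Posz p) x = x ->
  shift k x = shift (Posz (absz (k %% Posz p)%Z)) x.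
Proof.
move=> p0 px; have r0 : (0 <= (k %% Posz p)%Z)%R by apply: modz_ge0; lia.
rewrite {1}(divz_eq k (Posz p)); case: (k %/ Posz p)%Z => q.
  have -> : (Posz q * Posz p + (k %% p)%Z = Posz (absz (k %% Posz p)%Z) + Posz (q * p))%R by lia.
  by rewrite -shift_shift shift_mul.
rewrite -[in LHS](shift_mul q.+1 px) shift_shift.
have -> // : (Negz q * Posz p + (k %% p)%Z + Posz (q.+1 * p) = Posz (absz (k %% Posz p)%Z))%R.
by rewrite NegzE; lia.
Qed.

Lemma least_period x k : 0 < k -> shift (Posz k) x = x ->
  exists p, [/\ 0 < p, p %| k, shift (Posz p) x = x & (shift_orbit x #= `I_p)%card].
Proof.
move=> k0 kx; have ex : exists p, (0 < p) && `[< shift (Posz p) x = x >].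
  by exists k; rewrite k0; apply/asboolP.
case: (ex_minnP ex) => p /andP[p0 /asboolP px] pmin; exists p; split => //.
  have := shift_modz (Posz k) p0 px; rewrite kx modz_nat absz_nat => /esym kr.
  rewrite /dvdn; apply: contraT; rewrite -lt0n => r0.
  have := pmin (k %% p); rewrite r0 /= leqNgt ltn_pmod // => H.
  by apply: H; apply/asboolP.
have -> : shift_orbit x = ((fun j : nat => shift (Posz j) x) @` `I_p)%classic.
  apply/seteqP; split=> [_ [j _ <-]|_ [j _ <-]]; last by exists (Posz j).
  exists (absz (j %% Posz p)%Z); last by rewrite -shift_modz.
  have := ltz_mod j (d := Posz p) ltac:(lia); have := modz_ge0 j (d := Posz p) ltac:(lia).
  by rewrite /=; lia.
apply: inj_card_eq => i j; rewrite !inE /=.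
wlog ij : i j / i <= j.
  by move=> W ip jp E; have [/W|/ltnW/W H] := leqP i j; [apply|symmetry; apply: H].
move=> ip jp E; apply/eqP; apply: contraT => ne.
have jip : j - i < p by lia.
have := pmin (j - i); rewrite [p <= _]leqNgt jip.
rewrite subn_gt0 ltn_neqAle ne ij /= => H; apply: H; apply/asboolP.
have := congr1 (shift (- Posz i)%R) E; rewrite !shift_shift.
have -> : (- Posz i + Posz i = 0)%R by lia.
have -> : (- Posz i + Posz j = Posz (j - i))%R by lia.
by rewrite shift0.
Qed.

Lemma orbit_size_shift x p : periodic_point x -> (shift_orbit x #= `I_p)%card ->
  0 < p /\ shift (Posz p) x = x.
Proof.
move=> [k k0 kx] op; have [q [q0 _ qx oq]] := least_period k0 kx.
suff -> : p = q by [].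
apply/card_eq_II; rewrite card_eq_sym in op.
exact: card_eq_trans op oq.
Qed.

Lemma period_dvd C x k : C x -> 0 < k -> shift (Posz k) x = x -> period C %| k.
Proof.
move=> Cx k0 kx; have [p [p0 pk px op]] := least_period k0 kx.
apply: dvdn_trans pk; have [H _] := gcd_setP (periodic_orbit_sizes C); apply: H.
by exists x; split => //; exists k.
Qed.

(** The period of [C] divides [j] and [k], hence [delta], hence every orbit size of [X]; the other
    divisibility is monotonicity. *)
Lemma period_eq X C x y j k delta : (C `<=` X)%classic -> C x -> C y ->
  0 < j -> k = j + delta -> shift (Posz j) x = x -> shift (Posz k) y = y ->
  (forall p, periodic_orbit_sizes X p -> delta %| p) -> period C = period X.
Proof.
move=> CX Cx Cy j0 kj jx ky dX.
have [HC HC'] := gcd_setP (periodic_orbit_sizes C).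
have [HX HX'] := gcd_setP (periodic_orbit_sizes X).
apply/eqP; rewrite eqn_dvd; apply/andP; split.
  apply: HX' => p /dX; apply: dvdn_trans.
  have := period_dvd Cy _ ky; rewrite kj dvdn_addr; last exact: period_dvd Cx j0 jx.
  by apply; rewrite addn_gt0 j0.
by apply: HC' => p [z [Cz pz oz]]; apply: HX; exists z; split=> //; exact: CX.
Qed.

End Orbits.

(** * Differences of loop lengths and the period *)

Section Loops.
Variables (A : finType) (a0 : A) (h : nat) (X : set (full_shift A)).
Hypothesis hL : language_axioms h (lang X).
Variable g : seq A.
Hypotheses (gh : size g = h).

Lemma loop_repeat c q : lang X g -> loop (lang X) g c -> loop (lang X) g (flatten (nseq q c)).
Proof.
move=> Lg lc; elim: q => [|q IH]; first exact: loop_nil.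
by apply: (loop_cat hL _ lc IH); rewrite gh.
Qed.

Lemma size_repeat (c : seq A) q : size (flatten (nseq q c)) = q * size c.
Proof. by elim: q => //= q IH; rewrite size_cat IH mulSn. Qed.

(** [delta] is the least positive difference between the lengths of two loops at [g]. A periodic
    orbit of size [p] can be inserted into a loop, which lengthens it by [p]; if [delta] did not
    divide [p], a difference of [p %% delta] would arise. *)
Lemma loops_difference c : loop (lang X) g c -> 0 < size c ->
  exists r0 r1 delta, [/\ loop (lang X) g r0, loop (lang X) g r1, 0 < delta,
    size r1 = size r0 + delta & forall p, periodic_orbit_sizes X p -> delta %| p].
Proof.
move=> lc c0; have hg : h <= size g by rewrite gh.
have Lg : lang X g by have [/(lang_prefix hL)] := lc.
have ex : exists delta, `[< 0 < delta /\ exists r0 r1, [/\ loop (lang X) g r0, loop (lang X) g r1 &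
    size r1 = size r0 + delta] >].
  exists (size c); apply/asboolP; split=> //; exists c, (c ++ c).
  split=> //; last by rewrite size_cat.
  exact: (loop_cat hL).
case: (ex_minnP ex) => delta /asboolP[d0 [r0 [r1 [l0 l1 s1]]]] dmin.
exists r0, r1, delta; split=> // p [x [Xx px ox]].
have [p0 xp] := orbit_size_shift px ox.
pose sg := subword x 0%R h; pose lw := subword x 0%R (p + h).
have Lsg : lang X sg by apply: lang_subword.
have Llw : lang X lw by apply: lang_subword.
have shx k : x (Posz (p + k)) = x (Posz k).
  by rewrite -[in RHS]xp /shift; congr x; lia.
have szs : size sg = h by rewrite size_subword.
have lw1 : lw = sg ++ drop h lw.
  rewrite -{1}(cat_take_drop h lw); congr (_ ++ _).
  apply: (@eq_from_nth _ a0); rewrite size_takel ?size_subword ?leq_addl ?szs // => k kh.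
  by rewrite nth_take // !nth_subword //; lia.
have lw2 : lw = take p lw ++ sg.
  rewrite -{1}(cat_take_drop p lw); congr (_ ++ _).
  apply: (@eq_from_nth _ a0); rewrite size_drop size_subword addKn ?szs // => k kh.
  by rewrite nth_drop !nth_subword ?add0r ?shx //; lia.
have [a La] := lang_irr hL Lg Lsg; have [b Lb] := lang_irr hL Lsg Lg.
have hs : h <= size sg by rewrite szs.
have A1 : loop (lang X) g (a ++ sg ++ b ++ g).
  split; last by exists (g ++ a ++ sg ++ b); rewrite -!catA.
  rewrite [g ++ _]catA; apply: (lang_glue hL hs) => //.
  by rewrite -catA.
have A2 : loop (lang X) g (a ++ lw ++ b ++ g).
  split; last by exists (g ++ a ++ lw ++ b); rewrite -!catA.
  have H1 : lang X (g ++ a ++ lw).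
    rewrite lw1 [g ++ _]catA; apply: (lang_glue hL hs); first by rewrite -catA.
    by rewrite -lw1.
  have -> : g ++ a ++ lw ++ b ++ g = (g ++ a ++ lw) ++ (b ++ g) by rewrite -!catA.
  apply: (lang_extend hL hs H1 (w := g ++ a ++ take p lw)) => //.
  by rewrite {1}lw2 -!catA.
rewrite /dvdn; apply: contraT; rewrite -lt0n => rho0.
have lt := ltn_pmod p d0.
suff : delta <= p %% delta by rewrite leqNgt lt.
apply: dmin; apply/asboolP; split=> //.
(* The detour through [lw] is longer by [p] than the one through [sg]. Adding [p %/ delta] copies of
   the longer loop to the shorter detour, and of the shorter loop to the longer detour, leaves the
   difference [p %% delta]. *)
exists ((a ++ sg ++ b ++ g) ++ flatten (nseq (p %/ delta) r1)).
exists ((a ++ lw ++ b ++ g) ++ flatten (nseq (p %/ delta) r0)).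
split; try by apply: (loop_cat hL) => //; apply: loop_repeat.
rewrite !size_cat !size_repeat s1 !size_subword.
by have := divn_eq p delta; rewrite mulnDr; lia.
Qed.

End Loops.

(** * Existence of a component *)

Section Periodic.
Variables (A : finType) (a0 : A).

Definition periodic_word (W : seq A) : full_shift A :=
  fun i : int => nth a0 W (absz (i %% Posz (size W))%Z).

Lemma nth_repeat (W : seq A) k y : y < k * size W ->
  nth a0 (flatten (nseq k W)) y = nth a0 W (y %% size W).
Proof.
elim: k y => [|k IH] y //=; rewrite mulSn => yk; rewrite nth_cat; case: ltnP => yW.
  by rewrite modn_small.
by rewrite IH; [rewrite -[in RHS](subnK yW) modnDr|lia].
Qed.

Lemma periodic_shift W : shift (Posz (size W)) (periodic_word W) = periodic_word W.
Proof. by apply/funext => i; rewrite /shift /periodic_word modzDr. Qed.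

Lemma periodic_nth W k : k < size W -> periodic_word W (Posz k) = nth a0 W k.
Proof. by move=> kW; rewrite /periodic_word modz_nat absz_nat modn_small. Qed.

Lemma block_periodic n W i : 0 < size W -> exists p,
  p + n <= n.+1 * size W /\ block n (periodic_word W) i = window a0 n p (flatten (nseq n.+1 W)).
Proof.
move=> W0; have t0 := modz_ge0 i (d := Posz (size W)) ltac:(lia).
have t1 := ltz_mod i (d := Posz (size W)) ltac:(lia).
exists (absz (i %% Posz (size W))%Z).
have nW : n <= n * size W by rewrite leq_pmulr.
have tb : absz (i %% Posz (size W))%Z < size W by lia.
split; first by rewrite mulSn; lia.
apply: block_window => k kn; rewrite nth_repeat; last by rewrite mulSn; lia.
rewrite /periodic_word; congr nth.
rewrite -modzDml -[X in _ = X]absz_nat -modz_nat; congr (absz (_ %% _)%Z).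
by rewrite PoszD; congr (_ + _)%R; lia.
Qed.

End Periodic.

(** * Petals *)

Section Blocks.
Variables (A : finType) (a0 : A) (F : seq (seq A)) (n : nat).
Let X : set (full_shift A) := forbidding F.
Hypotheses (Fn : order_bound F <= n).
Hypothesis hL : language_axioms (order_bound F) (lang X).
Variables (g : seq A) (c : bool -> seq A) (l : nat) (r : bool -> seq A).
Hypotheses (gh : size g = order_bound F) (l0 : 0 < l) (size_c : forall b, size (c b) = l).
Hypotheses (cloop : forall b, loop (lang X) g (c b)) (rloop : forall b, loop (lang X) g (r b)).
Hypothesis c_heads : nth a0 (c false) 0 <> nth a0 (c true) 0.
Variables (d E : nat).
Hypotheses (lE : l <= E) (rE : forall b, size (r b) <= E) (d0 : 0 < d).
Hypothesis n_large : 2 * (d * l + E) <= n.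

(** Of the four loops beginning with [encode c s], the two that end with [c] have equal length and
    serve the entropy, and the two that end with [r] have lengths differing by [delta] and serve the
    period. *)
Definition petal (s : seq bool) (j : bool * bool) : seq A :=
  encode c s ++ (if j.1 then c j.2 else r j.2).

Definition petals (s : seq bool) (js : seq (bool * bool)) : seq A := flatten (map (petal s) js).

Lemma petals_cat s js js' : petals s (js ++ js') = petals s js ++ petals s js'.
Proof. by rewrite /petals map_cat flatten_cat. Qed.

Lemma size_petal s j : size s = d -> d * l <= size (petal s j) <= d * l + E.
Proof.
move=> sd; rewrite size_cat (size_encode size_c) sd leq_addr /= leq_add2l.
by case: j => [[] b] /=; rewrite ?size_c.
Qed.

Lemma size_petals s js : size s = d -> size js * (d * l) <= size (petals s js).
Proof.
move=> sd; elim: js => [|j js IH] //; rewrite /petals /= size_cat mulSn.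
by rewrite leq_add // (andP (size_petal j sd)).1.
Qed.

Lemma petals_repeat s js k : petals s (flatten (nseq k js)) = flatten (nseq k (petals s js)).
Proof. by elim: k => //= k IH; rewrite petals_cat IH. Qed.

Lemma petals_lang s js : lang X (petals s js).
Proof.
have hg : order_bound F <= size g by rewrite gh.
have Lg : lang X g by have [/(lang_prefix hL)] := cloop true.
suff : loop (lang X) g (petals s js) by move=> [/(lang_suffix hL)].
elim: js => [|j js IH]; first exact: loop_nil.
apply: (loop_cat hL hg _ IH); apply: (loop_cat hL hg (loop_encode hL s hg Lg cloop)).
by case: j => [[] b]; [exact: cloop|exact: rloop].
Qed.

Definition petal_windows (s : seq bool) : {set n.-tuple A} :=
  finset (fun b =>
    `[< exists js p, p + n <= size (petals s js) /\ b = window a0 n p (petals s js) >]).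

Lemma petal_windowsP s b : reflect
  (exists js p, p + n <= size (petals s js) /\ b = window a0 n p (petals s js))
  (b \in petal_windows s).
Proof. by rewrite inE; apply: asboolP. Qed.

Lemma petal_windows_lang s b : b \in petal_windows s -> lang X b.
Proof.
by move=> /petal_windowsP[js [p [pn ->]]]; apply: (window_lang a0 hL (petals_lang s js)).
Qed.

Lemma window_catr p (U V : seq A) : window a0 n (size U + p) (U ++ V) = window a0 n p V.
Proof.
by apply/windowP => u un; rewrite nth_cat ltnNge -addnA leq_addr /= addKn.
Qed.

Lemma window_catl p (U V : seq A) : p + n <= size U -> window a0 n p (U ++ V) = window a0 n p U.
Proof. by move=> pU; apply/windowP => u un; rewrite nth_cat ifT //; lia. Qed.

Lemma petal_window_first s b : size s = d -> b \in petal_windows s ->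
  exists j js p, [/\ p < size (petal s j), p + n <= size (petals s (j :: js)) &
    b = window a0 n p (petals s (j :: js))].
Proof.
move=> sd /petal_windowsP[js [p []]]; elim: js p => [|j js IH] p pn bE.
  by move: pn; rewrite /petals /=; have := leq_mul d0 l0; lia.
have [pj|jp] := ltnP p (size (petal s j)); first by exists j, js, p.
apply: (IH (p - size (petal s j))).
  by move: pn; rewrite /petals /= size_cat; lia.
by rewrite bE -[in LHS](subnKC jp) /petals /= window_catr.
Qed.

(** A window that starts in the first petal is determined by its start and the next [rr] petals,
    with four choices each. Petals have length proportional to [n], so [rr] can be chosen
    independently of [n]. *)
Lemma card_petal_windows s rr : size s = d -> n + (d * l + E) <= rr * (d * l) ->
  #|petal_windows s| <= 4 ^ rr * n.
Proof.
move=> sd rrn.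
have sub : petal_windows s \subset
    [set window a0 n x.1 (petals s x.2) | x : 'I_n * rr.-tuple (bool * bool)].
  apply/fintype.subsetP => b /(petal_window_first sd)[j [js [p [pj pn ->]]]].
  have /andP[_ jE] := size_petal j sd.
  have pN : p < n by lia.
  (* Copies of [j] fill the list up when fewer than [rr] petals are present; they lie to the right
     of the window. *)
  have sz : size (take rr (j :: js ++ nseq rr j)) == rr.
    by rewrite size_takel //= size_cat size_nseq; lia.
  apply/imsetP; exists (Ordinal pN, Tuple sz) => //=.
  have big : p + n <= size (petals s (take rr (j :: js ++ nseq rr j))).
    by apply: leq_trans (size_petals _ sd); rewrite (eqP sz); lia.
  rewrite -(window_catl (petals s (nseq rr j)) pn) -petals_cat /=.
  by rewrite -{1}(cat_take_drop rr (j :: js ++ nseq rr j)) petals_cat window_catl.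
apply: leq_trans (subset_leq_card sub) _.
apply: leq_trans (leq_imset_card _ _) _.
by rewrite !card_prod card_tuple card_ord card_prod card_bool mulnC.
Qed.

(** Since [n] is at least twice the length of a petal, a window contains a full copy of
    [encode c s]. Its offset and the window determine [s], so a window belongs to at most [n] values
    of [s]. *)
Lemma petal_window_code s b : size s = d -> b \in petal_windows s ->
  exists q : 'I_n, forall u, u < d * l -> nth a0 b (q + u) = nth a0 (encode c s) u.
Proof.
move=> sd /(petal_window_first sd)[j [js [p [pj pn ->]]]].
have /andP[_ jE] := size_petal j sd; have se : size (encode c s) = d * l.
  by rewrite (size_encode size_c) sd.
have dl := leq_mul d0 l0.
have n0 : 0 < n by lia.
have nthb q : q < n ->
    nth a0 (window a0 n p (petals s (j :: js))) q = nth a0 (petals s (j :: js)) (p + q).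
  by move=> qn; rewrite -(tnth_nth a0 _ (Ordinal qn)) tnth_mktuple.
have [p0|p0] := posnP p.
  exists (Ordinal n0) => u ud /=; rewrite add0n nthb; last by lia.
  by rewrite p0 add0n /petals /= /petal -!catA nth_cat se ud.
have qn : size (petal s j) - p < n by lia.
exists (Ordinal qn) => u ud /=; rewrite nthb; last by lia.
have -> : p + (size (petal s j) - p + u) = size (petal s j) + u by lia.
rewrite /petals /= nth_cat ltnNge leq_addr /= addKn.
case: js pn {nthb} => [|j2 js] pn; first by move: pn; rewrite /petals /= cats0; lia.
by rewrite /= /petal -!catA nth_cat se ud.
Qed.

Lemma card_petal_owners b : #|[set s : d.-tuple bool | b \in petal_windows s]| <= n.
Proof.
have /choice[f fP] : forall s : d.-tuple bool, exists q : nat, b \in petal_windows s ->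
    q < n /\ forall u, u < d * l -> nth a0 b (q + u) = nth a0 (encode c s) u.
  move=> s; have [bs|] := boolP (b \in petal_windows s); last by exists 0.
  by have [q H] := petal_window_code (size_tuple s) bs; exists (q : nat).
have [n0|n0] := posnP n.
  by have := leq_mul d0 l0; lia.
have finj : {in [set s : d.-tuple bool | b \in petal_windows s] &,
    injective (fun s => inord (f s) : 'I_n.-1.+1)}.
  move=> s t; rewrite inE => bs; rewrite inE => bt /(congr1 val) /=.
  have [fs Hs] := fP _ bs; have [ft Ht] := fP _ bt.
  rewrite !inordK ?prednK // => fst.
  apply: val_inj; apply: (encode_inj (a0 := a0) l0 size_c) => //; first by rewrite !size_tuple.
  apply: (@eq_from_nth _ a0); rewrite !(size_encode size_c) !size_tuple // => u ud.
  by rewrite -Hs // -Ht // fst.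
rewrite -(card_in_imset finj); apply: leq_trans (max_card _) _.
by rewrite card_ord prednK.
Qed.

Section Open.
Variable delta : nat.
Hypothesis r_delta : size (r true) = size (r false) + delta.
Hypothesis X_delta : forall p, periodic_orbit_sizes X p -> delta %| p.
Variables (w : {set n.-tuple A}) (s : seq bool).
Hypotheses (wX : forall b, b \in w -> lang X (tval b)) (sd : size s = d).
Hypothesis sw : petal_windows s \subset w.

Lemma open_petals js : open_word a0 w (petals s js).
Proof. by move=> p pn; apply: (fintype.subsetP sw); apply/petal_windowsP; exists js, p. Qed.

(** Long enough to contain a window. Placing it before and after other petals links their windows to
    [e] in both directions. *)
Let base := petals s (nseq n (true, true)).
Let e := window a0 n 0 base.

Lemma size_base : n <= size base.
Proof.
apply: leq_trans (size_petals _ sd); rewrite size_nseq leq_pmulr // muln_gt0.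
by rewrite d0.
Qed.

Lemma petal_window_scc js p : p + n <= size (petals s js) ->
  window a0 n p (petals s js) \in scc a0 w e.
Proof.
move=> pn; have n0 : 0 < n by have := leq_mul d0 l0; lia.
apply/sccP; split.
  have : linked a0 w (window a0 n 0 (petals s (nseq n (true, true) ++ js)))
      (window a0 n (size base + p) (petals s (nseq n (true, true) ++ js))).
    apply: linked_between => //; first exact: open_petals.
    by rewrite petals_cat size_cat -addnA leq_add2l.
  rewrite petals_cat -/base (window_catr p) window_catl //; exact: size_base.
have : linked a0 w (window a0 n p (petals s (js ++ nseq n (true, true))))
    (window a0 n (size (petals s js) + 0) (petals s (js ++ nseq n (true, true)))).
  apply: linked_between => //; [exact: open_petals|by lia|].
  by rewrite petals_cat size_cat addn0 leq_add2l size_base.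
by rewrite petals_cat -/base (window_catr 0) window_catl.
Qed.

Lemma periodic_scc js : 0 < size js -> scc_sft a0 w e (periodic_word a0 (petals s js)).
Proof.
move=> js0 i; have W0 : 0 < size (petals s js).
  by apply: leq_trans (size_petals _ sd); rewrite !muln_gt0 js0 d0.
have [p [pn ->]] := block_periodic a0 n i W0.
rewrite -petals_repeat; apply: petal_window_scc.
by rewrite petals_repeat size_repeat.
Qed.

Lemma petal_component (R : realType) : exists f : n.-tuple A,
  [/\ (scc_sft a0 w f !=set0)%classic, (0 < entropy R (scc_sft a0 w f))%R &
      period (scc_sft a0 w f) = period X].
Proof.
have n0 : 0 < n by have := leq_mul d0 l0; lia.
have ne : (scc_sft a0 w e !=set0)%classic.
  by exists (periodic_word a0 (petals s [:: (true, true)])); exact: periodic_scc.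
exists e; split=> //.
  apply: (@entropy_gt0_lower _ _ _ (d * l + l)) => //; first by rewrite addn_gt0 l0 orbT.
  move=> N; have -> : 2 ^ N = #|{: N.-tuple bool}| by rewrite card_tuple card_bool.
  have szp (t : seq bool) : size (petals s (map (pair true) t)) = size t * (d * l + l).
    elim: t => //= b t IH; rewrite /petals /= size_cat -/(petals s _) IH mulSn.
    by rewrite /petal size_cat (size_encode size_c) sd size_c.
  have szt (t : N.-tuple bool) : size (petals s (map (pair true) t)) == N * (d * l + l).
    by rewrite szp size_tuple.
  pose f (t : N.-tuple bool) := Tuple (szt t).
  have finj : injective f.
    move=> t t' [H]; apply: val_inj => /=.
    have : size t = size t' by rewrite !size_tuple.
    elim: (tval t) (tval t') H => [|b u IH] [|b' u'] //= H [su].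
    move: H; rewrite /petals /= => /eqP; rewrite eqseq_cat; last first.
      by rewrite /petal !size_cat !size_c.
    move=> /andP[/eqP bb /eqP /IH -> //]; congr cons.
    move: bb; rewrite /petal => /eqP; rewrite eqseq_cat // eqxx /= => /eqP cc.
    by case: b b' cc => [] [] // cc; case: c_heads; rewrite cc.
  rewrite -(card_imset _ finj); apply: subset_leq_card; apply/fintype.subsetP => _ /imsetP[t _ ->].
  apply/mem_language => /=; have [N0|N0] := posnP N.
    have -> : tval t = [::] by apply: size0nil; rewrite size_tuple.
    have [x Cx] := ne; exists x => //; exists 0%R; exact: erefl.
  have js0 : 0 < size (map (pair true) t) by rewrite size_map size_tuple.
  exists (periodic_word a0 (petals s (map (pair true) t))); first exact: periodic_scc.
  by exists 0%R; apply/(subwordP a0) => k kW; rewrite add0r periodic_nth.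
have szr b : size (petals s [:: (false, b)]) = d * l + size (r b).
  by rewrite /petals /= cats0 size_cat (size_encode size_c) sd.
apply: (@period_eq _ X _ (periodic_word a0 (petals s [:: (false, false)]))
   (periodic_word a0 (petals s [:: (false, true)])) (d * l + size (r false))
   (d * l + size (r true)) delta).
- by move=> x /(scc_sft_sub Fn wX)[].
- exact: periodic_scc.
- exact: periodic_scc.
- by rewrite addn_gt0 muln_gt0 d0 l0.
- by rewrite r_delta addnA.
- by rewrite -szr periodic_shift.
- by rewrite -szr periodic_shift.
- exact: X_delta.
Qed.

End Open.

Local Open Scope ring_scope.

Lemma bernoulli_inv (R : realType) (x : R) M : 0 <= x <= 1 -> (1 - x) ^+ M * (1 + M%:R * x) <= 1.
Proof.
move=> /andP[x0 x1]; elim: M => [|M IH]; first by rewrite expr0 mul0r addr0 mulr1.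
apply: le_trans IH; rewrite exprSr -mulrA; apply: ler_wpM2l.
  by rewrite exprn_ge0 // subr_ge0.
rewrite -natr1; have : 0 <= M.+1%:R * (x * x) by rewrite !mulr_ge0.
by rewrite -natr1; lra.
Qed.

(** Among the [2 ^ d] sets of windows, at least [2 ^ d / (4 ^ rr * n * n)] are pairwise disjoint,
    and each is open with probability at least [x = alpha ^+ (4 ^ rr * n)]. By [bernoulli_inv] all
    [M] of them fail with probability at most [1 / (M * x)], which is stated here without
    division. *)
Lemma petal_pr (R : realType) (alpha : R) (Ln : {set n.-tuple A}) rr :
  0 <= alpha -> alpha <= 1 -> (n + (d * l + E) <= rr * (d * l))%N ->
  (forall b : n.-tuple A, lang X b -> b \in Ln) ->
  pr alpha Ln (fun w => [forall s : d.-tuple bool, ~~ (petal_windows s \subset w)]) *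
    (2 ^+ d * alpha ^+ (4 ^ rr * n)) <= (4 ^ rr * n * n)%:R.
Proof.
move=> a0' a1 rrn LLn.
have [Fam FN dis] := @disjoint_subfamily _ _ (fun s : d.-tuple bool => petal_windows s) (4 ^ rr * n)
  n (fun s => card_petal_windows (size_tuple s) rrn) card_petal_owners ltac:(
    move=> s; apply/finset.set0Pn; exists (window a0 n 0 (petals s (nseq n (true, true))));
    apply/petal_windowsP; exists (nseq n (true, true)), 0%N; split=> //;
    exact: size_base (size_tuple s)).
set p := pr _ _ _.
have p0 : 0 <= p by apply: pr_ge0.
have al : 0 <= alpha ^+ (4 ^ rr * n) <= 1 by rewrite exprn_ge0 // exprn_ile1.
have : p <= (1 - alpha ^+ (4 ^ rr * n)) ^+ #|Fam|.
  apply: (@le_trans _ _ (pr alpha Ln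
    (fun w => [forall s, (s \in Fam) ==> ~~ (petal_windows s \subset w)]))).
    apply: pr_sub => // w _ /forallP H; apply/forallP => s; apply/implyP => _; exact: H.
  apply: (@all_closed_pr _ _ _ a0' a1 _ (mem Fam) _ (fun s => petal_windows s)) => //.
  - by rewrite subr_ge0 gerBl; case/andP: al => -> ->.
  - move=> s _; split; first by apply/fintype.subsetP => b /petal_windows_lang /LLn.
    by move=> w /=; rewrite (depends_subset (petal_windows s)).
  - move=> s _; rewrite prC pr_subset; last by apply/fintype.subsetP => b /petal_windows_lang /LLn.
    rewrite lerD2l lerN2; apply: ler_wiXn2l => //; exact: card_petal_windows (size_tuple s) rrn.
move=> pF; have := bernoulli_inv #|Fam| al; set x := alpha ^+ _ in al pF *.
case/andP: al => x0 x1 => bern.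
have pb : p * (1 + #|Fam|%:R * x) <= 1.
  by apply: le_trans bern; apply: ler_wpM2r => //; rewrite addr_ge0 // mulr_ge0.
have pFx : p * (#|Fam|%:R * x) <= 1 by move: pb; rewrite mulrDr mulr1; lra.
have D2 : 2 ^+ d <= #|Fam|%:R * (4 ^ rr * n * n)%:R :> R.
  by rewrite -natrX -natrM ler_nat; move: FN; rewrite card_tuple card_bool -!mulnA.
apply: (@le_trans _ _ (p * (#|Fam|%:R * (4 ^ rr * n * n)%:R * x))).
  by apply: ler_wpM2l => //; apply: ler_wpM2r.
have -> : p * (#|Fam|%:R * (4 ^ rr * n * n)%:R * x) =
          p * (#|Fam|%:R * x) * (4 ^ rr * n * n)%:R by ring.
by rewrite -[leRHS]mul1r; apply: ler_wpM2r.
Qed.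

End Blocks.

(** * The event and its probability *)

Section Event.
Variables (R : realType) (A : finType) (a0 : A) (F : seq (seq A)) (n : nat).
Let X : set (full_shift A) := forbidding F.
Hypotheses (Fn : order_bound F <= n) (n_gt0 : 0 < n).
Variables (Q : nat).
Hypotheses (Q0 : 0 < Q) (Qn : 4 * Q <= n).

Definition aperiodic_pair (Z Y : seq A) : Prop :=
  [/\ lang X Z, lang X (rev Y), aperiodic a0 Z (n - 4 * Q) n Q & aperiodic a0 Y (n - 4 * Q) n Q].

Definition pairs_linked (w : {set n.-tuple A}) : Prop :=
  forall Z Y : (2 * n).-tuple A, aperiodic_pair Z Y ->
    open_word a0 w Z -> open_word a0 w (rev Y) ->
    linked a0 w (window a0 n 0 Z) (window a0 n n (rev Y)).

Lemma component_event (w : {set n.-tuple A}) (e : n.-tuple A) : w \in Omega X n ->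
  pairs_linked w -> (scc_sft a0 w e !=set0)%classic ->
  (0 < entropy R (scc_sft a0 w e))%R -> period (scc_sft a0 w e) = period X ->
  unique_component_event R X n w.
Proof.
move=> wO good C0 Cent Cper.
have wX b : b \in w -> lang X (tval b).
  by move=> bw; apply/mem_language; move: wO; rewrite inE => /fintype.subsetP/(_ b bw).
have Ccomp := scc_component n_gt0 Fn wX C0.
split=> //; exists (scc_sft a0 w e); split=> // D Dcomp Dent.
have [_ DX iD _] := Dcomp; have [_ CX iC _] := Ccomp.
have word_of (D' : set (full_shift A)) : irreducible_sft D' -> (0 < entropy R D')%R ->
    exists2 x, D' x &
    forall q, 0 < q <= Q -> exists2 k, q <= k < 4 * Q & x (Posz k) <> x (Posz (k - q)).
  move=> iD' ent.
  have [z Dz az] := aperiodic_word a0 Q0 (irreducible_shift iD') (entropy_unbounded ent).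
  by exists z.
have [x Dx apx] := word_of _ iD Dent; have [y Cy apy] := word_of _ iC Cent.
have link (x' y' : full_shift A) : random_sft X w x' -> random_sft X w y' ->
    (forall q, 0 < q <= Q -> exists2 k, q <= k < 4 * Q & x' (Posz k) <> x' (Posz (k - q))) ->
    (forall q, 0 < q <= Q -> exists2 k, q <= k < 4 * Q & y' (Posz k) <> y' (Posz (k - q))) ->
    linked a0 w (block n x' (Posz (4 * Q) - Posz n)%R) (block n y' 0%R).
  move=> Xx Xy ax ay.
  (* The aperiodic stretch of [x'], at coordinates 0 to [4 * Q], occupies the last [4 * Q] of the
     first [n] letters of [Z]. Read backwards, that of [y'] has the same position in [Y]: coordinate
     [k] becomes [n - 1 - k]. *)
  pose Z := subword x' (Posz (4 * Q) - Posz n)%R (2 * n).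
  pose Y := rev (subword y' (- Posz n)%R (2 * n)).
  have sZ : size Z == 2 * n by rewrite size_subword.
  have sY : size Y == 2 * n by rewrite size_rev size_subword.
  have oZ : open_word a0 w Z by move=> p; apply: (open_subword a0 n_gt0 Fn wX Xx).
  have oY : open_word a0 w (rev Y) by rewrite revK => p; apply: (open_subword a0 n_gt0 Fn wX Xy).
  have <- : window a0 n 0 Z = block n x' (Posz (4 * Q) - Posz n)%R.
    by rewrite window_subword //; [congr (block _ _ _); lia|lia].
  have <- : window a0 n n (rev Y) = block n y' 0%R.
    by rewrite revK window_subword //; [congr (block _ _ _); lia|lia].
  apply: (good (Tuple sZ) (Tuple sY) _ oZ oY); split.
  - by apply: lang_subword; case: Xx.
  - by rewrite revK; apply: lang_subword; case: Xy.
  - move=> q /ax[k kq ne]; exists (n - 4 * Q + k); first by lia.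
    rewrite !nth_subword; [|lia|lia] => E; apply: ne.
    have -> : Posz k = (Posz (4 * Q) - Posz n + Posz (n - 4 * Q + k))%R by lia.
    by rewrite E; congr x'; lia.
  - move=> q /ay[k kq ne]; exists (n - 1 - k + q); first by lia.
    rewrite !nth_rev ?size_subword; [|lia|lia].
    rewrite !nth_subword; [|lia|lia] => E; apply: ne.
    have -> : Posz k = (- Posz n + Posz (2 * n - (n - 1 - k + q - q).+1))%R by lia.
    by rewrite -E; congr y'; lia.
have xy := link _ _ (DX _ Dx) (CX _ Cy) apx apy.
have yx := link _ _ (CX _ Cy) (DX _ Dx) apy apx.
apply: (component_scc n_gt0 Fn wX (x := x) (i := 0%R)) => //; apply/sccP; split.
  apply: (linked_trans n_gt0) yx; have := Cy (Posz (4 * Q) - Posz n)%R.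
  by move/sccP => [].
apply: (linked_trans n_gt0)
  (irreducible_linked a0 n_gt0 Fn wX 0%R (Posz (4 * Q) - Posz n)%R iD DX Dx Dx) _.
apply: (linked_trans n_gt0) xy _; have := Cy 0%R.
by move/sccP => [].
Qed.

End Event.

Local Open Scope ring_scope.

Lemma probE (R : realType) (A : finType) (X : set (full_shift A)) n (alpha : R)
    (E : set {set n.-tuple A}) :
  prob X alpha E = pr alpha (language n X) (fun w => `[< E w >]).
Proof. by []. Qed.

(** With [d = n %/ B], the bound [B * d <= n] makes room for networks and petals, while
    [n < B * d.+1] bounds the number [rr] of petals met by a window by a constant. *)
Lemma scale_bounds (C lc E B rr d n : nat) : (0 < C)%N -> (0 < lc)%N -> (0 < d)%N ->
  B = (80 * C + 2 * lc + 2 * E + 1)%N -> rr = (2 * B + E + 1)%N ->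
  (B * d <= n)%N -> (n < B * d.+1)%N ->
  [/\ (0 < 8 * C * d)%N, (4 * (8 * C * d) <= n)%N, (80 * C * d <= n)%N,
      (n + (d * lc + E) <= rr * (d * lc))%N & (2 * (d * lc + E) <= n)%N].
Proof.
move=> C0 lc0 d0 BE rrE Bdn nBd.
have Edd : (E <= E * d)%N by rewrite leq_pmulr.
have Bd : (B * d = 80 * C * d + 2 * (lc * d) + 2 * (E * d) + d)%N by rewrite BE; ring.
split; try by [rewrite !muln_gt0 d0 C0|lia].
have dlc : (d <= d * lc)%N by rewrite leq_pmulr.
have h1 : (B * d.+1 <= 2 * B * (d * lc))%N.
  apply: (@leq_trans (2 * B * d)); last by rewrite leq_mul2l dlc orbT.
  by rewrite mulnS; have := leq_mul (leqnn B) d0; rewrite muln1; lia.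
have h2 : (E <= E * (d * lc))%N by rewrite leq_pmulr // muln_gt0 d0.
by rewrite rrE !mulnDl mul1n; lia.
Qed.

(** Here [K = 4 * C * d], [Q = 2 * K] and [lo = n - 4 * Q], where [4 * Q] is the length of an
    aperiodic stretch. The condition [n + 3 * K <= 2 * lo] amounts to [76 * C * d <= n], which [80]
    covers. *)
Lemma net_scale_bounds (C d n : nat) : (80 * C * d <= n)%N ->
  [/\ (n - 4 * (8 * C * d) = n - 32 * C * d)%N, (4 * C * d <= n - 32 * C * d)%N,
      (2 * (4 * C * d) <= 8 * C * d)%N, (n + 3 * (4 * C * d) <= 2 * (n - 32 * C * d))%N &
      (n - 32 * C * d <= n)%N].
Proof. by rewrite -!mulnA => H; split; lia. Qed.

(** [C], [B] and [q] depend on [X] only and are fixed before [alpha], so that the distance of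
    [alpha] from 1 can be chosen from them. The first term is the union bound over the pairs
    [(Z, Y)], and [p] is the probability that no family of petals is open. *)
Theorem failure_bound (R : realType) (A : finType) (X : set (full_shift A)) :
  irreducible_sft X -> 0 < entropy R X ->
  exists h C B q : nat, [/\ (0 < B)%N, (0 < #|A|)%N &
  forall (n d : nat) (alpha beta Y0 eta : R),
    0 <= alpha -> alpha <= 1 -> (h <= n)%N -> (0 < d)%N -> (B * d <= n)%N -> (n < B * d.+1)%N ->
    (4 * n * d < 2 ^ d)%N -> 0 <= beta -> beta <= 1 / 3 ->
    1 <= alpha ^+ (2 * C) * (1 + beta) -> 1 <= alpha ^+ (2 * n) * Y0 ->
    3 * beta + (2 / 3) ^+ d * Y0 <= eta -> 0 <= eta -> eta <= 1 ->
    exists2 p, p * (2 ^+ d * alpha ^+ (q * n)) <= (q * n * n)%:R &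
      1 - prob X alpha (unique_component_event R X n) <= #|A|%:R ^+ (4 * n) * eta ^+ d.-1 + p].
Proof.
move=> iX ent; have unb := entropy_unbounded ent.
have [x0 Xx0] : exists x, X x.
  have [N [s [_ s0] sL]] := unb 0%N; case: s s0 sL => // u s _ /(_ u (mem_head _ _))[_ [x Xx _]].
  by exists x.
pose a0 : A := x0 0; have [h [[F XF hF] hL]] := irreducible_language a0 iX.
have [C [l [c [l' [c' [[/andP[l0 lC] /andP[l0' lC']] net]]]]]] := net_exists a0 hL unb.
have [g [cc [lc [gh lc0 scc_ ccloop ccd]]]] := code_exists a0 hL unb.
have cc0 : (0 < size (cc true))%N by rewrite scc_.
have [r0 [r1 [delta [lr0 lr1 d0 sr Xd]]]] := loops_difference a0 hL gh (ccloop true) cc0.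
pose r (b : bool) := if b then r1 else r0.
have [E EE] : exists E, E = (lc + size r0 + size r1)%N by eexists.
have [B BE] : exists B, B = (80 * C + 2 * lc + 2 * E + 1)%N by eexists.
have [rr rrE] : exists rr, rr = (2 * B + E + 1)%N by eexists.
exists h, C, B, (4 ^ rr)%N; split; first by rewrite BE addn1.
  by apply/card_gt0P; exists a0.
move=> n d alpha beta Y0 eta al0 al1 hn dd Bdn nBd n2 b0 b3 aw aN et e0 e1.
have C0 : (0 < C)%N by apply: leq_trans lC.
have [Cd0 Qn Cn rrn pl] := scale_bounds C0 lc0 dd BE rrE Bdn nBd.
have n0 : (0 < n)%N by apply: leq_trans Qn; rewrite muln_gt0.
have hF' : (order_bound F <= n)%N by rewrite -hF.
have Ln (b : n.-tuple A) : lang X b -> b \in language n X by move=> /mem_language.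
have cch : nth a0 (cc false) 0 <> nth a0 (cc true) 0 by apply/eqP.
have hLF := hL; rewrite XF hF in hLF.
have rloop b : loop (lang X) g (r b) by case: b.
have sr' : size (r true) = (size (r false) + delta)%N by [].
have rE b : (size (r b) <= E)%N.
  by case: b; rewrite EE ?leq_addl // addnAC leq_addl.
have lcE : (lc <= E)%N by rewrite EE -addnA leq_addr.
have gh' : size g = order_bound F by rewrite gh.
rewrite XF in ccloop rloop Xd Ln net *.
have pb := petal_pr hF' hLF gh' lc0 scc_ ccloop rloop cch lcE rE dd pl al0 al1 rrn Ln.
eexists; first exact: pb.
rewrite probE -prC; set Q := (8 * C * d)%N in Cd0 Qn.
pose G (zy : (2 * n).-tuple A * (2 * n).-tuple A) : pred {set n.-tuple A} := fun w =>
  `[< [/\ open_word a0 w zy.1, open_word a0 w (rev zy.2) &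
      ~ linked a0 w (window a0 n 0 zy.1) (window a0 n n (rev zy.2))] >].
pose D (zy : (2 * n).-tuple A * (2 * n).-tuple A) := `[< aperiodic_pair a0 F n Q zy.1 zy.2 >].
apply: (@le_trans _ _ (pr alpha (language n (forbidding F)) (fun w =>
   [exists zy, D zy && G zy w] ||
   [forall s : d.-tuple bool, ~~ (petal_windows a0 n cc r s \subset w)]))).
  apply: pr_sub => // w wL; apply: contraR; rewrite negb_or negb_exists negb_forall.
  move=> /andP[/forallP nG /existsP[s]]; rewrite negbK => sw; apply/asboolP.
  have wO : w \in Omega (forbidding F) n by rewrite powersetE.
  have wX b : b \in w -> lang (forbidding F) (tval b).
    by move=> bw; apply/mem_language; apply: (fintype.subsetP wL).
  have [e [Cn0 Ce Cp]] := petal_component hF' gh' lc0 scc_ cch lcE rE dd pl sr' Xd wX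
    (size_tuple s) sw R.
  apply: (component_event hF' n0 Cd0 Qn wO _ Cn0 Ce Cp) => Z Y ZY oZ oY.
  apply: contrapT => nl; have := nG (Z, Y); rewrite negb_and.
  move=> /orP[/asboolP|/asboolP]; first by [].
  by apply.
apply: (le_trans (pr_unionU al0 al1 _ _ _)); rewrite lerD2r.
apply: (le_trans (pr_union al0 al1 _ _ _)).
apply: (@le_trans _ _ (\sum_(zy | D zy) eta ^+ d.-1)); last first.
  rewrite sumr_const -[leLHS]mulr_natl; apply: ler_wpM2r; first exact: exprn_ge0.
  rewrite -natrX ler_nat; apply: leq_trans (max_card _) _.
  by rewrite card_prod !card_tuple -expnD; rewrite -mulnDl leqnn.
apply: ler_sum => -[Z Y] /asboolP[/= LZ LY aZ aY].
have hn' : (h <= n)%N by [].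
have [lo32 K1 K2 K3 lon] := net_scale_bounds Cn.
rewrite lo32 in aZ aY.
have [mu [e [e' [rho [rho' [S1 S2 rC mk NL]]]]]] :=
  net d n Z Y dd hn' Cn n2 (size_tuple Z) (size_tuple Y) LZ LY aZ aY.
have hLF' := hLF; rewrite -hF in hLF'.
exact: (net_pr hLF' lon K1 K2 K3 (size_tuple Z) (size_tuple Y) lC lC' S1 S2 rC mk NL
  al0 al1 b0 b3 aw aN et e0 e1 Ln).
Qed.

Local Open Scope classical_set_scope.
Local Open Scope ring_scope.

Lemma common_bound (a b c : nat) :
  exists D, [/\ (0 < D)%N, (a <= D)%N, (b <= D)%N & (c <= D)%N].
Proof. by exists (a + b + c).+1; split; lia. Qed.

Section Asymptotics.
Variable R : realType.

Lemma bernoulli (x : R) n : 0 <= x -> 1 + n%:R * x <= (1 + x) ^+ n.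
Proof.
move=> x0; elim: n => [|n IH]; first by rewrite mul0r addr0 expr0.
rewrite exprSr; apply: (@le_trans _ _ ((1 + n%:R * x) * (1 + x))); last first.
  by apply: ler_wpM2r => //; rewrite addr_ge0.
have : 0 <= n%:R * (x * x) by rewrite !mulr_ge0.
by rewrite -natr1; lra.
Qed.

Lemma bernoulli_le (x : R) n : 0 <= x <= 1 -> 1 - n%:R * (1 - x) <= x ^+ n.
Proof.
move=> /andP[x0 x1]; elim: n => [|n IH]; first by rewrite mul0r subr0 expr0.
rewrite exprS; have : x * (1 - n%:R * (1 - x)) <= x * x ^+ n by apply: ler_wpM2l.
have : 0 <= n%:R * ((1 - x) * (1 - x)) by rewrite !mulr_ge0 // subr_ge0.
by rewrite -natr1; lra.
Qed.

Lemma union_weight (a : R) k : 1 <= a ->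
  a ^+ k.+2 * (2 * a)^-1 ^+ k <= 2 * a ^+ 2 * (2 / 3) ^+ k.+1.
Proof.
move=> a1; have a0 : 0 < a by rewrite (lt_le_trans ltr01).
have -> : a ^+ k.+2 * (2 * a)^-1 ^+ k = a ^+ 2 * 2^-1 ^+ k.
  rewrite invfM exprMn mulrCA [in RHS]mulrC; congr (_ * _).
  by rewrite -add2n exprD -mulrA -exprMn divff ?gt_eqF // expr1n mulr1.
have -> : 2 * a ^+ 2 * (2 / 3) ^+ k.+1 = a ^+ 2 * (4 / 3 * (2 / 3) ^+ k).
  by rewrite (exprS (2 / 3)); field.
apply: ler_wpM2l; first by rewrite exprn_ge0 // ltW.
have h : 2^-1 ^+ k <= (2 / 3) ^+ k :> R by apply: lerXn2r; rewrite ?nnegrE; lra.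
have p : 0 <= (2 / 3) ^+ k :> R by apply: exprn_ge0; lra.
by lra.
Qed.

(** Bernoulli's inequality for the fourth root of [r] bounds [r ^+ d] below by a multiple of
    [d.+1%:R ^+ 4], and the two spare powers absorb [K]. *)
Lemma square_le_exponential (r K : R) : 1 < r ->
  exists D, forall d, (D <= d)%N -> K * d.+1%:R ^+ 2 <= r ^+ d.
Proof.
move=> r1; pose s := Num.sqrt (Num.sqrt r).
have r0 : 0 <= r by rewrite ltW // (lt_trans ltr01).
have s4 : s ^+ 4 = r by rewrite (exprM s 2 2) !sqr_sqrtr // sqrtr_ge0.
have s0 : 0 <= s by apply: sqrtr_ge0.
have s1 : 1 < s.
  by rewrite ltNge; apply: contraL r1 => s1; rewrite -leNgt -s4 exprn_ile1.
pose x := Num.min 1 (s - 1).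
have x0 : 0 < x by rewrite lt_min ltr01 subr_gt0.
have sx d : x * d.+1%:R <= s ^+ d.
  apply: (@le_trans _ _ (1 + d%:R * (s - 1))); last first.
    by rewrite -{2}(subrKC 1 s); apply: bernoulli; rewrite subr_ge0 ltW.
  rewrite -nat1r mulrDr mulr1 lerD //; first by rewrite ge_min lexx.
  by rewrite mulrC; apply: ler_wpM2l => //; rewrite ge_min lexx orbT.
exists (Num.trunc (`|K| / x ^+ 4)).+1 => d Dd.
have Kd : `|K| <= x ^+ 4 * d.+1%:R ^+ 2.
  rewrite mulrC -ler_pdivrMr ?exprn_gt0 //.
  apply: (@le_trans _ _ d.+1%:R).
    apply: ltW; apply: lt_le_trans (truncnS_gt _) _; rewrite ler_nat.
    exact: leq_trans Dd (leqnSn _).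
  by rewrite expr2 -[leLHS]mulr1; apply: ler_wpM2l => //; rewrite ler1n.
rewrite -s4 -exprM mulnC exprM; apply: (@le_trans _ _ ((x * d.+1%:R) ^+ 4)); last first.
  by apply: lerXn2r; rewrite ?nnegrE ?mulr_ge0 ?exprn_ge0 // ltW.
have -> : (x * d.+1%:R) ^+ 4 = x ^+ 4 * d.+1%:R ^+ 2 * d.+1%:R ^+ 2 by ring.
by apply: ler_wpM2r; [exact: exprn_ge0|apply: le_trans (ler_norm _) Kd].
Qed.

Lemma edge_loss (beta x : R) : 0 <= beta <= 1 -> 1 - beta / 2 <= x -> 1 <= x * (1 + beta).
Proof.
move=> /andP[b0 b1] bx; apply: (@le_trans _ _ ((1 - beta / 2) * (1 + beta))).
  have bb : 0 <= beta * (1 - beta) by rewrite mulr_ge0 // subr_ge0.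
  by lra.
by apply: ler_wpM2r => //; rewrite addr_ge0.
Qed.

Lemma leaf_loss (x : R) d : (9 / 10) ^+ d <= x -> 1 <= x * (10 / 9) ^+ d.
Proof.
move=> dx; apply: (@le_trans _ _ ((9 / 10) ^+ d * (10 / 9) ^+ d)).
  by rewrite -exprMn (_ : 9 / 10 * (10 / 9) = 1 :> R) ?expr1n //; lra.
by apply: ler_wpM2r => //; apply: exprn_ge0; lra.
Qed.

Lemma depth_loss (eta : R) d : 0 < eta ->
  10 / 9 * (2 / eta) * d.+1%:R ^+ 2 <= (27 / 20) ^+ d ->
  (2 / 3) ^+ d * (10 / 9) ^+ d.+1 <= eta / 2.
Proof.
move=> e0 H; have p0 : 0 <= 10 / 9 * (2 / eta).
  by rewrite mulr_ge0 ?divr_ge0 // ltW.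
have -> : (2 / 3) ^+ d * (10 / 9) ^+ d.+1 = 10 / 9 * (20 / 27) ^+ d :> R.
  by rewrite exprS mulrCA -exprMn; congr (_ * _ ^+ _); lra.
have -> : 10 / 9 * (20 / 27) ^+ d = 10 / 9 * (2 / eta) * (20 / 27) ^+ d * (eta / 2) :> R.
  by field; rewrite gt_eqF.
rewrite -[leRHS]mul1r; apply: ler_wpM2r; first by rewrite divr_ge0 // ltW.
apply: (@le_trans _ _ ((27 / 20) ^+ d * (20 / 27) ^+ d)).
  apply: ler_wpM2r; first by apply: exprn_ge0; lra.
  apply: le_trans H; rewrite -[leLHS]mulr1; apply: ler_wpM2l => //.
  by rewrite exprn_ege1 // ler1n.
by rewrite -exprMn (_ : 27 / 20 * (20 / 27) = 1 :> R) ?expr1n //; lra.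
Qed.

Lemma existence_weight (p x : R) (q B n d : nat) : (n <= B * d.+1)%N ->
  p * (2 ^+ d * x) <= (q * n * n)%:R -> (9 / 10) ^+ d.+1 <= x ->
  q%:R * B%:R ^+ 2 * (10 / 9) * d.+1%:R ^+ 2 <= (6 / 5) ^+ d :> R -> p <= (2 / 3) ^+ d.
Proof.
move=> nBd pq dx H; have [p0|p0] := leP p 0.
  by apply: (le_trans p0); apply: exprn_ge0; lra.
have nR : n%:R <= B%:R * d.+1%:R :> R by rewrite -natrM ler_nat.
have b1 : p * (2 ^+ d * (9 / 10) ^+ d.+1) <= 9 / 10 * (6 / 5) ^+ d.
  apply: (@le_trans _ _ (p * (2 ^+ d * x))).
    by apply: ler_wpM2l; [exact: ltW|apply: ler_wpM2l => //; exact: exprn_ge0].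
  apply: (le_trans pq); apply: (@le_trans _ _ (q%:R * B%:R ^+ 2 * d.+1%:R ^+ 2)); last by lra.
  rewrite -mulnA natrM -mulrA; apply: ler_wpM2l => //.
  by rewrite natrM -exprMn expr2; apply: ler_pM.
have z0 : 0 < (9 / 5 : R) ^+ d by apply: exprn_gt0; lra.
rewrite -(ler_pM2r z0) -exprMn (_ : 2 / 3 * (9 / 5) = 6 / 5 :> R); last by lra.
have E : 2 ^+ d * (9 / 10) ^+ d.+1 = 9 / 10 * (9 / 5) ^+ d :> R.
  by rewrite exprS mulrCA -exprMn; congr (_ * _ ^+ _); lra.
by move: b1; rewrite E; lra.
Qed.

Lemma exponential_rate (B n d : nat) : (0 < B)%N -> (n < B * d.+1)%N ->
  (2 / 3 : R) ^+ d <= 3 / 2 * expR (- (ln (3 / 2) / B%:R * n%:R)).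
Proof.
move=> B0 nB; have t0 : 0 < 3 / 2 :> R by lra.
have lt : 0 < ln (3 / 2 : R) by rewrite ln_gt0 //; lra.
have -> : (2 / 3 : R) ^+ d = 3 / 2 * (2 / 3) ^+ d.+1.
  by rewrite exprS mulrA (_ : 3 / 2 * (2 / 3) = 1 :> R) ?mul1r //; lra.
apply: ler_wpM2l; first exact: ltW.
have -> : (2 / 3 : R) ^+ d.+1 = expR (- (ln (3 / 2) * d.+1%:R)).
  rewrite expRN expRM_natr lnK ?posrE // -exprVn; congr (_ ^+ _).
  by rewrite invf_div.
rewrite ler_expR lerN2 mulrAC -mulrA; apply: ler_wpM2l; first exact: ltW.
by rewrite ler_pdivrMr ?ltr0n // -natrM ler_nat mulnC ltnW.
Qed.

Lemma exponential_cvg (u : nat -> R) (K rho : R) : 0 < K -> 0 < rho ->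
  (forall n, u n <= 1) -> (\forall n \near \oo, 1 - u n <= K * expR (- (rho * n%:R))) ->
  u @ \oo --> (1 : R).
Proof.
move=> K0 rho0 u1 uK.
have g0 : (fun n => K * expR (- rho) ^+ n) @ \oo --> (0 : R).
  apply: (@cvg_geometric R K (expR (- rho))).
  by rewrite ger0_norm ?expR_ge0 // expR_lt1 oppr_lt0.
have g1 : (fun n => 1 - K * expR (- rho) ^+ n) @ \oo --> (1 : R).
  by rewrite -[X in _ --> X]subr0; apply: cvgB => //; exact: cvg_cst.
have g2 : (fun=> 1 : R) @ \oo --> (1 : R) by exact: cvg_cst.
apply: squeeze_cvgr g1 g2; near=> n; rewrite u1 andbT.
have un : 1 - u n <= K * expR (- (rho * n%:R)) by near: n.
have E : expR (- rho) ^+ n = expR (- (rho * n%:R)) by rewrite -expRM_natr mulNr.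
by rewrite E; lra.
Unshelve. all: by end_near.
Qed.

End Asymptotics.

Unset Implicit Arguments.

Theorem theorem1p4 (R : realType) (A : finType) (X : set (full_shift A))
    (lambda : R) (hX : irreducible_sft X) (hlambda : 0 < lambda)
    (hentropy : entropy R X = ln lambda) (hpos : 0 < entropy R X) :
  exists c : R, 0 < c /\
    forall alpha : R, 0 <= alpha -> 1 - c < alpha -> alpha <= 1 ->
      ((fun n : nat => prob X alpha (unique_component_event R X n))
         @ \oo --> (1 : R)) /\
      exists K rho : R, 0 < K /\ 0 < rho /\
        \forall n \near \oo,
          1 - prob X alpha (unique_component_event R X n)
            <= K * expR (- (rho * n%:R)).
Proof.
have [h [C [B [q [B0 A0 bound]]]]] := failure_bound hX hpos.
have a1 : 1 <= #|A|%:R :> R by rewrite ler1n.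
pose a := (#|A|%:R : R) ^+ (4 * B).
have a1' : 1 <= a by rewrite exprn_ege1.
have a0 : 0 < a by rewrite (lt_le_trans ltr01).
(* There are at most [#|A| ^ (4 * n) <= a ^+ d.+1] pairs [(Z, Y)], so this [eta] leaves a factor
   [2^-1 ^+ d.-1] in the union bound. *)
pose eta := (2 * a)^-1.
have eta0 : 0 < eta by rewrite invr_gt0 mulr_gt0.
have eta1 : eta <= 1 / 2.
  by rewrite /eta invfM -[leRHS]mulrC ler_wpM2l ?invf_le1 //; lra.
(* Half of [eta] pays for [3 * beta], the other half for the leaves. [M] dominates the exponents of
   [alpha] that must stay close to 1: [2 * C] per inner node, and per unit of depth [2 * B] for a
   leaf and [q * B] for a family of petals. *)
pose beta := eta / 6.
pose M := (2 * C + 2 * B + q * B)%N.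
have [MC MB Mq] : [/\ (2 * C <= M)%N, (2 * B <= M)%N & (q * B <= M)%N].
  by split; rewrite /M ?leq_addl // -addnA ?leq_addr // addnCA leq_addr.
pose c := beta / (2 * M.+1%:R).
have c0 : 0 < c by rewrite !divr_gt0 // mulr_gt0.
exists c; split => // alpha al0 alc al1.
have beta0 : 0 < beta by rewrite divr_gt0.
have pow m : (m <= M)%N -> 1 - beta / 2 <= alpha ^+ m.
  move=> mM; apply: le_trans (bernoulli_le m _); last by rewrite al0.
  rewrite lerD2l lerN2; apply: (@le_trans _ _ (M.+1%:R * c)).
    apply: ler_pM => //; [by rewrite subr_ge0|by rewrite ler_nat ltnW|by lra].
  have -> // : M.+1%:R * c = beta / 2 by rewrite /c; field; rewrite nat1r pnatr_eq0.
have beta1 : beta <= 1 / 12 by rewrite /beta; lra.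
have eta_le1 : eta <= 1 by lra.
have beta3 : beta <= 1 / 3 by lra.
have beta01 : 0 <= beta <= 1 by rewrite ltW //=; lra.
have eq_beta : 3 * beta <= eta / 2 by rewrite /beta; lra.
(* The rate 9/10 fits both uses. A leaf costs [(10 / 9) ^+ d.+1], which [(2 / 3) ^+ d] beats as
   20/27 < 1. For petals, [2 * (9 / 10) * (2 / 3) = 6 / 5] exceeds 1 and leaves room for the
   polynomial factors. *)
have p9 m n d : (m * B <= M)%N -> (n < B * d.+1)%N -> (9 / 10) ^+ d.+1 <= alpha ^+ (m * n).
  move=> mM nB; apply: (@le_trans _ _ (alpha ^+ (m * B * d.+1))).
    rewrite exprM; apply: lerXn2r; [by rewrite nnegrE; lra|by rewrite nnegrE exprn_ge0|].
    by apply: le_trans (pow _ mM); lra.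
  by apply: ler_wiXn2l => //; rewrite -mulnA leq_mul2l (ltnW nB) orbT.
have [D1 HD1] := @square_le_exponential R 2 (4 * B%:R + 1) ltac:(lra).
have [D2 HD2] := @square_le_exponential R (27 / 20) (10 / 9 * (2 / eta)) ltac:(lra).
have [D3 HD3] := @square_le_exponential R (6 / 5) (q%:R * B%:R ^+ 2 * (10 / 9)) ltac:(lra).
have [D [DD0 DD1 DD2 DD3]] := common_bound D1 D2 D3.
pose K := (2 * a ^+ 2 + 1) * (3 / 2).
have K0 : 0 < K by rewrite mulr_gt0 // ltr_wpDl // mulr_ge0 ?exprn_ge0 // ltW.
pose rho := ln (3 / 2 : R) / B%:R.
have rho0 : 0 < rho by rewrite divr_gt0 ?ltr0n // ln_gt0 //; lra.
have main : \forall n \near \oo, 1 - prob X alpha (unique_component_event R X n)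
            <= K * expR (- (rho * n%:R)).
  near=> n.
  have hn : (h <= n)%N by near: n; exact: nbhs_infty_ge.
  have Dn : (B * D <= n)%N by near: n; exact: nbhs_infty_ge.
  pose d := (n %/ B)%N.
  have Dd : (D <= d)%N by rewrite /d leq_divRL // mulnC.
  have d0 := leq_trans DD0 Dd.
  have Bdn : (B * d <= n)%N by rewrite mulnC leq_divM.
  have nBd : (n < B * d.+1)%N by rewrite mulnC -ltn_divLR.
  have nBdR : n%:R <= B%:R * d.+1%:R :> R by rewrite -natrM ler_nat ltnW.
  have h1 := HD1 d (leq_trans DD1 Dd).
  have h2 := HD2 d (leq_trans DD2 Dd).
  have h3 := HD3 d (leq_trans DD3 Dd).
  have dsq : 1 <= d.+1%:R ^+ 2 :> R by rewrite exprn_ege1 // ler1n.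
  have n2 : (4 * n * d < 2 ^ d)%N.
    have : (4 * n * d)%:R < (2 ^ d)%:R :> R; last by rewrite ltr_nat.
    rewrite natrX; apply: lt_le_trans h1; rewrite mulrDl mul1r.
    apply: (@le_lt_trans _ _ (4 * B%:R * d.+1%:R ^+ 2)); last by rewrite ltrDl (lt_le_trans ltr01).
    rewrite -mulnA !natrM -mulrA; apply: ler_wpM2l => //; rewrite expr2 mulrA.
    by apply: ler_pM => //; rewrite ler_nat.
  pose Y0 : R := (10 / 9) ^+ d.+1.
  have aN : 1 <= alpha ^+ (2 * n) * Y0 := leaf_loss (p9 2 n d MB nBd).
  have et : 3 * beta + (2 / 3) ^+ d * Y0 <= eta.
    rewrite [leRHS]splitr; exact: lerD eq_beta (depth_loss eta0 h2).
  have aw : 1 <= alpha ^+ (2 * C) * (1 + beta) := edge_loss beta01 (pow _ MC).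
  have [p pq Hp] := bound n d alpha beta Y0 eta al0 al1 hn d0 Bdn nBd n2 (ltW beta0)
    beta3 aw aN et (ltW eta0) eta_le1.
  apply: (le_trans Hp).
  have t1 : #|A|%:R ^+ (4 * n) * eta ^+ d.-1 <= 2 * a ^+ 2 * (2 / 3) ^+ d.
    apply: (@le_trans _ _ (a ^+ d.+1 * eta ^+ d.-1)).
      apply: ler_wpM2r; first by rewrite exprn_ge0 // ltW.
      rewrite /a -exprM; apply: ler_weXn2l => //.
      by rewrite -mulnA leq_mul2l (ltnW nBd) orbT.
    by have := union_weight d.-1 a1'; rewrite (prednK d0).
  have t2 : p <= (2 / 3) ^+ d := existence_weight (ltnW nBd) pq (p9 q n d Mq nBd) h3.
  apply: (@le_trans _ _ ((2 * a ^+ 2 + 1) * (2 / 3) ^+ d)).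
    by rewrite mulrDl mul1r lerD.
  rewrite /K -mulrA; apply: ler_wpM2l; last exact: exponential_rate.
  by rewrite addr_ge0 // mulr_ge0 // exprn_ge0 // ltW.
split; last by exists K, rho.
apply: (exponential_cvg K0 rho0) main => n.
by rewrite probE; apply: pr_le1.
Unshelve. all: by end_near.
Qed.
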